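(* Let $\alpha>-1$, $r\in\mathbb{N}$, and $0<\theta<1$ be fixed. For $n\in\mathbb{N}$ let $m_n$ be the largest integer such that $2j(m_n)\le n$. Then $Q^{\mathrm{2TL}}_{j(m_n)}$ uses at most $n$ nodes, and there are constants $C_1,C_2>0$ independent of $n$ such that for all $n\in\mathbb{N}$ \[ C_1 n^{-3r/4}\;\le\;\mathrm{Int}_n\big(\mathbf{W}^r_{1,w_r}(\mathbb{R})\big)\;\le\;\sup_{f\in \mathbf{W}^r_{1,w_r}(\mathbb{R})}\Big|\int_{\mathbb{R}} f(x)w(x)\,dx-Q^{\mathrm{2TL}}_{j(m_n)}f\Big|\;\le\; C_2\, n^{-r/2}. \]
   Context: For $r\in\mathbb{N}_0$ let $w_r(x)=|x|^{\alpha+r/2}e^{-|x|}$ on $\mathbb{R}$ and $w:=w_0$. The space $L_{1,w_r}(\mathbb{R})$ consists of measurable $f$ with $\|f\|_{L_{1,w_r}}=\int_{\mathbb{R}}|f(x)w_r(x)|\,dx<\infty$; $W^r_{1,w_r}(\mathbb{R})$ consists of $f\in L_{1,w_r}(\mathbb{R})$ with weak derivatives $f^{(k)}\in L_{1,w_r}(\mathbb{R})$ for $0\le k\le r$, normed by $\sum_{k=0}^r\|f^{(k)}\|_{L_{1,w_r}}$; its elements are identified with their continuous representatives, and $\mathbf{W}^r_{1,w_r}(\mathbb{R})$ is its closed unit ball. For a set $\mathbf{F}$ of continuous functions on $\mathbb{R}$, $\mathrm{Int}_n(\mathbf{F})=\inf_Q\sup_{f\in\mathbf{F}}\big|\int_{\mathbb{R}}f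 w\,dx-Qf\big|$, the infimum over all quadratures $Qf=\sum_{i=1}^k\lambda_if(x_i)$ with $k\le n$, arbitrary nodes $x_i\in\mathbb{R}$ and real weights $\lambda_i$. Let $p_m$ be the orthonormal polynomials on $(0,\infty)$ for the Laguerre weight $x^\alpha e^{-x}$, with zeros $x_{m,1}<\dots<x_{m,m}$ and Cotes numbers $\lambda_{m,k}=\int_0^\infty\ell_k(x)x^\alpha e^{-x}dx$, $\ell_k(x)=\prod_{i\ne k}\frac{x-x_{m,i}}{x_{m,k}-x_{m,i}}$. For fixed $\theta\in(0,1)$, $j(m)$ is the largest integer with $x_{m,j(m)}\le4\theta m$, and $Q^{\mathrm{2TL}}_{j(m)}f=\sum_{k=1}^{j(m)}\lambda_{m,k}\big(f(x_{m,k})+f(-x_{m,k})\big)$. *)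

(* Defs.v *)
From mathcomp Require Import all_boot all_order all_algebra.
From mathcomp Require Import all_classical all_reals all_analysis.
Set Implicit Arguments. Unset Strict Implicit. Unset Printing Implicit Defensive.
Import Order.TTheory GRing.Theory Num.Theory.
Import numFieldNormedType.Exports.
Local Open Scope classical_set_scope.
Local Open Scope ring_scope.

Section Defs.
Variable R : realType.
Notation mu := (@lebesgue_measure R).

Definition wr (alpha : R) (r : nat) (x : R) : R :=
  (`|x|) `^ (alpha + r%:R / 2) * expR (- `|x|).

Definition wnorm (alpha : R) (r : nat) (f : R -> R) : \bar R :=
  (\int[mu]_x (`|f x * wr alpha r x|)%:E)%E.

Definition in_L1w (alpha : R) (r : nat) (f : R -> R) : Prop :=
  measurable_fun setT f /\ (wnorm alpha r f < +oo)%E.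

Definition test_fun (phi : R -> R) : Prop :=
  (forall n x, derivable (derive1n n phi) x 1) /\
  exists M : R, forall x, M < `|x| -> phi x = 0.

Definition weak_deriv (k : nat) (f g : R -> R) : Prop :=
  forall phi, test_fun phi ->
    mu.-integrable setT (fun x => (f x * derive1n k phi x)%:E) /\
    mu.-integrable setT (fun x => (g x * phi x)%:E) /\
    (\int[mu]_x (f x * derive1n k phi x)%:E
       = ((-1) ^+ k)%:E * \int[mu]_x (g x * phi x)%:E)%E.

(* closed unit ball of W^r_{1,w_r}(R), elements = continuous representatives;
   g k plays the role of f^(k) (g 0 = f) *)
Definition W_ball (alpha : R) (r : nat) : set (R -> R) :=
  [set f : R -> R | continuous f /\
     exists g : nat -> R -> R,
       g 0%N = f /\
       (forall k, (k <= r)%N -> in_L1w alpha r (g k)) /\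
       (forall k, (0 < k <= r)%N -> weak_deriv k f (g k)) /\
       (\sum_(k < r.+1) wnorm alpha r (g k) <= 1)%E].

Definition quad_apply (Q : seq (R * R)) (f : R -> R) : R :=
  \sum_(p <- Q) p.2 * f p.1.

Definition quad_err (alpha : R) (Q : seq (R * R)) (f : R -> R) : \bar R :=
  (`| \int[mu]_x (f x * wr alpha 0 x)%:E - (quad_apply Q f)%:E |)%E.

Definition sup_err (alpha : R) (F : set (R -> R)) (Q : seq (R * R)) : \bar R :=
  ereal_sup [set quad_err alpha Q f | f in F].

Definition Int_n (alpha : R) (n : nat) (F : set (R -> R)) : \bar R :=
  ereal_inf [set sup_err alpha F Q | Q in [set Q : seq (R * R) | (size Q <= n)%N]].

Definition laguerre_orthonormal (alpha : R) (P : nat -> {poly R}) : Prop :=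
  forall m, size (P m) = m.+1 /\ 0 < lead_coef (P m) /\
    forall k, (\int[mu]_(x in [set x : R | (0 < x)%R])
                 ((P m).[x] * (P k).[x] * x `^ alpha * expR (- x))%:E
               = ((m == k)%:R)%:E)%E.

Definition zeros_of (p : {poly R}) (s : seq R) : Prop :=
  sorted <%R s /\ forall x, root p x <-> x \in s.

Definition lagr (s : seq R) (k : nat) (x : R) : R :=
  \prod_(i < size s | i != k :> nat) ((x - s`_i) / (s`_k - s`_i)).

(* Cotes number lambda_{m,k+1} (0-based k) *)
Definition cotes (alpha : R) (s : seq R) (k : nat) : R :=
  Rintegral mu [set x : R | (0 < x)%R] (fun x => lagr s k x * x `^ alpha * expR (- x)).

(* j(m): largest j (0 <= j <= m) with x_{m,j} <= 4 theta m (j = 0 allowed);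
   s = zeros x_{m,1} < ... < x_{m,m}, stored 0-based *)
Definition jidx (theta : R) (m : nat) (s : seq R) : nat :=
  \max_(j < (size s).+1 | (j == 0%N :> nat) || (s`_(j.-1) <= 4 * theta * m%:R)) j.

Definition Q2TL (alpha : R) (s : seq R) (j : nat) : seq (R * R) :=
  flatten [seq [:: (s`_k, cotes alpha s k); (- s`_k, cotes alpha s k)]
          | k <- iota 0 j].

End Defs.

(* Main.v *)
Require Import Defs.
From mathcomp Require Import all_boot all_order all_algebra.
From mathcomp Require Import all_classical all_reals all_analysis.
From mathcomp Require Import measurable_realfun ring lra.
Set Implicit Arguments. Unset Strict Implicit. Unset Printing Implicit Defensive.
Import Order.TTheory GRing.Theory Num.Theory.
Import numFieldNormedType.Exports.
Local Open Scope classical_set_scope.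
Local Open Scope ring_scope.

(* Upper bound. Folding f(x) + f(-x) reduces the claim to the half line, with the weight
   w(x) = x^alpha e^(-x). Let e_0(t) be the difference of the mass of w on (0,t] and the sum
   of the Cotes numbers of the nodes in (0,t], and let e_(i+1) be the primitive of e_i
   vanishing at 0. Repeated integration by parts on (0,T], with T = 4 theta m, expresses the
   error through the f^(i)(T) e_i(T), i < r, the integral of f^(r) e_(r-1) and the tail
   beyond T, so that |e_i(t)| <= C (t/m)^((i+1)/2) w(t) on (0,T] gives the rate.
   Gaussian exactness makes e_i orthogonal to all polynomials of degree <= 2m - 2 - i; as e_i
   has no more turning points than this forces it to have sign changes, it has a zero
   between any two nodes whose indices differ by more than about i/2. This yields the
   Markov-Stieltjes inequalities for e_0 and, by integrating from zeros, the estimate of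
   e_i by the local mesh width. The mesh width is bounded by Sturm comparison for the
   Liouville form of the Laguerre equation in y = sqrt x.
   Lower bound. Among n + 1 consecutive unit intervals one contains no node in its
   interior; a smooth bump there gives an error of order n^(-r/2), even larger than
   n^(-3r/4). *)

(** * Integrals over half-open intervals and integration by parts without regularity *)

Section Intervals.
Variable R : realType.
Notation mu := (@lebesgue_measure R).
Implicit Types (f g h : R -> R) (a b c : R) (D E : set (measurableTypeR R)).

(** For [i = r - 1] the factor [(t/m)^((i+1)/2)] of the kernel bound is [m^(-r/2) w_r / w]: this
    produces both the rate and the weight [w_r]. Then [j(m) <= m] and the maximality of [m_n] turn
    [m] into [n]. Three obstacles shape the details. The kernels are not known beforehand to be
    integrable on the half line, so orthogonality is a limit of integrals over [(0, n]], and decay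
    at infinity is carried along in the same induction. Sturm comparison is out of reach for [t] of
    order [1/m], where [(1/4 - alpha^2)/y^2] is not controlled, and it needs room to the right of
    [4 theta m]: below [K0/m] a crude bound takes over, resting on the lower bound [(alpha+1)/m] for
    the zeros, and the room comes from replacing [theta] by [(1+theta)/2]. Finally, the derivatives
    are weak and the weight may vanish or blow up at 0: the derivatives below order [r] are replaced
    by representatives whose increments are integrals of the next one, and integration by parts
    becomes Fubini on a triangle. *)

Definition itg D h : Prop := mu.-integrable D (EFin \o h).

(** Half-open intervals split into disjoint pieces. For [b <= a] the value is 0, not minus the
    reversed integral. *)
Definition Int a b h : R := \int[mu]_(x in `]a, b]) h x.

Lemma itgS D E h : measurable D -> measurable E -> E `<=` D -> itg D h -> itg E h.
Proof. by move=> mD mE ED; exact: integrableS. Qed.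

Lemma itg_oc a b c d h : a <= c -> d <= b -> itg `]a, b] h -> itg `]c, d] h.
Proof.
move=> ac db; apply: itgS => //.
by move=> x /=; rewrite !in_itv/= => /andP[cx xd]; rewrite (le_lt_trans ac cx) (le_trans xd db).
Qed.

Lemma eq_itg D h g : measurable D -> (forall x, D x -> h x = g x) -> itg D h -> itg D g.
Proof.
rewrite /itg => mD hg; apply: (eq_integrable mD) => x /set_mem Dx /=.
by rewrite hg.
Qed.

Lemma itgD D h g : measurable D -> itg D h -> itg D g -> itg D (fun x => h x + g x).
Proof. by move=> mD ih ig; have := integrableD mD ih ig; apply: (eq_integrable mD). Qed.

Lemma itgB D h g : measurable D -> itg D h -> itg D g -> itg D (fun x => h x - g x).
Proof. by move=> mD ih ig; have := integrableB mD ih ig; apply: (eq_integrable mD). Qed.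

Lemma itgZ D k h : measurable D -> itg D h -> itg D (fun x => k * h x).
Proof. by move=> mD ih; have := integrableZl mD k ih; apply: (eq_integrable mD). Qed.

Lemma itgN D h : measurable D -> itg D h -> itg D (fun x => - h x).
Proof. by move=> mD ih; have := integrableN ih; apply: (eq_integrable mD). Qed.

Lemma itg_norm D h : measurable D -> itg D h -> itg D (fun x => `|h x|).
Proof. by move=> mD ih; have := integrable_norm ih; apply: (eq_integrable mD). Qed.

Lemma itg_meas D h : itg D h -> measurable_fun D h.
Proof. by move/measurable_int/measurable_EFinP. Qed.

Lemma itg_le D h g : measurable D -> measurable_fun D h ->
  (forall x, D x -> `|h x| <= g x) -> itg D g -> itg D h.
Proof.
move=> mD mh hg ig; apply: (le_integrable mD _ _ ig); first exact/measurable_EFinP.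
move=> x Dx /=; rewrite lee_fin (le_trans (hg x Dx))//; exact: ler_norm.
Qed.

Lemma itg_sum D (I : Type) (s : seq I) (h : I -> R -> R) : measurable D ->
  (forall i, itg D (h i)) -> itg D (fun x => \sum_(i <- s) h i x).
Proof.
move=> mD ih.
have := @integrable_sum _ _ _ mu D mD I s xpredT (fun i => EFin \o h i).
move=> /(_ (fun i _ => ih i)); apply: (eq_integrable mD) => x _ /=.
by rewrite sumEFin.
Qed.

Lemma mu_oc a b : a <= b -> mu `]a, b]%classic = (b - a)%:E.
Proof.
move=> ab; rewrite lebesgue_measure_itv/= lte_fin.
by case: ltgtP ab => // -> _; rewrite subrr.
Qed.

Lemma itg_cst a b (k : R) : itg `]a, b] (fun=> k).
Proof.
have [ab|ba] := leP a b.
  by apply: measurable_bounded_integrable => //; [rewrite /= mu_oc// ltry|exact: bounded_cst].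
by rewrite set_itv_ge; [exact: integrable_set0|rewrite bnd_simp -leNgt ltW].
Qed.

Lemma itg_bounded a b h M : measurable_fun `]a, b] h ->
  (forall x, a < x <= b -> `|h x| <= M) -> itg `]a, b] h.
Proof.
by move=> mh hM; apply: (itg_le _ mh _ (itg_cst a b M)) => // x /=; rewrite in_itv/=; apply: hM.
Qed.

Lemma itgM D f h M : measurable D -> measurable_fun D f ->
  (forall x, D x -> `|f x| <= M) -> itg D h -> itg D (fun x => f x * h x).
Proof.
move=> mD mf fM ih; apply: (@itg_le D _ (fun x => M * `|h x|)) => //.
- by apply: measurable_funM => //; exact: itg_meas.
- by move=> x Dx; rewrite normrM ler_wpM2r// fM.
- by apply: itgZ => //; exact: itg_norm.
Qed.

Lemma Int_split a b c h : a <= c -> c <= b -> itg `]a, b] h ->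
  Int a b h = Int a c h + Int c b h.
Proof.
move=> ac cb ih; rewrite /Int; apply/eqP; rewrite addrC -subr_eq; apply/eqP.
by rewrite (Rintegral_itvB ih).
Qed.

Lemma Int_ge a b h : b <= a -> Int a b h = 0.
Proof. by move=> ba; rewrite /Int set_itv_ge ?Rintegral_set0// bnd_simp -leNgt. Qed.

Lemma eq_Int a b h g : (forall x, a < x <= b -> h x = g x) -> Int a b h = Int a b g.
Proof.
by move=> hg; apply: eq_Rintegral => x /set_mem; rewrite /= in_itv/= => /hg.
Qed.

Lemma IntD a b h g : itg `]a, b] h -> itg `]a, b] g ->
  Int a b (fun x => h x + g x) = Int a b h + Int a b g.
Proof. by move=> ih ig; rewrite /Int RintegralD. Qed.

Lemma IntB a b h g : itg `]a, b] h -> itg `]a, b] g ->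
  Int a b (fun x => h x - g x) = Int a b h - Int a b g.
Proof. by move=> ih ig; rewrite /Int RintegralB. Qed.

Lemma IntZ a b k h : itg `]a, b] h -> Int a b (fun x => k * h x) = k * Int a b h.
Proof. by move=> ih; rewrite /Int RintegralZl. Qed.

Lemma IntN a b h : itg `]a, b] h -> Int a b (fun x => - h x) = - Int a b h.
Proof.
by move=> ih; rewrite -mulN1r -IntZ//; apply: eq_Int => x _; rewrite mulN1r.
Qed.

Lemma Int_cst a b k : a <= b -> Int a b (fun=> k) = k * (b - a).
Proof. by move=> ab; rewrite /Int Rintegral_cst//= mu_oc. Qed.

Lemma Int_ge0 a b h : (forall x, a < x <= b -> 0 <= h x) -> 0 <= Int a b h.
Proof. by move=> h0; apply: Rintegral_ge0 => x /=; rewrite in_itv/=; exact: h0. Qed.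

Lemma Int_le a b h g : itg `]a, b] h -> itg `]a, b] g ->
  (forall x, a < x <= b -> h x <= g x) -> Int a b h <= Int a b g.
Proof. by move=> ih ig hg; apply: le_Rintegral => // x /=; rewrite in_itv/=; exact: hg. Qed.

Lemma Int_norm a b h : itg `]a, b] h -> `|Int a b h| <= Int a b (fun x => `|h x|).
Proof. by move=> ih; apply: le_normr_Rintegral. Qed.

Lemma Int_norm_le a b h g : itg `]a, b] h -> itg `]a, b] g ->
  (forall x, a < x <= b -> `|h x| <= g x) -> `|Int a b h| <= Int a b g.
Proof.
move=> ih ig hg; apply: le_trans (Int_norm ih) _.
by apply: Int_le => //; apply: itg_norm.
Qed.

Lemma Int_bound a b h M : a <= b -> itg `]a, b] h ->
  (forall x, a < x <= b -> `|h x| <= M) -> `|Int a b h| <= M * (b - a).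
Proof.
by move=> ab ih hM; rewrite -Int_cst//; apply: Int_norm_le => //; exact: itg_cst.
Qed.

Lemma Int_mono a b c d h : itg `]a, b] h -> (forall x, a < x <= b -> 0 <= h x) ->
  a <= c -> d <= b -> Int c d h <= Int a b h.
Proof.
move=> ih h0 ac db; have [dc|cd] := leP d c; first by rewrite Int_ge// Int_ge0.
have icd := itg_oc ac db ih.
rewrite (@Int_split a b c)//; last by rewrite (le_trans (ltW cd)).
rewrite (@Int_split c b d)//; [|exact: ltW|exact: (itg_oc ac (lexx b))].
rewrite addrCA lerDl addr_ge0// Int_ge0// => x /andP[x1 x2]; apply: h0; apply/andP; split; move: ac db cd x1 x2; lra.
Qed.

Lemma itg_cc a (b : itv_bound R) h :
  itg [set` Interval (BRight a) b] h -> itg [set` Interval (BLeft a) b] h.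
Proof.
move=> /integrableP[mh ih]; have mh' := (emeasurable_fun_itv_obnd_cbndP _ _ _).1 mh.
apply/integrableP; split=> //.
rewrite -integral_itv_obnd_cbnd//; exact: measurableT_comp.
Qed.

Lemma continuous_Int a b h : itg `]a, b] h -> {within `[a, b], continuous (fun x => Int a x h)}.
Proof.
move=> ih; have [ab|ba] := leP a b; last first.
  by rewrite set_itv_ge ?bnd_simp -?ltNge//; exact: continuous_subspace0.
have := parameterized_integral_continuous ab (itg_cc ih).
apply: subspace_eq_continuous => x; rewrite inE/= in_itv/= => /andP[ax xb].
rewrite /from_subspace /= /parameterized_integral /Int. by rewrite Rintegral_itv_obnd_cbnd//; exact: (itg_oc (lexx a) xb).
Qed.

Lemma within_continuous_meas a b h : {within `[a, b], continuous h} -> measurable_fun `]a, b] h.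
Proof.
move=> ch; apply: measurable_funS (subspace_continuous_measurable_fun (measurable_itv `[a, b]) ch) => //.
exact: subset_itv_oc_cc.
Qed.

Lemma meas_Int a b h : itg `]a, b] h -> measurable_fun `]a, b] (fun x => Int a x h).
Proof. by move=> ih; apply: within_continuous_meas; exact: continuous_Int. Qed.

Lemma Int_bounded a b h : itg `]a, b] h ->
  forall x, a < x <= b -> `|Int a x h| <= Int a b (fun x => `|h x|).
Proof.
move=> ih x /andP[ax xb]; have ix := itg_oc (lexx a) xb ih.
by apply: le_trans (Int_norm ix) _; apply: Int_mono => //; exact: itg_norm.
Qed.

Lemma itg_Int a b h : itg `]a, b] h -> itg `]a, b] (fun x => Int a x h).
Proof.
by move=> ih; apply: itg_bounded (meas_Int ih) _; exact: Int_bounded.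
Qed.

Lemma IntE a b h : Int a b h = \int[mu]_x (h \_ `]a, b] x).
Proof. by rewrite /Int Rintegral_mkcond. Qed.

(* Fubini on the triangle [x < y]: integration by parts with no regularity of [h]. *)
Lemma Fubini_parts a b (F f h : R -> R) : itg `]a, b] f -> itg `]a, b] h ->
  (forall x, a < x <= b -> F x = F b - Int x b f) ->
  Int a b (fun x => F x * h x) =
  F b * Int a b h - Int a b (fun y => f y * Int a y h).
Proof.
move=> jf jh FE.
pose f' := f \_ `]a, b]; pose h' := h \_ `]a, b].
have jf' : itg setT f' by rewrite /itg -restrict_EFin; apply/integrable_restrict => //=; rewrite setTI.
have jh' : itg setT h' by rewrite /itg -restrict_EFin; apply/integrable_restrict => //=; rewrite setTI.
(* The function [h(x) f(y)] on the triangle [a < x < y <= b]. Integrating in [y] first gives the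
   integral of [(F b - F x) h x], integrating in [x] first that of [f y * Int a y h]. *)
pose phi (z : measurableTypeR R * measurableTypeR R) : R := h' z.1 * f' z.2 * (\1_[set z : R * R | z.1 < z.2] z).
have mphi : measurable_fun setT phi.
  apply: measurable_funM; first apply: measurable_funM.
  - by apply: measurableT_comp; [exact: itg_meas jh'|exact: measurable_fst].
  - by apply: measurableT_comp; [exact: itg_meas jf'|exact: measurable_snd].
  - apply: measurable_indic; rewrite -[X in measurable X]setTI.
    have -> : [set z : R * R | z.1 < z.2] = (fun z : R * R => z.1 < z.2) @^-1` [set true].
      by apply/seteqP; split=> z /=.
    exact: measurable_fun_ltr.
have iphi : (mu \x mu)%E.-integrable setT (EFin \o phi).
  apply/integrable12ltyP; first exact/measurable_EFinP.
  have bnd x y : `|phi (x, y)| <= `|h' x| * `|f' y|.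
    rewrite /phi /= !normrM ler_piMr ?mulr_ge0// indicE.
    by case: (_ \in _); rewrite ?normr1 ?normr0.
  apply: (@le_lt_trans _ _ (\int[mu]_x ((`|h' x|)%:E * \int[mu]_y (`|f' y|)%:E))%E).
    apply: ge0_le_integral => //.
    - by move=> x _; apply: integral_ge0.
    - apply: (@measurable_fun_fubini_tonelli_F _ _ (measurableTypeR R) (measurableTypeR R) R mu (abse \o (EFin \o phi))) => //=.
      by apply: measurableT_comp => //; exact/measurable_EFinP.
    - by apply: emeasurable_funM => //; apply/measurable_EFinP; apply: measurableT_comp => //; exact: itg_meas.
    - move=> x _; rewrite -ge0_integralZl//; last first.
        by apply/measurable_EFinP; apply: measurableT_comp => //; exact: itg_meas.
      apply: ge0_le_integral => //.
      + by apply: measurableT_comp => //; apply/measurable_EFinP; exact: (measurableT_comp mphi).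
      + by apply: emeasurable_funM => //; apply/measurable_EFinP; apply: measurableT_comp => //; exact: itg_meas.
      + by move=> y _; rewrite -EFinM lee_fin; exact: bnd.
  have /integrableP[_ hlt] := jh'; have /integrableP[_ flt] := jf'.
  rewrite ge0_integralZr//; [|by apply/measurable_EFinP; apply: measurableT_comp => //; exact: itg_meas|exact: integral_ge0].
  by rewrite lte_mul_pinfty// ?integral_ge0// ge0_fin_numE// ?integral_ge0.
have := Fubini iphi => /=.
have -> : (\int[mu]_x \int[mu]_y (phi (x, y))%:E = (Int a b (fun x => (F b - F x) * h x))%:E)%E.
  have E1 x : (\int[mu]_y (phi (x, y))%:E = ((fun x => (F b - F x) * h x) \_ `]a, b] x)%:E)%E.
    have ix := itg_oc (lexx a).
    rewrite patchE; case: ifPn => xab; last first.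
      by apply: integral0_eq => y _; rewrite /phi /= /h' patchE (negbTE xab) !mul0r.
    move: (xab); rewrite inE/= in_itv/= => /andP[ax xb].
    transitivity (\int[mu]_(y in `]x, b]) (h x * f y)%:E)%E.
      rewrite [RHS]integral_mkcond; apply: eq_integral => y _.
      rewrite /phi /= /h' /f' !patchE xab indicE.
      have -> : ((x, y) \in [set z : R * R | z.1 < z.2]) = (x < y) by apply/idP/idP; rewrite inE.
      rewrite !mem_setE !in_itv/=; case: (ltP x y) => xy /=; last by rewrite mulr0.
      by rewrite (lt_trans ax xy)/=; case: ifPn => _; rewrite mulr1 ?mulr0.
    have jx : itg `]x, b] f := itg_oc (ltW ax) (lexx b) jf.
    have jx' : itg `]x, b] (fun y => h x * f y) by exact: itgZ.
    rewrite -[LHS]fineK; last exact: integrable_fin_num.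
    by congr EFin; have := IntZ (h x) jx; rewrite /Int /Rintegral => ->; rewrite (FE x) ?ax// /Int /Rintegral; ring.
  under eq_integral do rewrite E1.
  have jF : itg `]a, b] (fun x => (F b - F x) * h x).
    apply: (@itgM _ _ _ (Int a b (fun x => `|f x|))) => //.
    - apply: (@eq_measurable_fun _ _ _ _ _ (fun x => Int a b f - Int a x f)).
        move=> x; rewrite inE/= in_itv/= => /andP[ax xb].
        by rewrite (Int_split (ltW ax) xb)// (FE x) ?ax//; ring.
      by apply: measurable_funB => //; exact: meas_Int.
    - move=> x /=; rewrite in_itv/= => /andP[ax xb]; rewrite (FE x) ?ax// opprB addrC subrK.
      apply: le_trans (Int_norm (itg_oc (ltW ax) (lexx b) jf)) _.
      by apply: Int_mono => //; [exact: itg_norm|exact: ltW].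
  rewrite IntE /Rintegral fineK//.
  apply: integrable_fin_num => //; rewrite -[X in _.-integrable _ X]restrict_EFin.
  by apply/integrable_restrict => //=; rewrite setTI.
have -> : (\int[mu]_y \int[mu]_x (phi (x, y))%:E = (Int a b (fun y => f y * Int a y h))%:E)%E.
  have E1 y : (\int[mu]_x (phi (x, y))%:E = ((fun y => f y * Int a y h) \_ `]a, b] y)%:E)%E.
    rewrite patchE; case: ifPn => yab; last first.
      apply: integral0_eq => x _; have f0 : f' y = 0 by rewrite /f' patchE (negbTE yab).
      by rewrite /phi /= f0 mulr0 mul0r.
    move: (yab); rewrite inE/= in_itv/= => /andP[ay yb].
    transitivity (\int[mu]_(x in `]a, y[) (f y * h x)%:E)%E.
      rewrite [RHS]integral_mkcond; apply: eq_integral => x _.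
      rewrite /phi /= /h' /f' !patchE yab indicE.
      have -> : ((x, y) \in [set z : R * R | z.1 < z.2]) = (x < y) by apply/idP/idP; rewrite inE.
      rewrite !mem_setE !in_itv/=; case: (ltP x y) => xy /=; last by rewrite andbF mulr0.
      by rewrite (le_trans (ltW xy) yb)/= !andbT; case: ifPn => _; rewrite mulr1 ?mul0r// mulrC.
    have jy : itg `]a, y] h := itg_oc (lexx a) yb jh.
    have jy' : itg `]a, y] (fun x => f y * h x) by exact: itgZ.
    rewrite integral_itv_bndo_bndc; last first.
      by apply: measurable_funS (measurable_int _ jy') => //; exact: subset_itv_oo_oc.
    rewrite -[LHS]fineK; last exact: integrable_fin_num.
    by congr EFin; have := IntZ (f y) jy; rewrite /Int /Rintegral => ->.
  under eq_integral do rewrite E1.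
  have jF : itg `]a, b] (fun x => f x * Int a x h).
    apply: (@eq_itg _ (fun x => Int a x h * f x)) => //; first by move=> x _; rewrite mulrC.
    apply: (@itgM _ _ _ (Int a b (fun x => `|h x|))) => //; first exact: meas_Int.
    by move=> x /=; rewrite in_itv/=; exact: Int_bounded.
  rewrite IntE /Rintegral fineK//.
  apply: integrable_fin_num => //; rewrite -[X in _.-integrable _ X]restrict_EFin.
  by apply/integrable_restrict => //=; rewrite setTI.
move=> [<-].
have jF : itg `]a, b] (fun x => F x * h x).
  apply: (@itgM _ _ _ (`|F b| + Int a b (fun x => `|f x|))) => //.
  - apply: (@eq_measurable_fun _ _ _ _ _ (fun x => F b - Int a b f + Int a x f)).
      move=> x; rewrite inE/= in_itv/= => /andP[ax xb].
      by rewrite (Int_split (ltW ax) xb)// (FE x) ?ax//; ring.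
    by apply: measurable_funD => //; exact: meas_Int.
  - move=> x /=; rewrite in_itv/= => /andP[ax xb]; rewrite (FE x) ?ax//.
    apply: le_trans (ler_normB _ _) _; rewrite lerD2l.
    apply: le_trans (Int_norm (itg_oc (ltW ax) (lexx b) jf)) _.
    by apply: Int_mono => //; [exact: itg_norm|exact: ltW].
rewrite [X in _ - X](@eq_Int _ _ _ (fun x => F b * h x - F x * h x)); last by move=> x _; rewrite mulrBl.
rewrite IntB//; last exact: itgZ.
by rewrite IntZ//; ring.
Qed.

End Intervals.

(** * Fundamental theorem, limits of integrals, sign changes of polynomials *)

Section IntervalsTwo.
Variable R : realType.
Notation mu := (@lebesgue_measure R).
Implicit Types (f g h F : R -> R) (a b c : R) (D E : set (measurableTypeR R)).

Lemma continuous_itg a b h : (forall x, a <= x <= b -> {for x, continuous h}) ->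
  itg `]a, b] h.
Proof.
move=> ch; apply: (@itgS _ `[a, b]) => //; first exact: subset_itv_oc_cc.
apply: continuous_compact_integrable; first exact: segment_compact.
by apply: continuous_in_subspaceT => x /set_mem /=; rewrite in_itv/=; exact: ch.
Qed.

Lemma Int_FTC a b F f : a <= b ->
  (forall x, a <= x <= b -> is_derive x 1 F (f x)) ->
  (forall x, a <= x <= b -> {for x, continuous f}) ->
  Int a b f = F b - F a.
Proof.
rewrite le_eqVlt => /predU1P[<- _ _|ab dF cf]; first by rewrite Int_ge// subrr.
have cf' : {within `[a, b], continuous f}.
  by apply: continuous_in_subspaceT => x /set_mem /=; rewrite in_itv/=; exact: cf.
have cF x : a <= x <= b -> {for x, continuous F}.
  by move=> /dF dFx; apply/differentiable_continuous/derivable1_diffP; exact: ex_derive.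
have dF' : derivable_oo_LRcontinuous F a b.
  split.
  - by move=> x; rewrite in_itv/= => /andP[/ltW ax /ltW xb]; apply: (@ex_derive _ _ _ _ _ _ (f x)); apply: dF; rewrite ax.
  - by apply: cvg_at_right_filter; apply: cF; rewrite lexx ltW.
  - by apply: cvg_at_left_filter; apply: cF; rewrite lexx ltW.
have dFE : {in `]a, b[, derive1 F =1 f}.
  move=> x; rewrite in_itv/= => /andP[/ltW ax /ltW xb].
  by rewrite derive1E; have [_ ->] : is_derive x 1 F (f x) by apply: dF; rewrite ax.
have := continuous_FTC2 ab cf' dF' dFE.
have itf : itg `]a, b] f by exact: continuous_itg.
rewrite /Int /Rintegral => E.
by rewrite integral_itv_obnd_cbnd ?E//; exact: measurable_int itf.
Qed.

(** Dominated convergence with [|h|] as bound. The lower end moves too, because the weight may be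
    unbounded at 0 and identities are then available only away from it. *)
Lemma Int_cvg h (u v : nat -> R) : itg `]0, +oo[ h ->
  (forall n, 0 <= u n) -> u @ \oo --> (0 : R) -> v @ \oo --> +oo ->
  Int (u n) (v n) h @[n --> \oo] --> \int[mu]_(x in `]0, +oo[) h x.
Proof.
move=> ih u0 cu cv.
pose fn n (x : R) := ((h \_ `]u n, v n]) x)%:E.
have mD : measurable (`]0, +oo[%classic : set (measurableTypeR R)) by [].
have mh := measurable_int _ ih.
have sub n : `]u n, v n]%classic `<=` (`]0, +oo[%classic : set R).
  by move=> x /=; rewrite !in_itv/= andbT => /andP[ux _]; exact: le_lt_trans (u0 n) ux.
have mfn n : measurable_fun (`]0, +oo[%classic : set (measurableTypeR R)) (fn n).
  have -> : fn n = (EFin \o h) \_ `]u n, v n].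
    by apply/funext => x; rewrite /fn !patchE; case: ifP.
  apply/measurable_restrict => //.
  by rewrite setIidr//; apply: measurable_funS mh.
have cvf : {ae mu, forall x, `]0, +oo[%classic x -> fn ^~ x @ \oo --> (h x)%:E}.
  apply: aeW => x /=; rewrite in_itv/= andbT => x0.
  apply: cvg_near_cst; near=> n.
  rewrite /fn patchE mem_set//= in_itv/=; apply/andP; split.
    near: n; have /cvgrPdist_lt/(_ x x0) := cu; apply: filterS => n.
    by rewrite sub0r normrN; exact: le_lt_trans (ler_norm _).
  by near: n; move/cvgryPge : cv; exact.
have dom : {ae mu, forall x n, `]0, +oo[%classic x -> (`|fn n x| <= (`|h x|)%:E)%E}.
  apply: aeW => x n _; rewrite /fn patchE; case: ifPn => _ /=; rewrite lee_fin ?normr0//.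
have [_ _] := @dominated_convergence _ _ _ mu _ mD fn (EFin \o h) (fun x => (`|h x|)%:E) mfn mh cvf (itg_norm mD ih) dom.
have iE : (\int[mu]_(x in `]0%R, +oo[) (h x)%:E = (\int[mu]_(x in `]0%R, +oo[) h x)%:E)%E.
  by rewrite /Rintegral fineK//; exact: integrable_fin_num.
rewrite iE => cvI.
have : (EFin \o (fun n => Int (u n) (v n) h)) @ \oo --> (\int[mu]_(x in `]0%R, +oo[) h x)%:E.
  apply: cvg_trans cvI; apply: near_eq_cvg; near=> n => /=.
  rewrite /Int /Rintegral fineK; last by apply: integrable_fin_num => //; exact: itgS (sub n) ih.
  rewrite [RHS]integral_mkcond [LHS]integral_mkcond; apply: eq_integral => x _.
  rewrite /fn !patchE; case: (boolP (x \in `]u n, v n]%classic)) => xn /=; last by case: ifP.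
  by rewrite ifT//; apply/mem_set/(sub n)/set_mem.
by move/fine_cvgP => [_]; apply: cvg_trans; apply: near_eq_cvg; near=> n.
Unshelve. all: by end_near. Qed.

Lemma itg_ae0 D h : measurable D -> itg D h -> (forall x, D x -> 0 <= h x) ->
  \int[mu]_(x in D) h x = 0 -> {ae mu, forall x, D x -> h x = 0}.
Proof.
move=> mD ih h0 I0.
have : (\int[mu]_(x in D) `|(EFin \o h) x| = 0)%E.
  have -> : (\int[mu]_(x in D) `|(EFin \o h) x| = \int[mu]_(x in D) (h x)%:E)%E.
    by apply: eq_integral => x /set_mem Dx /=; rewrite ger0_norm// h0.
  by rewrite -[LHS]fineK; [rewrite -[fine _]/(Rintegral mu D h) I0|exact: integrable_fin_num].
move/(ae_eq_integral_abs mu mD (measurable_int _ ih)).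
by apply: filterS => x /= + Dx => /(_ Dx) [].
Qed.

Lemma poly_roots_seq (q : {poly R}) : q != 0 -> exists s : seq R, forall x, root q x -> x \in s.
Proof.
have [n] := ubnP (size q); elim: n q => // n IH q sq q0.
have [[z rz]|nr] := pselect (exists z, root q z); last first.
  by exists [::] => x rx; case: nr; exists x.
have /factor_theorem [q1 qE] := rz.
have q10 : q1 != 0 by apply: contraNneq q0 => e; rewrite qE e mul0r.
have [|s sP] := IH q1 _ q10.
  by move: sq; rewrite qE size_Mmonic ?monicXsubC// size_XsubC addn2.
exists (z :: s) => x; rewrite qE rootM root_XsubC in_cons => /orP[/sP ->|->//].
by rewrite orbT.
Qed.

Lemma ae0_poly (q : {poly R}) a b : a < b ->
  {ae mu, forall x, a < x < b -> q.[x] = 0} -> q = 0.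
Proof.
move=> ab [N [mN N0 sN]]; apply/eqP; apply: contraT => q0.
have [s sP] := poly_roots_seq q0.
have ms : measurable ([set` s] : set (measurableTypeR R)).
  by apply: countable_measurable => //; apply: finite_set_countable; exact: finite_seq.
have s0 : mu [set` s] = 0%E.
  by apply: countable_lebesgue_measure0; apply: finite_set_countable; exact: finite_seq.
have : (mu `]a, b[%classic <= mu (N `|` [set` s]))%E.
  apply: le_measure; rewrite ?inE//; first exact: measurableU.
  move=> x /=; rewrite in_itv/= => abx.
  have [rx|nrx] := boolP (root q x); first by right; exact: sP.
  by left; apply: sN => /= /(_ abx) qx; move: nrx; rewrite rootE qx eqxx.
have -> : mu (N `|` [set` s]) = 0%E by apply: null_set_setU.
by rewrite lebesgue_measure_itv/= lte_fin ab leNgt -EFinB lte_fin subr_gt0 ab.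
Qed.

(* [s] lists the positive roots of odd multiplicity. *)
Lemma poly_sign_changes (p : {poly R}) : p != 0 ->
  exists (s : seq R) (e : R), [/\ uniq s, all (fun z => (0 < z) && root p z) s,
    `|e| = 1 & forall x, 0 < x -> 0 <= e * p.[x] * \prod_(z <- s) (x - z)].
Proof.
have [n] := ubnP (size p); elim: n p => // n IH p sp p0.
have [[z z0 rz]|nr] := pselect (exists2 z, 0 < z & root p z); last first.
  (* Without positive roots the sign of [p] on the half line is its sign at 1, by the intermediate
     value theorem. *)
  exists [::], (Num.sg p.[1]); split=> //.
    by rewrite normr_sg; case: eqP => // /eqP p1; case: nr; exists 1.
  move=> x x0; rewrite big_nil mulr1.
  have p1 : p.[1] != 0 by apply/negP => r1; case: nr; exists 1.
  rewrite leNgt; apply/negP => neg.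
  have sgp : Num.sg p.[1] * p.[1] > 0 by rewrite -normrEsg normr_gt0.
  have [y [y0 ry]] : exists y, 0 < y /\ root (Num.sg p.[1] *: p) y.
    have [x1|x1] := leP x 1.
      have [|y] := @poly_ivt R (Num.sg p.[1] *: p) x 1 x1.
        by rewrite !hornerZ !ltW.
      by move=> /andP[xy _] ry; exists y; split=> //; exact: lt_le_trans xy.
    have [|y] := @poly_ivt R (- (Num.sg p.[1] *: p)) 1 x (ltW x1).
      by rewrite !hornerN !hornerZ oppr_le0 oppr_ge0 !ltW.
    by rewrite rootN => /andP[xy _] ry; exists y; split=> //; exact: lt_le_trans xy.
  by case: nr; exists y => //; move: ry; rewrite rootZ// sgr_eq0.
have /factor_theorem [q pE] := rz.
have q0 : q != 0 by apply: contraNneq p0 => e; rewrite pE e mul0r.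
have [|s [e [us /allP as_ e1 eP]]] := IH q _ q0.
  by move: sp; rewrite pE size_Mmonic ?monicXsubC// size_XsubC addn2.
have rP y : root q y -> root p y by rewrite pE rootM => ->.
(* One more factor ['X - z] flips the parity of the multiplicity of [z], so [z] leaves [s] if it is
   there and joins it otherwise. *)
have [zs|zs] := boolP (z \in s).
  exists (rem z s), e; split=> //.
  - exact: rem_uniq.
  - by apply/allP => y /mem_rem /as_ /andP[-> /rP].
  - move=> x x0; have := eP x x0; rewrite (perm_big _ (perm_to_rem zs))/= big_cons.
    by rewrite pE hornerM hornerXsubC !mulrA.
exists (z :: s), e; split=> //.
- by rewrite /= zs.
- by rewrite /= z0 rz; apply/allP => y /as_ /andP[-> /rP].
- move=> x x0; rewrite big_cons pE hornerM hornerXsubC.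
  have -> : e * (q.[x] * (x - z)) * ((x - z) * \prod_(j <- s) (x - j)) =
            (x - z) ^+ 2 * (e * q.[x] * \prod_(j <- s) (x - j)) by ring.
  by rewrite mulr_ge0// ?sqr_ge0// eP.
Qed.

End IntervalsTwo.

Lemma cvg0_le (R : realType) (a b : nat -> R) : (forall n, `|a n| <= b n) ->
  b @ \oo --> (0 : R) -> a @ \oo --> (0 : R).
Proof.
move=> ab /cvgrPdist_lt cb; apply/cvgrPdist_lt => e /cb; apply: filterS => n.
by rewrite !sub0r !normrN; apply: le_lt_trans; exact: le_trans (ab n) (ler_norm _).
Qed.

Section EqRintegral.
Variable R : realType.
Notation mu := (@lebesgue_measure R).

Lemma eq_RintR (D : set (measurableTypeR R)) (f g : R -> R) :
  (forall x : R, D x -> f x = g x) -> \int[mu]_(x in D) f x = \int[mu]_(x in D) g x.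
Proof. by move=> fg; apply: eq_Rintegral => x /set_mem /fg. Qed.

End EqRintegral.

Section DeriveFun.
Variable R : realType.
Implicit Types (f g : R -> R) (x : R).

Lemma derive_eqv f x a b : is_derive x 1 f a -> a = b -> is_derive x 1 f b.
Proof. by move=> ? <-. Qed.

Lemma deriveD_fun f g x a b : is_derive x 1 f a -> is_derive x 1 g b ->
  is_derive x 1 (fun y => f y + g y) (a + b).
Proof. by move=> fa gb; exact: is_deriveD. Qed.

Lemma deriveB_fun f g x a b : is_derive x 1 f a -> is_derive x 1 g b ->
  is_derive x 1 (fun y => f y - g y) (a - b).
Proof. by move=> fa gb; exact: is_deriveB. Qed.

Lemma deriveM_fun f g x a b : is_derive x 1 f a -> is_derive x 1 g b ->
  is_derive x 1 (fun y => f y * g y) (f x * b + g x * a).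
Proof. by move=> fa gb; exact: is_deriveM. Qed.

Lemma derive_comp_fun f g x a b : is_derive (f x) 1 g b -> is_derive x 1 f a ->
  is_derive x 1 (fun y => g (f y)) (b * a).
Proof. by move=> gb fa; exact: is_derive1_comp. Qed.

Lemma derive_cont f x a : is_derive x 1 f a -> {for x, continuous f}.
Proof. by move=> fa; apply/differentiable_continuous/derivable1_diffP; exact: ex_derive. Qed.

End DeriveFun.

Section PolyGrowth.
Variable R : realType.
Implicit Types (q : {poly R}) (x : R).

Lemma poly_bound_sum q x : `|q.[x]| <= \sum_(i < size q) `|q`_i| * `|x| ^+ i.
Proof.
rewrite horner_coef; apply: le_trans (ler_norm_sum _ _ _) _.
by apply: ler_sum => i _; rewrite normrM normrX.
Qed.

Lemma poly_growth q : exists C (N : nat), forall x, 1 <= x -> `|q.[x]| <= C * x ^+ N.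
Proof.
exists (\sum_(i < size q) `|q`_i|), (size q) => x x1.
apply: le_trans (poly_bound_sum _ _) _; rewrite mulr_suml; apply: ler_sum => i _.
by rewrite ler_wpM2l// ger0_norm ?(le_trans ler01)// ler_weXn2l// ltnW.
Qed.

End PolyGrowth.

(** * The Laguerre weight and its moment functional *)

Section Weight.
Variable R : realType.
Variable alpha : R.
Notation mu := (@lebesgue_measure R).
Implicit Types (p q : {poly R}) (x : R).

Definition wt x : R := x `^ alpha * expR (- x).

Definition Lf q : R := \int[mu]_(x in `]0, +oo[) (q.[x] * wt x).

Lemma pos_itv : [set x : R | 0 < x] = `]0, +oo[%classic.
Proof. by apply/seteqP; split=> x /=; rewrite in_itv/= andbT. Qed.

Lemma wt_gt0 x : 0 < x -> 0 < wt x.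
Proof. by move=> x0; rewrite mulr_gt0 ?expR_gt0// powR_gt0. Qed.

Lemma wt_ge0 x : 0 <= wt x.
Proof. by rewrite mulr_ge0 ?expR_ge0 ?powR_ge0. Qed.

Lemma meas_wt (D : set (measurableTypeR R)) : measurable_fun D wt.
Proof.
apply: measurable_funTS; apply: measurable_funM => //.
by apply: measurableT_comp.
Qed.

Lemma meas_horner q (D : set (measurableTypeR R)) : measurable_fun D (horner q).
Proof.
by apply: measurable_funTS; apply: continuous_measurable_fun; exact: continuous_horner.
Qed.

Lemma meas_polyw q (D : set (measurableTypeR R)) : measurable_fun D (fun x => q.[x] * wt x).
Proof. by apply: measurable_funM; [exact: meas_horner|exact: meas_wt]. Qed.

Lemma derive_wt x : 0 < x ->
  is_derive x 1 (fun y => y `^ (alpha + 1) * expR (- y)) ((alpha + 1 - x) * wt x).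
Proof.
move=> x0.
have d1 := is_derive1_powR (alpha + 1) x0.
have d2 : is_derive x 1 (fun y : R => expR (- y)) (expR (- x) * -1).
  by apply: (@derive_comp_fun _ -%R expR); exact: is_derive1_expR || exact: is_deriveNid.
apply: derive_eqv (deriveM_fun d1 d2) _.
rewrite addrK /wt powRD; last by rewrite (gt_eqF x0) implybT.
by rewrite powRr1 ?ltW//; ring.
Qed.

Lemma wt_powS x : 0 < x -> x `^ (alpha + 1) * expR (- x) = x * wt x.
Proof.
move=> x0; rewrite powRD; last by rewrite (gt_eqF x0) implybT.
by rewrite powRr1 ?ltW// /wt; ring.
Qed.

Lemma cont_wt x : 0 < x -> {for x, continuous wt}.
Proof.
move=> x0.
have d1 := is_derive1_powR alpha x0.
have d2 : is_derive x 1 (fun y : R => expR (- y)) (expR (- x) * -1).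
  by apply: (@derive_comp_fun _ -%R expR); exact: is_derive1_expR || exact: is_deriveNid.
exact: derive_cont (deriveM_fun d1 d2).
Qed.

Lemma expR_ge_pow (n : nat) x : 0 <= x -> x ^+ n / n`!%:R <= expR x.
Proof.
case: n => [|n] x0; last by apply: le_trans (expR_ge1Dxn n x0); rewrite lerDr.
by rewrite expr0 fact0 divr1; apply: le_trans (expR_ge1Dx x); rewrite lerDl.
Qed.

(** The power [alpha + n + 1] is dominated by a natural exponent [N], and [expR x >= x^N / N!]. *)
Lemma wt_decay (n : nat) : exists C, forall x, 1 <= x -> x ^+ n * wt x <= C / x.
Proof.
have [N aN] : exists N : nat, alpha + n%:R + 1 <= N%:R.
  exists (Num.bound `|alpha + n%:R + 1|); apply: ltW.
  by apply: le_lt_trans (ler_norm _) (archi_boundP _).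
exists N`!%:R => x x1; have x0 : 0 < x by exact: lt_le_trans x1.
rewrite ler_pdivlMr// /wt expRN.
have -> : x ^+ n * (x `^ alpha / expR x) * x = x `^ (alpha + n%:R + 1) / expR x.
  rewrite !powRD ?(gt_eqF x0) ?implybT// powRr1 ?ltW// powR_mulrn ?ltW//; ring.
rewrite ler_pdivrMr ?expR_gt0//.
apply: le_trans (_ : x ^+ N <= _); first by rewrite -(powR_mulrn N (ltW x0)) ler_powR.
by rewrite -ler_pdivrMl ?ltr0n ?fact_gt0// mulrC expR_ge_pow// ltW.
Qed.

Hypothesis alpha_gt : -1 < alpha.
Hypothesis iw : forall q, itg `]0, +oo[ (fun x => q.[x] * wt x).

Lemma LfD p q : Lf (p + q) = Lf p + Lf q.
Proof.
rewrite /Lf -RintegralD//; last 2 first. exact: iw. exact: iw.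
by apply: eq_RintR => x _; rewrite hornerD mulrDl.
Qed.

Lemma LfZ (c : R) p : Lf (c *: p) = c * Lf p.
Proof.
rewrite /Lf -RintegralZl//; last exact: iw.
by apply: eq_RintR => x _; rewrite hornerZ; ring.
Qed.

Lemma LfN p : Lf (- p) = - Lf p.
Proof. by rewrite -scaleN1r LfZ mulN1r. Qed.

Lemma LfB p q : Lf (p - q) = Lf p - Lf q.
Proof. by rewrite LfD LfN. Qed.

Lemma Lf0 : Lf 0 = 0.
Proof. by rewrite -(scale0r (0 : {poly R})) LfZ mul0r. Qed.

Lemma Lf_sum (I : Type) (s : seq I) (F : I -> {poly R}) :
  Lf (\sum_(i <- s) F i) = \sum_(i <- s) Lf (F i).
Proof.
elim: s => [|i s IH]; first by rewrite !big_nil Lf0.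
by rewrite !big_cons LfD IH.
Qed.

Lemma Lf_ge0 q : (forall x, 0 < x -> 0 <= q.[x]) -> 0 <= Lf q.
Proof.
move=> q0; apply: Rintegral_ge0 => x /=; rewrite in_itv/= andbT => x0.
by rewrite mulr_ge0 ?wt_ge0 ?q0.
Qed.

Lemma Lf_eq0 q : (forall x, 0 < x -> 0 <= q.[x]) -> Lf q = 0 -> q = 0.
Proof.
move=> q0 L0; have nn x : (`]0, +oo[%classic : set (measurableTypeR R)) x -> 0 <= q.[x] * wt x.
  by rewrite /= in_itv/= andbT => x0; rewrite mulr_ge0 ?wt_ge0 ?q0.
have [N [mN N0 sN]] := itg_ae0 (measurable_itv _) (iw q) nn L0.
apply: (@ae0_poly _ _ 0 1) => //; exists N; split=> // x /= nx.
apply: sN => /= qw; apply: nx => /andP[x0 _]; move: qw.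
rewrite in_itv/= andbT => /(_ x0) /eqP.
by rewrite mulf_eq0 (gt_eqF (wt_gt0 x0)) orbF => /eqP.
Qed.

(* integration by parts against the derivative of [x^(alpha+1) e^(-x)] *)
Lemma Lf_parts q : Lf ('X * q^`() + ((alpha + 1)%:P - 'X) * q) = 0.
Proof.
(* The boundary term. The fundamental theorem is applied on [[1/(n+1), n+1]]; [G] tends to 0 at
   infinity by the exponential and at 0 because [alpha + 1 > 0]. *)
pose G x := x `^ (alpha + 1) * expR (- x) * q.[x].
pose g x := ('X * q^`() + ((alpha + 1)%:P - 'X) * q).[x] * wt x.
have dG x : 0 < x -> is_derive x 1 G (g x).
  move=> x0; apply: derive_eqv (deriveM_fun (derive_wt x0) (is_derive_poly q x)) _.
  by rewrite wt_powS// /g !(hornerM, hornerD, hornerN, hornerC, hornerX); ring.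
have cg x : 0 < x -> {for x, continuous g}.
  move=> x0; apply: continuousM; last exact: cont_wt.
  exact: continuous_horner.
pose u (n : nat) : R := n.+1%:R^-1; pose v (n : nat) : R := n.+1%:R.
have u0 n : 0 < u n by rewrite invr_gt0 ltr0n.
have v1 n : 1 <= v n by rewrite ler1n.
have uv n : u n <= v n by apply: le_trans (v1 n); rewrite invf_le1 ?ltr0n// ler1n.
have IE n : Int (u n) (v n) g = G (v n) - G (u n).
  by apply: Int_FTC => // x /andP[ux _]; [apply: dG|apply: cg]; exact: lt_le_trans ux.
have cu : u @ \oo --> (0 : R) by exact: cvg_harmonic.
have cv : v @ \oo --> +oo.
  by rewrite /v (cvg_shiftS (fun n : nat => (n%:R : R))); exact: cvgr_idn.
have := Int_cvg (iw ('X * q^`() + ((alpha + 1)%:P - 'X) * q)) (fun n => ltW (u0 n)) cu cv.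
rewrite -/(Lf _) => cI; apply: (cvg_unique _ cI) => //.
rewrite [X in X @ _](_ : _ = fun n => G (v n) - G (u n)); last by apply/funext => n; exact: IE.
have E1 : (fun n => G (v n)) @ \oo --> (0 : R).
  have [C CP] : exists C, forall x, 1 <= x -> `|G x| <= C / x.
    have [C [N CN]] := poly_growth q; have [D DP] := wt_decay N.+1.
    exists (C * D) => x x1; have x0 := lt_le_trans ltr01 x1.
    have C0 : 0 <= C.
      by have := le_trans (normr_ge0 _) (CN 1 (lexx _)); rewrite expr1n mulr1.
    have xw : 0 <= x * wt x := mulr_ge0 (ltW x0) (wt_ge0 x).
    rewrite /G wt_powS// normrM (ger0_norm xw).
    apply: le_trans (ler_wpM2l xw (CN x x1)) _.
    have -> : x * wt x * (C * x ^+ N) = C * (x ^+ N.+1 * wt x) by rewrite exprS; ring.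
    by rewrite -mulrA ler_wpM2l// DP.
  have : (fun n => C * u n) @ \oo --> (0 : R).
    by rewrite -[X in _ --> X](mulr0 C); apply: cvgM => //; exact: cvg_cst.
  by move=> cb; apply: (cvg0_le _ cb) => n; apply: le_trans (CP _ (v1 n)) _; rewrite /u /v.
have E2 : (fun n => G (u n)) @ \oo --> (0 : R).
  pose M := \sum_(i < size q) `|q`_i|.
  have : (fun n => M * (u n) `^ (alpha + 1)) @ \oo --> (0 : R).
    rewrite -[X in _ --> X](mulr0 M); apply: cvgM; first exact: cvg_cst.
    have a1 : 0 < alpha + 1 by move: alpha_gt; lra.
    by have /cvg_at_rightP := powR_cvg0 a1; apply; split.
  move=> cb; apply: (cvg0_le _ cb) => n.
  rewrite /G normrM mulrC ler_pM//.
    apply: le_trans (poly_bound_sum _ _) _.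
    apply: ler_sum => i _; rewrite ler_piMr// ger0_norm ?(ltW (u0 n))//.
    by rewrite exprn_ile1 ?(ltW (u0 n))// invf_le1 ?ltr0n// ler1n.
  rewrite ger0_norm ?mulr_ge0 ?powR_ge0 ?expR_ge0// ler_piMr ?powR_ge0//.
  by rewrite expR_le1 oppr_le0 ltW.
have := cvgB E1 E2; rewrite subr0 => E; exact: E.
Qed.

End Weight.

(** * Laguerre polynomials: zeros, Gauss quadrature, differential equation *)

Section Laguerre.
Variables (R : realType) (alpha : R) (P : nat -> {poly R}).
Notation mu := (@lebesgue_measure R).
Implicit Types (p q r : {poly R}) (x z : R).
Hypothesis alpha_gt : -1 < alpha.
Hypothesis lag : laguerre_orthonormal alpha P.
Local Notation wt := (wt alpha).
Local Notation Lf := (Lf alpha).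

Lemma size_lag m : size (P m) = m.+1.
Proof. by have [] := lag m. Qed.

Lemma lag_neq0 m : P m != 0.
Proof. by rewrite -size_poly_gt0 size_lag. Qed.

Lemma lag_integral m k :
  (\int[mu]_(x in `]0%R, +oo[) ((P m * P k).[x] * wt x)%:E = ((m == k)%:R)%:E)%E.
Proof.
have [_ [_ /(_ k) <-]] := lag m; rewrite pos_itv; apply: eq_integral => x _.
by rewrite hornerM /wt !mulrA.
Qed.

Lemma itg_lag2 m : itg `]0, +oo[ (fun x => (P m).[x] ^+ 2 * wt x).
Proof.
have mh : measurable_fun (`]0, +oo[%classic : set (measurableTypeR R)) (fun x : R => (P m).[x] ^+ 2 * wt x).
  by apply: measurable_funM; [apply: measurable_funX; exact: meas_horner|exact: meas_wt].
apply/integrableP; split; first exact/measurable_EFinP.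
rewrite (_ : (\int[mu]_(x in _) _)%E = 1%E) ?ltry//.
rewrite -[RHS](_ : ((m == m)%:R)%:E = 1%E); last by rewrite eqxx.
rewrite -lag_integral; apply: eq_integral => x _ /=.
by rewrite hornerM -expr2 ger0_norm// mulr_ge0 ?sqr_ge0 ?wt_ge0.
Qed.

Lemma lag_reduce n q : (size q <= n.+1)%N -> exists c : R, (size (q - c *: P n)%R <= n)%N.
Proof.
move=> sq; exists (q`_n / lead_coef (P n)); apply/leq_sizeP => j nj.
rewrite coefB coefZ; have [->|jn] := eqVneq j n.
  have lcn : lead_coef (P n) = (P n)`_n by rewrite lead_coefE size_lag.
  by rewrite lcn divfK ?subrr// -lcn lead_coef_eq0 lag_neq0.
have nj' : (n < j)%N by rewrite ltn_neqAle eq_sym jn.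
have Pj : (size (P n) <= j)%N by rewrite size_lag.
by rewrite (nth_default _ (leq_trans sq nj')) (nth_default _ Pj) mulr0 subr0.
Qed.

(** Integrability is drawn from orthonormality: the integral of the nonnegative [P_m^2 w] is 1,
    hence finite; [|P_m| <= P_m^2 + 1]; and the [P_m] span all polynomials by degree. *)
Lemma itg_polyw q : itg `]0, +oo[ (fun x => q.[x] * wt x).
Proof.
have P0E : P 0%N = ((P 0%N)`_0)%:P by apply: size1_polyC; rewrite size_lag.
have c0 : (P 0%N)`_0 != 0 by apply: contraNneq (lag_neq0 0) => e; rewrite P0E e.
have i1 : itg `]0, +oo[ wt.
  apply: eq_itg (itgZ ((P 0%N)`_0 ^- 2) _ (itg_lag2 0)) => // x _.
  by rewrite P0E hornerC coefC /= mulrA mulVf ?mul1r// expf_neq0.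
have iP m : itg `]0, +oo[ (fun x => (P m).[x] * wt x).
  apply: itg_le (itgD _ (itg_lag2 m) i1) => //; first exact: meas_polyw.
  move=> x _; rewrite -[X in _ <= _ + X]mul1r -mulrDl normrM (ger0_norm (wt_ge0 _ _)).
  rewrite ler_wpM2r ?wt_ge0// -normr_id -(real_normK (num_real (P m).[x])).
  by have := sqr_ge0 (`|(P m).[x]| - 1); rewrite normr_id; have := sqr_ge0 (`|(P m).[x]|); rewrite !expr2; nra.
have [n] := ubnP (size q); elim: n q => // n IH q; rewrite ltnS.
case: n IH => [_|n IH sq].
  by rewrite leqn0 size_poly_eq0 => /eqP ->; apply: eq_itg (itgZ 0 _ i1) => // x _; rewrite horner0 !mul0r.
have [c sc] := lag_reduce sq.
apply: eq_itg (itgD _ (itgZ c _ (iP n)) (IH _ (leq_ltn_trans sc (ltnSn _)))) => // x _.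
by rewrite hornerD hornerN hornerZ; ring.
Qed.

Let iw := itg_polyw.

Lemma Lf_lag m k : Lf (P m * P k) = (m == k)%:R.
Proof. by rewrite /Lf /Rintegral lag_integral. Qed.

Lemma Lf_orth m q : (size q <= m)%N -> Lf (P m * q) = 0.
Proof.
have : forall n, (n <= m)%N -> forall r, (size r <= n)%N -> Lf (P m * r) = 0.
  elim=> [_|n IH nm] r sr.
    by move: sr; rewrite leqn0 size_poly_eq0 => /eqP ->; rewrite mulr0 Lf0.
  have [c /(IH (ltnW nm))] := lag_reduce sr.
  by rewrite mulrBr -scalerAr LfB// LfZ// Lf_lag (gtn_eqF nm) mulr0 subr0.
by move=> /(_ m (leqnn m)); apply.
Qed.

Section Zeros.
Variables (m : nat) (s : seq R).
Hypothesis sP : zeros_of (P m) s.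

Lemma zeros_uniq : uniq s.
Proof. by have [ss _] := sP; exact: (sorted_uniq lt_trans ltxx). Qed.

(** If fewer than [m] positive roots had odd multiplicity, the product of their linear factors would
    have degree below [m] and be orthogonal to [P m], while its product with [P m] keeps one sign.
    So there are [m] of them, which leaves no other root. *)
Lemma zeros_size_pos : size s = m /\ all (fun z => 0 < z) s.
Proof.
have [_ rP] := sP.
have [t [e [ut /allP at_ e1 eP]]] := poly_sign_changes (lag_neq0 m).
have ts : {subset t <= s} by move=> z /at_ /andP[_ rz]; apply/rP.
have sm : (size s <= m)%N.
  rewrite -ltnS -(size_lag m); apply: max_poly_roots (lag_neq0 m) _ zeros_uniq.
  by apply/allP => z /rP.
have tm : (m <= size t)%N.
  rewrite leqNgt; apply/negP => tm.
  pose q := e *: \prod_(z <- t) ('X - z%:P).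
  have q0 : q != 0.
    rewrite /q scaler_eq0 negb_or -normr_eq0 e1 oner_eq0/=.
    by rewrite monic_neq0// monic_prod_XsubC.
  have sq : (size q <= m)%N.
    by apply: leq_trans (size_scale_leq _ _) _; rewrite size_prod_XsubC.
  have nn x : 0 < x -> 0 <= (P m * q).[x].
    move=> x0; rewrite hornerM /q hornerZ horner_prod; have := eP x x0.
    rewrite (eq_bigr (fun z => ('X - z%:P).[x])) => [|z _]; last by rewrite hornerXsubC.
    by congr (_ <= _); ring.
  have /eqP := Lf_eq0 iw nn (Lf_orth sq).
  by rewrite mulf_eq0 (negbTE (lag_neq0 m)) (negbTE q0).
have stm : size s = m.
  by apply/eqP; rewrite eqn_leq sm (leq_trans tm)// uniq_leq_size.
split=> //; apply/allP => z zs.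
have st : (size s <= size t)%N by rewrite stm.
by have [_ ts'] := uniq_min_size ut ts st; move: zs; rewrite -ts' => /at_ /andP[].
Qed.

Let sm : size s = m := (zeros_size_pos).1.

Lemma zeros_pos k : (k < m)%N -> 0 < s`_k.
Proof. by move=> km; have [_ /allP] := zeros_size_pos; apply; rewrite mem_nth// sm. Qed.

Lemma zeros_lt i j : (i < j < m)%N -> s`_i < s`_j.
Proof.
move=> /andP[ij jm]; have [ss _] := sP.
by apply: (sorted_ltn_nth lt_trans) => //; rewrite inE sm// (ltn_trans ij).
Qed.

Lemma zeros_inj i j : (i < m)%N -> (j < m)%N -> (s`_i == s`_j) = (i == j).
Proof. by move=> im jm; rewrite nth_uniq ?zeros_uniq// sm. Qed.

Definition lagp (k : nat) : {poly R} :=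
  \prod_(i < size s | i != k :> nat) ((s`_k - s`_i)^-1 *: ('X - (s`_i)%:P)).

Lemma horner_lagp k x : (lagp k).[x] = lagr s k x.
Proof.
rewrite /lagp horner_prod /lagr; apply: eq_bigr => i _.
by rewrite hornerZ hornerXsubC mulrC.
Qed.

Lemma lagp_node k j : (k < m)%N -> (j < m)%N -> (lagp k).[s`_j] = (j == k)%:R.
Proof.
move=> km jm; rewrite horner_lagp /lagr; have [->|jk] := eqVneq j k.
  apply: big1 => i ik; rewrite divff// subr_eq0 zeros_inj ?(eq_sym k)//.
  by rewrite -sm ltn_ord.
have js : (j < size s)%N by rewrite sm.
by rewrite (bigD1 (Ordinal js))//= subrr mul0r mul0r.
Qed.

Lemma size_lagp k : (k < m)%N -> (size (lagp k) <= m)%N.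
Proof.
move=> km; rewrite /lagp scaler_prod; apply: leq_trans (size_scale_leq _ _) _.
have ks : (k < size s)%N by rewrite sm.
rewrite -big_filter size_prod_XsubC -(card_ord m).
have -> : size [seq i : 'I_(size s) <- index_enum 'I_(size s) | (i : nat) != k] = #|predC1 (Ordinal ks)|.
  by rewrite cardE /enum_mem -enumT; congr size; rewrite /index_enum -enumT; apply: eq_filter.
by rewrite cardC1 card_ord sm card_ord prednK// (leq_ltn_trans _ km).
Qed.

Lemma cotesE k : cotes alpha s k = Lf (lagp k).
Proof.
rewrite /cotes pos_itv /Lf; apply: eq_RintR => x _.
by rewrite horner_lagp /wt mulrA.
Qed.

Lemma lagrange_interpolation r : (size r <= m)%N -> r = \sum_(k < m) r.[s`_k] *: lagp k.
Proof.
move=> sr; apply/eqP; rewrite -subr_eq0; apply/eqP.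
apply: (@roots_geq_poly_eq0 _ _ s); last 2 first.
- exact: zeros_uniq.
- rewrite sm; apply: leq_trans (size_polyD _ _) _; rewrite geq_max sr size_polyN.
  apply: leq_trans (size_sum _ _ _) _; apply/bigmax_leqP => k _.
  by apply: leq_trans (size_scale_leq _ _) _; exact: size_lagp.
apply/allP => z /(nthP 0) [j]; rewrite sm => jm <-.
rewrite rootE hornerD hornerN horner_sum (bigD1 (Ordinal jm))//= hornerZ lagp_node// eqxx mulr1.
rewrite big1 ?addr0 ?subrr// => k kj; rewrite hornerZ lagp_node ?ltn_ord//.
by rewrite [j == k](_ : _ = false) ?mulr0//; apply: contraNF kj => /eqP jk; apply/eqP/val_inj.
Qed.

(** Division by [P m]: the quotient has degree below [m] and is killed by orthogonality; the
    remainder agrees with [q] at the nodes and is interpolated exactly. *)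
Lemma gauss_exact q : (size q <= 2 * m)%N ->
  Lf q = \sum_(k < m) cotes alpha s k * q.[s`_k].
Proof.
move=> sq; rewrite {1}(divp_eq q (P m)) mulrC LfD// Lf_orth ?add0r; last first.
  rewrite size_divp ?lag_neq0// size_lag/=.
  by rewrite leq_subLR addnn -mul2n.
have sr : (size (q %% P m)%R <= m)%N.
  by rewrite -ltnS -[X in (_ < X)%N](size_lag m) ltn_modp lag_neq0.
rewrite {1}(lagrange_interpolation sr) Lf_sum//; apply: eq_bigr => k _.
rewrite LfZ// -cotesE mulrC; congr (_ * _).
have [_ rP] := sP; have /eqP rk : root (P m) s`_k by apply/rP; rewrite mem_nth// sm.
by rewrite [in RHS](divp_eq q (P m)) hornerD hornerM rk mulr0 add0r.
Qed.

Lemma cotes_gt0 k : (k < m)%N -> 0 < cotes alpha s k.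
Proof.
move=> km.
have E : Lf (lagp k ^+ 2) = cotes alpha s k.
  rewrite gauss_exact; last first.
    rewrite expr2; apply: leq_trans (size_mul_leq _ _) _; rewrite -subn1 leq_subLR mul2n -addnn.
    by apply: leq_trans (leq_add (size_lagp km) (size_lagp km)) _; rewrite leq_addl.
  rewrite (bigD1 (Ordinal km))//= expr2 hornerM lagp_node// eqxx !mulr1.
  rewrite big1 ?addr0// => j jk; rewrite hornerM lagp_node ?ltn_ord//.
  rewrite [_ == k](_ : _ = false) ?mulr0//.
  by apply: contraNF jk => /eqP e; apply/eqP/val_inj.
have nn x : 0 < x -> 0 <= (lagp k ^+ 2).[x] by rewrite expr2 hornerM -expr2 sqr_ge0.
rewrite -E lt_neqAle Lf_ge0// andbT; apply/negP => /eqP/esym/(Lf_eq0 iw nn)/eqP.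
rewrite expf_eq0 /= => /eqP l0; have := lagp_node km km.
by rewrite l0 horner0 eqxx => /eqP; rewrite eq_sym oner_eq0.
Qed.

(** The operator [D] is symmetric for the moment functional and does not raise the degree. So
    [D (P m) + m P m], in which the leading terms cancel, has degree below [m] and is orthogonal to
    every polynomial of degree below [m], in particular to itself. *)
Lemma laguerre_ode :
  'X * (P m)^`()^`() + ((alpha + 1)%:P - 'X) * (P m)^`() + m%:R *: P m = 0.
Proof.
pose D q := 'X * q^`()^`() + ((alpha + 1)%:P - 'X) * q^`().
have DE q j : (D q)`_j = q`_j.+1 *+ j.+1 * (j%:R + alpha + 1) - q`_j *+ j.
  rewrite /D coefD mulrBl coefB coefXM coefXM coefCM; case: j => [|j] /=.
    by rewrite !coef_deriv mulr0n subr0; ring.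
  by rewrite !coef_deriv; ring.
have sD q n : (size q <= n)%N -> (size (D q) <= n)%N.
  move=> /leq_sizeP qn; apply/leq_sizeP => j nj; rewrite DE (qn _ nj) (qn _ (leq_trans nj (leqnSn j))).
  by rewrite !mul0rn mul0r subr0.
rewrite -/(D (P m)); set r := D (P m) + _.
(* [D] multiplies the coefficient of [X^m] by [-m], up to the next coefficient, which is 0 here. *)
have sr : (size r <= m)%N.
  apply/leq_sizeP => j mj; rewrite /r coefD DE coefZ.
  rewrite (nth_default _ (_ : (size (P m) <= j.+1)%N)) ?size_lag// mul0rn mul0r sub0r.
  have [->|jm] := eqVneq j m; first by ring.
  have Pj : (size (P m) <= j)%N by rewrite size_lag ltn_neqAle eq_sym jm.
  by rewrite (nth_default _ Pj) mul0rn mulr0 addr0 oppr0.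
have orth q : (size q <= m)%N -> Lf (r * q) = 0.
  move=> sq.
  (* Both instances contain [X p' q']; their difference [A - B] is [D p * q - p * D q], which is the
     symmetry of [D]. *)
  have H1 := Lf_parts alpha_gt iw ((P m)^`() * q).
  have H2 := Lf_parts alpha_gt iw (P m * q^`()).
  have H3 : Lf (P m * D q) = 0 by apply: Lf_orth; exact: sD.
  have H4 := Lf_orth sq.
  move: H1 H2; set A := 'X * _ + _; set B := 'X * _ + _ => H1 H2.
  have -> : r * q = A - B + P m * D q + m%:R *: (P m * q).
    by rewrite /r /D /A /B !derivM -!mul_polyC; ring.
  by rewrite LfD// LfD// LfB// LfZ// H1 H2 H3 H4; ring.
have r2 : r * r = 0 by apply: (Lf_eq0 iw) (orth _ sr) => x _; rewrite hornerM -expr2 sqr_ge0.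
by move/eqP: r2; rewrite mulf_eq0 orbb => /eqP.
Qed.

(** At 0 the differential equation reads [(alpha + 1) P'(0) + m P(0) = 0], and [- P'(0) / P(0)] is
    the sum of the reciprocals of the zeros. That sum is thus [m / (alpha + 1)], and each positive
    term is at most this. *)
Lemma zeros_lower z : z \in s -> (alpha + 1) / m%:R <= z.
Proof.
move=> zs.
have deriv0 t : all (fun z : R => 0 < z) t ->
    (\prod_(z <- t) ('X - z%:P))^`().[0] = - (\sum_(z <- t) z^-1) * (\prod_(z <- t) ('X - z%:P)).[0].
  elim: t => [|y t IH] /=; first by rewrite !big_nil derivC hornerC oppr0 mul0r.
  move=> /andP[y0 /IH E]; rewrite !big_cons derivM derivXsubC mul1r hornerD !hornerM !hornerXsubC E.
  set S := \sum_(_ <- _) _; set Q := horner _ _. by field; rewrite gt_eqF.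
have [_ pos] := zeros_size_pos; have [_ rP] := sP.
have PE : P m = lead_coef (P m) *: \prod_(z <- s) ('X - z%:P).
  apply: all_roots_prod_XsubC; first by rewrite size_lag sm.
    by apply/allP => y /rP.
  by rewrite uniq_rootsE zeros_uniq.
have p0 : (P m).[0] != 0.
  by apply/negP => /rP /(allP pos); rewrite ltxx.
have dE : (P m)^`().[0] = - (\sum_(z <- s) z^-1) * (P m).[0].
  by rewrite PE derivZ !hornerZ deriv0//; ring.
have := congr1 (fun q => q.[0]) laguerre_ode.
rewrite !(hornerD, hornerM, hornerZ, hornerN, hornerC, hornerX) dE mul0r add0r subr0 => E.
have E2 : (alpha + 1) * \sum_(z <- s) z^-1 = m%:R.
  by apply: (mulIf p0); move: E; set S := \sum_(_ <- _) _; lra.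
have z0 : 0 < z by exact: (allP pos).
have m0 : 0 < m%:R :> R.
  by rewrite ltr0n -sm; case: (s) zs.
rewrite ler_pdivrMr// -E2 mulrCA ler_peMr//; first by move: alpha_gt; lra.
rewrite (big_rem z)//= mulrDr divff ?gt_eqF// lerDl mulr_ge0 ?(ltW z0)//.
rewrite big_seq; apply: sumr_ge0 => y /mem_rem ys.
by rewrite invr_ge0 ltW// (allP pos).
Qed.

End Zeros.
End Laguerre.

(** * Counting sign changes of piecewise monotone functions *)

Section SignChanges.
Variable R : realType.
Implicit Types (F G : R -> R) (a va x v z t : R) (l : seq (R * R)) (s zs N : seq R).

(* [alt F a va l]: starting from the (one-sided) value [va] at [a], [F] rises to the
   value [v] at [x] for the first entry [(x, v)] of [l]; then [- F] rises, from [- v],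
   to the next entry, and so on; after the last entry it rises to [0] at infinity.
   A jump is a piece with [a = x]. *)
Fixpoint alt F a va l : Prop :=
  if l is (x, v) :: l' then
    [/\ a <= x, va <= v, (forall t, a < t < x -> va <= F t <= v),
        (forall t u, a < t -> t <= u -> u < x -> F t <= F u) &
        alt (fun t => - F t) x (- v) l']
  else forall t, a < t -> va <= F t <= 0.

(** [z] is the supremum of [a] and the points where [F <= 0]. Only monotonicity is used, since [F]
    may jump; the value at [z] itself is left open. *)
Lemma monotone_crossing F a x : a <= x ->
  (forall t u, a < t -> t <= u -> u < x -> F t <= F u) ->
  exists z, [/\ a <= z <= x, (forall t, a < t < z -> F t <= 0) &
                (forall t, z < t < x -> 0 <= F t)].
Proof.
move=> ax mF; pose S := [set t | t = a \/ (a < t < x /\ F t <= 0)].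
have Sa : S a by left.
have ubS : ubound S x by move=> t [->//|[/andP[_ /ltW]]].
have hS : has_sup S by split; [exists a|exists x].
have aS : a <= sup S by apply: ub_le_sup => //; exists x.
exists (sup S); split.
- by rewrite aS ge_sup//; exists a.
- move=> t /andP[at_ tS].
  have e0 : 0 < sup S - t by rewrite subr_gt0.
  have [u Su tu] := sup_adherent e0 hS.
  rewrite opprB addrCA subrr addr0 in tu.
  case: Su => [ua|[/andP[au ux] Fu]]; first by move: tu at_; rewrite ua; lra.
  by apply: le_trans Fu; apply: mF => //; exact: ltW.
- move=> t /andP[St tx]; rewrite leNgt; apply/negP => Ft.
  have : t <= sup S.
    apply: ub_le_sup; first by exists x.
    by right; rewrite (le_lt_trans aS St) tx (ltW Ft).
  by rewrite leNgt St.
Qed.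

Lemma alt_opp2 F a va l : alt (fun t => - - F t) a va l = alt F a va l.
Proof. by congr alt; apply/funext => t; rewrite opprK. Qed.

(* The number of sign changes after [a] is at most [size l], and smaller as soon as
   some turning value has the wrong sign; [q] changes sign where [F] does. *)
Lemma alt_count F a va l : alt F a va l -> va <= 0 ->
  exists (q : {poly R}) N, [/\ q != 0, (size q <= (size l).+1)%N,
    (~~ all (fun p => 0 < p.2) l -> (size q <= size l)%N),
    (forall t, t <= a -> q.[t] <= 0) &
    (forall t, a < t -> t \notin N -> 0 <= F t * q.[t])].
Proof.
have [n] := ubnP (size l); elim: n F a va l => // n IH F a va [|[x v] l] sl /=.
  move=> Fa va0; exists (-1), [::]; split=> //.
  - by rewrite oppr_eq0 oner_eq0.
  - by rewrite size_polyN size_poly1.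
  - by move=> t _; rewrite hornerN hornerC lerN10.
  - move=> t /Fa /andP[_ Ft] _; rewrite hornerN hornerC mulrN1 oppr_ge0//.
move=> [ax vav Fb mF A] va0; have [v0|v0] := leP v 0; last first.
  have nv0 : - v <= 0 by rewrite oppr_le0 ltW.
  have [q [N [q0 sq cq ql qr]]] := IH _ _ _ _ sl A nv0.
  have [z [/andP[az zx] Fl Fr]] := monotone_crossing ax mF.
  have sE : size ((z%:P - 'X) * q) = (size q).+1.
    by rewrite -opprB mulNr size_polyN size_monicM ?monicXsubC// size_XsubC.
  have zqE t : ((z%:P - 'X) * q).[t] = (z - t) * q.[t].
    by rewrite hornerM hornerD hornerN hornerC hornerX.
  (* A positive turning value gives one crossing [z], hence one more linear factor. The points [z]
     and [x] are exceptional because only one-sided information is available there. *)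
  exists ((z%:P - 'X) * q), [:: z, x & N]; split; rewrite ?sE//.
  - by rewrite mulf_neq0// -opprB oppr_eq0 polyXsubC_eq0.
  - by move=> t ta; rewrite zqE mulr_ge0_le0 ?ql ?subr_ge0 ?(le_trans ta)// (le_trans az).
  - move=> t at_; rewrite !in_cons !negb_or => /and3P[tz tx tN]; rewrite zqE.
    have [xt|] := ltP x t.
      have -> : F t * ((z - t) * q.[t]) = (t - z) * (- F t * q.[t]) by ring.
      by rewrite mulr_ge0 ?qr// subr_ge0 (le_trans zx)// ltW.
    rewrite le_eqVlt (negbTE tx)/= => tx'.
    have qt := ql t (ltW tx').
    case: (ltgtP t z) tz => // tz _.
      have Ft : F t <= 0 by apply: Fl; rewrite at_.
      by rewrite mulrA mulr_le0// mulr_le0_ge0// subr_ge0 ltW.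
    have Ft : 0 <= F t by apply: Fr; rewrite tz.
    by rewrite mulr_ge0// mulr_le0// subr_le0 ltW.
(* With [v <= 0] the rise ends below 0 and the descent after it stays below 0 as well. Two turning
   points are used up without any sign change, or one if it is the last, and the count drops. *)
case: l A sl => [|[x2 v2] l] /= A sl.
  exists (-1), [:: x]; split=> //.
  - by rewrite oppr_eq0 oner_eq0.
  - by rewrite size_polyN size_poly1.
  - by rewrite size_polyN size_poly1.
  - by move=> t _; rewrite hornerN hornerC lerN10.
  - move=> t at_; rewrite inE => tx; rewrite hornerN hornerC mulrN1 oppr_ge0.
    case: (ltgtP t x) tx => // tx _; last by have := A _ tx; move: v0; lra.
    by have := Fb t; rewrite at_ tx => /(_ isT) /andP[_ /le_trans]; apply.
have [xx2 vv2 Fb2 _] := A; rewrite alt_opp2 => A2.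
have v20 : - v2 <= 0 by move: vv2 v0; lra.
have [|q [N [q0 sq cq ql qr]]] := IH _ _ _ l _ A2 v20.
  by move: sl; rewrite !ltnS; apply: leq_trans; exact: leqnSn.
exists q, [:: x, x2 & N]; split=> //.
- by rewrite (leq_trans sq)// ltnS -addn2 leq_addr.
- by move=> _; rewrite (leq_trans sq).
- by move=> t ta; rewrite ql// (le_trans ta)// (le_trans ax).
- move=> t at_; rewrite !in_cons !negb_or => /and3P[tx tx2 tN].
  have [x2t|] := ltP x2 t; first exact: qr.
  rewrite le_eqVlt (negbTE tx2)/= => tx2'; apply: mulr_le0; last by rewrite ql// ltW.
  case: (ltgtP t x) tx => // tx _.
    by have := Fb t; rewrite at_ tx => /(_ isT) /andP[_ /le_trans]; apply.
  by have := Fb2 t; rewrite tx tx2' => /(_ isT) /andP[+ _]; move: v0; lra.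
Qed.

(** The part of [alt] that integration keeps: signs only, off a finite set [N] that will contain the
    turning points, where [alt] fixes no value. *)
Fixpoint signpat N F a zs : Prop :=
  if zs is z :: zs' then
    [/\ a <= z, (forall t, a < t < z -> t \notin N -> F t <= 0) &
        signpat N (fun t => - F t) z zs']
  else forall t, a < t -> t \notin N -> F t <= 0.

Lemma signpat_sub N N' F a zs : {subset N <= N'} -> signpat N F a zs -> signpat N' F a zs.
Proof.
move=> NN; have nn t : t \notin N' -> t \notin N by apply: contra; exact: NN.
elim: zs F a => [|z zs IH] F a /=; first by move=> H t /H + /nn; apply.
by move=> [az H S]; split=> //; [move=> t /H + /nn; apply|exact: IH].
Qed.

Lemma signpat_ext N F a b zs : a <= b -> (forall t, a < t < b -> t \notin N -> F t <= 0) ->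
  b \in N -> signpat N F b zs -> signpat N F a zs.
Proof.
case: zs => [|z zs] ab Fab bN /=.
  move=> H t at_ tN; case: (ltgtP t b) => tb; [|exact: H|by move: tN; rewrite tb bN].
  by apply: Fab; rewrite ?at_.
move=> [bz H S]; split=> //; first exact: le_trans bz.
move=> t /andP[at_ tz] tN; case: (ltgtP t b) => tb; [|by apply: H; rewrite ?tb|by move: tN; rewrite tb bN].
by apply: Fab; rewrite ?at_.
Qed.

(** When every turning value has its expected sign, each monotone piece contains a crossing. That
    crossing number [j] lies between two consecutive turning points is what later locates the
    turning points of the primitive. *)
Lemma alt_signpat F a va l : alt F a va l -> va <= 0 -> all (fun p => 0 < p.2) l ->
  exists N zs, [/\ size zs = size l, signpat N F a zs &
    (forall j, (j < size zs)%N ->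
       nth 0 (a :: map fst l) j <= zs`_j <= nth 0 (map fst l) j)].
Proof.
elim: l F a va => [|[x v] l IH] F a va /=.
  by move=> H _ _; exists [::], [::]; split=> // t /H /andP[].
move=> [ax vav Fb mF A] va0 /andP[v0 al].
have [|N [zs [szs S I]]] := IH _ _ _ A _ al; first by rewrite oppr_le0 ltW.
have [z [/andP[az zx] Fl Fr]] := monotone_crossing ax mF.
exists (x :: N), (z :: zs); split=> /=; first by rewrite szs.
- split=> //; first by move=> t /Fl.
  apply: (@signpat_ext _ _ _ x) => //; last 2 first.
  + exact: mem_head.
  + by apply: signpat_sub S => t tN; rewrite in_cons tN orbT.
  by move=> t /Fr; rewrite oppr_le0.
- move=> [|j] /=; first by rewrite az zx.
  by rewrite ltnS => /I.
Qed.

(** Turning points of [- G] with values in the convention of [alt]: each entry is stored with the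
    sign that makes it the end of a rise. *)
Fixpoint vals G zs : seq (R * R) :=
  if zs is z :: zs' then (z, - G z) :: vals (fun t => - G t) zs' else [::].

Lemma vals_fst G zs : map fst (vals G zs) = zs.
Proof. by elim: zs G => //= z zs IH G; rewrite IH. Qed.

Lemma size_vals G zs : size (vals G zs) = size zs.
Proof. by rewrite -{2}(vals_fst G zs) size_map. Qed.

Lemma nth_vals G zs j : (j < size zs)%N ->
  nth (0, 0) (vals G zs) j = (zs`_j, (-1) ^+ j.+1 * G zs`_j).
Proof.
elim: zs G j => //= z zs IH G [|j] /=; first by rewrite expr1 mulN1r.
rewrite ltnS => /IH ->; rewrite [in RHS]exprS; congr (_, _); ring.
Qed.

(** [G] stands for a primitive of [F] that vanishes at infinity. Only its monotonicity where [F] has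
    one sign is asked for, so [F] need not be continuous; the limit 0 yields the last clause of
    [alt]. *)
Lemma signpat_alt N F G a zs : signpat N F a zs ->
  (forall t u, a <= t -> t <= u -> (forall y, t < y < u -> y \notin N -> F y <= 0) -> G u <= G t) ->
  (forall t u, a <= t -> t <= u -> (forall y, t < y < u -> y \notin N -> 0 <= F y) -> G t <= G u) ->
  (forall e, 0 < e -> exists B, forall t, B <= t -> `|G t| < e) ->
  alt (fun t => - G t) a (- G a) (vals G zs).
Proof.
elim: zs F G a => [|z zs IH] F G a /=.
  move=> S dG _ lG t at_; rewrite lerN2 oppr_le0 dG ?lexx ?(ltW at_)//=; last first.
    by move=> y /andP[ay _]; exact: S.
  (* A negative value of [G] after the last crossing could only decrease further, against the limit
     0. *)
  rewrite leNgt; apply/negP => Gt.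
  have nG : 0 < - G t by rewrite oppr_gt0.
  have [B BP] := lG _ nG.
  have : G (Num.max B t) <= G t.
    apply: dG; rewrite ?(ltW at_) ?le_max ?lexx ?orbT// => y /andP[ty _].
    by apply: S; exact: lt_trans ty.
  have := BP (Num.max B t); rewrite le_max lexx => /(_ isT).
  by rewrite ltr_norml => /andP[]; lra.
move=> [az Fz S] dG iG lG; split=> //.
- by rewrite lerN2 dG.
- move=> t /andP[at_ tz]; rewrite !lerN2; apply/andP; split.
    apply: dG => //; first exact: ltW.
    by move=> y /andP[ay yt]; apply: Fz; rewrite ay (lt_trans yt tz).
  apply: dG; [exact: ltW|exact: ltW|].
  by move=> y /andP[ty yz]; apply: Fz; rewrite yz (lt_trans at_ ty).
- move=> t u at_ tu uz; rewrite lerN2; apply: dG => //; first exact: ltW.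
  by move=> y /andP[ty yu]; apply: Fz; rewrite (lt_trans at_ ty) (lt_trans yu uz).
- apply: (IH (fun t => - F t)) => //.
  + move=> t u zt tu H; rewrite lerN2; apply: iG => //; first exact: le_trans zt.
    by move=> y ty yN; rewrite -oppr_le0; exact: H.
  + move=> t u zt tu H; rewrite lerN2; apply: dG => //; first exact: le_trans zt.
    by move=> y ty yN; rewrite -oppr_ge0; exact: H.
  + by move=> e /lG [B BP]; exists B => t /BP; rewrite normrN.
Qed.

Lemma alt_sorted F a va l j : alt F a va l -> (j < size l)%N ->
  nth 0 (a :: map fst l) j <= nth 0 (map fst l) j.
Proof.
elim: l F a va j => [|[x v] l IH] F a va [|j] //= [ax _ _ _ A] jl //.
exact: IH A jl.
Qed.

End SignChanges.

(** * Integrals insensitive to finitely many points; antiderivatives of polynomials *)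

Section FiniteExceptions.
Variable R : realType.
Notation mu := (@lebesgue_measure R).
Implicit Types (h : R -> R) (a b : R) (N : seq R).

Definition stp (y t : R) : R := if y <= t then 1 else 0.

Lemma stp_bound y t : 0 <= stp y t <= 1.
Proof. by rewrite /stp; case: ifP => _; rewrite lexx ler01. Qed.

Lemma meas_stp y (D : set (measurableTypeR R)) : measurable_fun D (stp y).
Proof.
apply: measurable_funTS.
rewrite (_ : stp y = \1_(`[y, +oo[%classic : set (measurableTypeR R))).
  by apply: measurable_indic; exact: measurable_itv.
by apply/funext => t; rewrite /stp indicE mem_setE in_itv/= andbT; case: ifP.
Qed.

Lemma Rint_cst0 (D : set (measurableTypeR R)) : measurable D -> \int[mu]_(y in D) (fun=> 0 : R) y = 0.
Proof. by move=> mD; rewrite Rintegral_cst// mul0r. Qed.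

Lemma Int_cst0 a b : Int a b (fun=> 0 : R) = 0.
Proof. by rewrite /Int Rint_cst0. Qed.

Lemma Int_sum a b (I : Type) (s : seq I) (h : I -> R -> R) : (forall i, itg `]a, b] (h i)) ->
  Int a b (fun y => \sum_(i <- s) h i y) = \sum_(i <- s) Int a b (h i).
Proof.
move=> ih; elim: s => [|i s IH].
  by rewrite big_nil -[RHS](Int_cst0 a b); apply: eq_Int => y _; rewrite big_nil.
rewrite big_cons -IH -IntD//; last exact: itg_sum.
by apply: eq_Int => y _; rewrite big_cons.
Qed.

Lemma tail_split h t : itg `]0, +oo[ h -> 0 <= t ->
  \int[mu]_(y in `]t, +oo[) h y = \int[mu]_(y in `]0, +oo[) h y - Int 0 t h.
Proof.
move=> ih t0; have := @Rintegral_itvB R h (BRight 0) +oo%O t ih.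
by rewrite !bnd_simp => /(_ t0 isT) <-.
Qed.

Lemma negligible_seq N : measurable ([set` N] : set (measurableTypeR R)) /\ mu [set` N] = 0%E.
Proof.
have cN : countable [set` N] by apply: finite_set_countable; exact: finite_seq.
split; last exact: countable_lebesgue_measure0.
exact: countable_measurable.
Qed.

Lemma Int_norm_fin a b h N : itg `]a, b] h ->
  (forall x, a < x <= b -> x \notin N -> 0 <= h x) -> Int a b h = Int a b (fun x => `|h x|).
Proof.
move=> ih h0; congr fine.
apply: ae_eq_integral => //.
- exact: measurable_int ih.
- exact: measurable_int (itg_norm _ ih).
have [mN N0] := negligible_seq N.
exists [set` N]; split=> // x /=; apply: contra_notP => xN; rewrite in_itv/= => abx.
by rewrite ger0_norm// h0//; apply/negP.
Qed.

Lemma Int_ge0_fin a b h N : itg `]a, b] h ->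
  (forall x, a < x <= b -> x \notin N -> 0 <= h x) -> 0 <= Int a b h.
Proof. by move=> ih h0; rewrite (Int_norm_fin ih h0) Int_ge0. Qed.

Lemma Int_gt0 a b h : a < b -> itg `]a, b] h -> (forall x, a < x < b -> 0 < h x) -> 0 < Int a b h.
Proof.
move=> ab ih h0; have hN : forall x, a < x <= b -> x \notin [:: b] -> 0 <= h x.
  by move=> x /andP[ax]; rewrite le_eqVlt inE => /predU1P[->|xb _]; [rewrite eqxx|rewrite ltW// h0// ax].
rewrite lt_neqAle (Int_ge0_fin ih hN) andbT; apply/negP => /eqP/esym.
rewrite (Int_norm_fin ih hN) => I0.
have [] := itg_ae0 (measurable_itv _) (itg_norm (measurable_itv _) ih) (fun x _ => normr_ge0 _) I0.
move=> Z [mZ Z0 sZ].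
have : (mu `]a, b[%classic <= mu Z)%E.
  apply: le_measure; rewrite ?inE// => x /=; rewrite in_itv/= => /andP[ax xb].
  apply: sZ => /=; rewrite in_itv/= ax (ltW xb) => /(_ isT)/eqP.
  by rewrite normr_eq0 gt_eqF// h0// ax.
by rewrite Z0 lebesgue_measure_itv/= lte_fin ab leNgt -EFinB lte_fin subr_gt0 ab.
Qed.

(** At [i = 0] the coefficient is a division by 0, which is 0: this is the antiderivative without
    constant term. *)
Definition prim (q : {poly R}) : {poly R} := \poly_(i < (size q).+1) (q`_i.-1 / i%:R).

Lemma deriv_prim q : (prim q)^`() = q.
Proof.
apply/polyP => j; rewrite coef_deriv coef_poly ltnS; case: ltnP => jq.
  by rewrite -[LHS]mulr_natr divfK// pnatr_eq0.
by rewrite mul0rn nth_default.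
Qed.

Lemma size_prim q : (size (prim q) <= (size q).+1)%N.
Proof. exact: size_poly. Qed.

Lemma FTC_poly (Q : {poly R}) x T : x <= T -> Q.[x] = Q.[T] - Int x T (horner Q^`()).
Proof.
move=> xT; rewrite (@Int_FTC _ _ _ (horner Q))//; first by ring.
by move=> y _; exact: continuous_horner.
Qed.

End FiniteExceptions.

(** * Peano kernels of a positive quadrature rule exact below degree 2m *)

Section GaussKernels.
Variables (R : realType) (alpha : R) (m : nat) (x lam : nat -> R).
Notation mu := (@lebesgue_measure R).
Local Notation wt := (wt alpha).
Local Notation Lf := (Lf alpha).
Implicit Types (q Q : {poly R}) (t u T z : R) (i j k n : nat).
Hypothesis iw : forall q, itg `]0, +oo[ (fun y => q.[y] * wt y).
Hypothesis m_gt0 : (0 < m)%N.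
Hypothesis xpos : forall k, (k < m)%N -> 0 < x k.
Hypothesis xlt : forall i j, (i < j < m)%N -> x i < x j.
Hypothesis lam_gt0 : forall k, (k < m)%N -> 0 < lam k.
Hypothesis exact_ : forall q, (size q <= 2 * m)%N -> Lf q = \sum_(k < m) lam k * q.[x k].

Lemma xle i j : (i <= j)%N -> (j < m)%N -> x i <= x j.
Proof. by rewrite leq_eqVlt => /predU1P[->//|ij jm]; rewrite ltW// xlt// ij. Qed.

Definition Wt t : R := Int 0 t wt.
Definition gam t : R := \sum_(k < m) lam k * stp (x k) t.

(** [ek 0] rises with [Wt] between nodes and drops by [lam k] at [x k], where it is
    right-continuous; from [i = 1] on the kernels are continuous. *)
Fixpoint ek i t : R := if i is i'.+1 then Int 0 t (ek i') else Wt t - gam t.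

Lemma itg_wt_pos : itg `]0, +oo[ wt.
Proof. by apply: eq_itg (iw 1) => // y _; rewrite hornerC mul1r. Qed.

Lemma itg_polyw_oc T q : itg `]0, T] (fun y => q.[y] * wt y).
Proof.
apply: itgS (iw q) => // y /=.
by rewrite !in_itv/= andbT => /andP[].
Qed.

Lemma itg_wt T : itg `]0, T] wt.
Proof. by apply: eq_itg (itg_polyw_oc T 1) => // y _; rewrite hornerC mul1r. Qed.

Lemma itg_gam T : itg `]0, T] gam.
Proof.
apply: itg_sum => // k; apply: itgZ => //; apply: (@itg_bounded _ _ _ _ 1).
  exact: meas_stp.
by move=> t _; have /andP[s0 s1] := stp_bound (x k) t; rewrite ger0_norm.
Qed.

Lemma itg_ek i T : itg `]0, T] (ek i).
Proof.
by elim: i => [|i IH] /=; [apply: itgB => //; [exact: itg_Int (itg_wt T)|exact: itg_gam]|exact: itg_Int].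
Qed.

Lemma itg_ek_oc i t u : 0 <= t -> itg `]t, u] (ek i).
Proof. by move=> t0; apply: itg_oc (itg_ek i u). Qed.

Lemma Wt_diff t u : 0 <= t -> t <= u -> Wt u - Wt t = Int t u wt.
Proof. by move=> t0 tu; rewrite /Wt (Int_split t0 tu (itg_wt u)); ring. Qed.

Lemma Wt_mono t u : 0 <= t -> t <= u -> Wt t <= Wt u.
Proof.
by move=> t0 tu; rewrite -subr_ge0 Wt_diff//; apply: Int_ge0 => y _; exact: wt_ge0.
Qed.

Lemma ek_diff i t u : 0 <= t -> t <= u -> ek i.+1 u - ek i.+1 t = Int t u (ek i).
Proof. by move=> t0 tu /=; rewrite (Int_split t0 tu (itg_ek i u)); ring. Qed.

Lemma gam_mono t u : t <= u -> gam t <= gam u.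
Proof.
move=> tu; apply: ler_sum => k _; rewrite ler_wpM2l ?(ltW (lam_gt0 _))//.
rewrite /stp; case: (leP (x k) t) => [xt|_]; first by rewrite (le_trans xt tu) lexx.
by case: ifP; rewrite ?ler01 ?lexx.
Qed.

(** Both the integral and each node value are written through [F T] and an integral of [f]: by
    Fubini for the weight, and against the step function at [x k] for a node. The factor
    [stp (x k) T] removes the nodes beyond [T]. *)
Lemma Peano0 T (F f : R -> R) : itg `]0, T] f ->
  (forall y, 0 < y <= T -> F y = F T - Int y T f) ->
  Int 0 T (fun y => F y * wt y) - \sum_(k < m) lam k * stp (x k) T * F (x k) =
  F T * ek 0 T - Int 0 T (fun y => f y * ek 0 y).
Proof.
move=> jf FE; rewrite (Fubini_parts jf (itg_wt T) FE) -/(Wt T).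
have jfb (h : R -> R) M : measurable_fun `]0, T] h -> (forall t, 0 < t <= T -> `|h t| <= M) ->
    itg `]0, T] (fun y => f y * h y).
  move=> mh hM; apply: eq_itg (itgM _ mh _ jf) => //; first by move=> y _; rewrite mulrC.
  by move=> y /=; rewrite in_itv/=; exact: hM.
have jstep k : itg `]0, T] (fun y => f y * stp (x k) y).
  by apply: (jfb _ 1); [exact: meas_stp|move=> t _; have /andP[s0 s1] := stp_bound (x k) t; rewrite ger0_norm].
have E k : (k < m)%N -> stp (x k) T * F (x k) = stp (x k) T * F T - Int 0 T (fun y => f y * stp (x k) y).
  move=> km; have x0 := xpos km; have [xT|Tx] := leP (x k) T; last first.
    rewrite /stp leNgt Tx !mul0r (@eq_Int _ _ _ _ (fun=> 0)) ?Int_cst0 ?subr0// => y /andP[_ yT].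
    by rewrite leNgt (le_lt_trans yT Tx) mulr0.
  rewrite [stp _ T]/stp xT !mul1r FE ?x0// (Int_split (ltW x0) xT (jstep k)).
  (* On [(0, x k]] the step function differs from 0 only at the right endpoint, so that endpoint is
     dropped. *)
  have -> : Int 0 (x k) (fun y => f y * stp (x k) y) = 0.
    rewrite /Int -Rintegral_itv_bndo_bndc; last first.
      apply: itgS (jstep k) => // y /=; rewrite !in_itv/= => /andP[-> /ltW yx].
      by rewrite (le_trans yx xT).
    rewrite (@eq_RintR _ _ _ (fun=> 0)) ?Rint_cst0// => y /=.
    by rewrite in_itv/= /stp leNgt => /andP[_ ->]; rewrite mulr0.
  rewrite add0r; congr (_ - _); apply: eq_Int => y /andP[xy _].
  by rewrite /stp (ltW xy) mulr1.
have -> : \sum_(k < m) lam k * stp (x k) T * F (x k) =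
    F T * gam T - Int 0 T (fun y => f y * gam y).
  under eq_bigr => k _ do rewrite -mulrA E// mulrBr mulrA.
  rewrite sumrB; congr (_ - _); first by rewrite mulrC -mulr_suml.
  have -> : Int 0 T (fun y => f y * gam y) = Int 0 T (fun y => \sum_(k < m) lam k * (f y * stp (x k) y)).
    by apply: eq_Int => y _; rewrite /gam mulr_sumr; apply: eq_bigr => k _; ring.
  rewrite Int_sum; last by move=> k; exact: itgZ.
  by apply: eq_bigr => k _; rewrite IntZ.
have jW : itg `]0, T] (fun y => f y * Wt y).
  by apply: jfb; [exact: meas_Int (itg_wt T)|exact: Int_bounded (itg_wt T)].
have jG : itg `]0, T] (fun y => f y * gam y).
  apply: (jfb _ (\sum_(k < m) lam k)); first exact: itg_meas (itg_gam T).
  move=> t _; rewrite ger0_norm; last by apply: sumr_ge0 => k _; rewrite mulr_ge0 ?(ltW (lam_gt0 _))//; have /andP[] := stp_bound (x k) t.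
  by apply: ler_sum => k _; rewrite ler_piMr ?(ltW (lam_gt0 _))//; have /andP[] := stp_bound (x k) t.
rewrite (@eq_Int _ _ _ (fun y => f y * ek 0 y) (fun y => f y * Wt y - f y * gam y)); last first.
  by move=> y _ /=; rewrite mulrBr.
by rewrite IntB//=; ring.
Qed.

Lemma PeanoS i T (F f : R -> R) : itg `]0, T] f ->
  (forall y, 0 < y <= T -> F y = F T - Int y T f) ->
  Int 0 T (fun y => F y * ek i y) = F T * ek i.+1 T - Int 0 T (fun y => f y * ek i.+1 y).
Proof. by move=> jf FE; exact: Fubini_parts jf (itg_ek i T) FE. Qed.

Lemma itg_horner q t u : itg `]t, u] (horner q).
Proof. by apply: continuous_itg => y _; exact: continuous_horner. Qed.

(** Exactness on constants makes [ek 0 t] the difference of the tails beyond [t] of the two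
    measures, and [t^n] times a tail is at most the [n]-th moment. *)
Lemma ek0_decay n : exists C, forall t, 1 <= t -> `|ek 0 t| * t ^+ n <= C.
Proof.
exists (Lf 'X^n + \sum_(k < m) lam k * x k ^+ n) => t t1.
have t0 : 0 <= t by exact: le_trans t1.
have tn : 0 <= t ^+ n by exact: exprn_ge0.
pose tau := \int[mu]_(y in `]t, +oo[) wt y.
have it (g : R -> R) : itg `]0, +oo[ g -> itg `]t, +oo[ g.
  apply: itgS => // y /=; rewrite !in_itv/= !andbT; exact: le_lt_trans.
have Lf1E : Lf 1 = \int[mu]_(y in `]0, +oo[) wt y.
  by apply: eq_RintR => y _; rewrite hornerC mul1r.
have WE : Wt t = Lf 1 - tau.
  by rewrite /tau /Wt (tail_split itg_wt_pos t0) Lf1E; ring.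
have e0E : ek 0 t = - tau + \sum_(k < m) lam k * (1 - stp (x k) t).
  rewrite /= WE exact_ ?size_poly1 ?muln_gt0//.
  have -> : \sum_(k < m) lam k * (1 : {poly R}).[x k] = gam t + \sum_(k < m) lam k * (1 - stp (x k) t).
    rewrite /gam -big_split/=; apply: eq_bigr => k _; rewrite hornerC.
    by ring.
  by ring.
have tau0 : 0 <= tau by apply: Rintegral_ge0 => y _; exact: wt_ge0.
rewrite e0E -[X in _ * X](ger0_norm tn) -normrM mulrDl; apply: le_trans (ler_normD _ _) _.
apply: lerD.
- rewrite mulNr normrN ger0_norm ?mulr_ge0// mulrC -RintegralZl//; last exact: it itg_wt_pos.
  have h1 : itg `]t, +oo[ (fun y => t ^+ n * wt y) by apply: itgZ => //; exact: it itg_wt_pos.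
  have h2 : itg `]t, +oo[ (fun y => ('X^n).[y] * wt y) by exact: it.
  have H : \int[mu]_(y in `]t, +oo[) (t ^+ n * wt y) <= \int[mu]_(y in `]t, +oo[) (('X^n).[y] * wt y).
    apply: le_Rintegral => // y /=; rewrite in_itv/= andbT => ty.
    rewrite hornerXn ler_wpM2r ?wt_ge0// lerXn2r ?nnegrE ?(ltW ty)//.
    exact: le_trans (ltW ty).
  apply: le_trans H _; rewrite (tail_split (iw 'X^n) t0) -/(Lf 'X^n) lerBlDr lerDl.
  by apply: Int_ge0 => y /andP[y0 _]; rewrite hornerXn mulr_ge0 ?wt_ge0// exprn_ge0// ltW.
- rewrite mulr_suml ger0_norm; last first.
    apply: sumr_ge0 => k _; rewrite !mulr_ge0 ?(ltW (lam_gt0 _))// subr_ge0.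
    by have /andP[] := stp_bound (x k) t.
  apply: ler_sum => k _; rewrite -mulrA ler_wpM2l ?(ltW (lam_gt0 _))//.
  have xk0 := ltW (xpos (ltn_ord k)).
  rewrite /stp; case: (leP (x k) t) => tx; first by rewrite subrr mul0r exprn_ge0.
  by rewrite subr0 mul1r lerXn2r// ?nnegrE// ltW.
Qed.

Let v n : R := n.+1%:R.

Let v1 n : 1 <= v n. Proof. by rewrite ler1n. Qed.

Let cvgv : v @ \oo --> +oo.
Proof. by rewrite /v (cvg_shiftS (fun n : nat => (n%:R : R))); exact: cvgr_idn. Qed.

Definition decays (F : R -> R) := forall n, exists C, forall t, 1 <= t -> `|F t| * t ^+ n <= C.

Lemma decays_poly F Q : decays F -> (fun n => Q.[v n] * F (v n)) @ \oo --> (0 : R).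
Proof.
move=> dF; have [C [N CN]] := poly_growth Q; have [D DP] := dF N.+1.
have cb : (fun n => C * D * n.+1%:R^-1) @ \oo --> (0 : R).
  by rewrite -[X in _ --> X](mulr0 (C * D)); apply: cvgM; [exact: cvg_cst|exact: cvg_harmonic].
apply: (cvg0_le _ cb) => n; have vn0 : 0 < v n := lt_le_trans ltr01 (v1 n).
have C0 : 0 <= C.
  by have := le_trans (normr_ge0 _) (CN 1 (lexx _)); rewrite expr1n mulr1.
rewrite normrM -/(v n) ler_pdivlMr//; apply: le_trans (_ : C * (v n ^+ N.+1 * `|F (v n)|) <= _).
  have -> : C * (v n ^+ N.+1 * `|F (v n)|) = C * v n ^+ N * `|F (v n)| * v n by rewrite exprS; ring.
  by rewrite ler_wpM2r ?(ltW vn0)// ler_wpM2r// CN.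
by rewrite ler_wpM2l// mulrC DP.
Qed.

Lemma Int_pow2 t u : 0 < t -> t <= u -> Int t u (fun y => y ^- 2) = t^-1 - u^-1.
Proof.
move=> t0 tu.
have dF y : t <= y <= u -> is_derive y 1 (fun y : R => - y^-1) (y ^- 2).
  move=> /andP[ty _]; have y0 : y != 0 by rewrite gt_eqF// (lt_le_trans t0).
  have d := is_deriveV y0 (is_derive_id y 1).
  by apply: derive_eqv (is_deriveN d) _; rewrite /GRing.scale/= mulr1 opprK.
rewrite (Int_FTC tu dF); first by ring.
move=> y /andP[ty _]; have y0 : y != 0 by rewrite gt_eqF// (lt_le_trans t0).
by apply: cvgV; [rewrite expf_neq0|exact: exprn_continuous].
Qed.

(* Every polynomial is a derivative, so the limit makes [ek i] orthogonal to the
   polynomials of size [< 2m - i]. *)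
Lemma ek_orth i : (i < 2 * m)%N -> decays (ek i) /\
  forall Q, (size Q + i <= 2 * m)%N -> (fun n => Int 0 (v n) (fun y => Q^`().[y] * ek i y)) @ \oo --> (0 : R).
Proof.
elim: i => [|i IH] im; first split.
- exact: ek0_decay.
- move=> Q; rewrite addn0 => sQ.
  (* The boundary term decays, and the truncated quadrature error tends to the full one, which is 0
     by exactness. *)
  have E n : Int 0 (v n) (fun y => Q^`().[y] * ek 0 y) = Q.[v n] * ek 0 (v n) -
     (Int 0 (v n) (fun y => Q.[y] * wt y) - \sum_(k < m) lam k * stp (x k) (v n) * Q.[x k]).
    rewrite (@Peano0 _ (horner Q) (horner Q^`())) ?subKr//; first exact: itg_horner.
    by move=> y /andP[_ yT]; exact: FTC_poly.
  under eq_fun do rewrite E.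
  have c1 := decays_poly Q ek0_decay.
  have c0 : (fun _ : nat => 0 : R) @ \oo --> (0 : R) by exact: cvg_cst.
  have c2 := Int_cvg (iw Q) (fun _ => lexx 0) c0 cvgv.
  have c3 : (fun n => \sum_(k < m) lam k * stp (x k) (v n) * Q.[x k]) @ \oo --> Lf Q.
    rewrite exact_//; apply: cvg_near_cst; near=> n; apply: eq_bigr => k _.
    rewrite /stp (_ : _ <= _) ?mulr1//; apply: le_trans (_ : x m.-1 <= _).
      by rewrite xle// -ltnS prednK.
    by near: n; move/cvgryPge : cvgv; exact.
  have := cvgB c1 (cvgB c2 c3); rewrite subrr subr0 => c4; exact: c4.
have [dF oF] := IH (ltnW im).
(* Orthogonality of [ek i] to constants (the case [Q = 'X]) says that [ek i.+1] tends to 0 along the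
   integers. So [ek i.+1 t] is minus the integral of [ek i] beyond [t], and two spare powers of
   decay make that integral converge with the bound wanted. *)
have dS : decays (ek i.+1).
  move=> N; have [C CP] := dF (N + 2)%N; exists C => t t1.
  have t0 : 0 < t by exact: lt_le_trans t1.
  have C0 : 0 <= C by apply: le_trans (CP _ (lexx 1)); rewrite mulr_ge0// exprn_ge0.
  have bnd u : t <= u -> `|ek i.+1 u - ek i.+1 t| * t ^+ N <= C.
    move=> tu; rewrite (ek_diff _ (ltW t0) tu).
    have i1 := itg_ek_oc i u (ltW t0).
    have i2 : itg `]t, u] (fun y => C / t ^+ N * y ^- 2).
      apply: itgZ => //; apply: continuous_itg => y /andP[ty _].
      by apply: cvgV; [rewrite expf_neq0// gt_eqF// (lt_le_trans t0)|exact: exprn_continuous].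
    apply: le_trans (_ : C / t ^+ N * (t^-1 - u^-1) * t ^+ N <= _).
      rewrite ler_wpM2r ?exprn_ge0 ?(ltW t0)// -Int_pow2// -IntZ; last first.
        apply: continuous_itg => y /andP[ty _].
        by apply: cvgV; [rewrite expf_neq0// gt_eqF// (lt_le_trans t0)|exact: exprn_continuous].
      apply: Int_norm_le => // y /andP[ty _].
      have y0 : 0 < y := lt_trans t0 ty.
      rewrite -mulrA -invfM ler_pdivlMr ?mulr_gt0 ?exprn_gt0//.
      apply: le_trans (CP y (le_trans t1 (ltW ty))).
      rewrite ler_wpM2l// exprD ler_wpM2r ?exprn_ge0 ?(ltW y0)// lerXn2r// ?nnegrE ltW//.
    have -> : C / t ^+ N * (t^-1 - u^-1) * t ^+ N = C * (t^-1 - u^-1).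
      by rewrite mulrAC divfK// gt_eqF// exprn_gt0.
    rewrite ler_piMr// lerBlDr (le_trans (_ : t^-1 <= 1))//; first by rewrite invf_le1.
    by rewrite lerDl invr_ge0 (le_trans (ltW t0)).
  have c := oF 'X (_ : (size 'X + i <= 2 * m)%N).
  have {}c : (fun n => ek i.+1 (v n)) @ \oo --> (0 : R).
    have := c _; rewrite size_polyX add2n => /(_ im); apply: cvg_trans; apply: near_eq_cvg.
    near=> n => /=; apply: eq_Int => y _; rewrite derivX hornerC mul1r//.
  rewrite leNgt; apply/negP => big; have tN : 0 < t ^+ N by exact: exprn_gt0.
  have eps : 0 < (`|ek i.+1 t| * t ^+ N - C) / t ^+ N by rewrite divr_gt0// subr_gt0.
  have [n [tn sn]] : exists n, t <= v n /\ `|ek i.+1 (v n)| < (`|ek i.+1 t| * t ^+ N - C) / t ^+ N.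
    have /cvgrPdist_lt/(_ _ eps) H := c.
    near \oo => n; exists n; split; first by near: n; move/cvgryPge : cvgv; exact.
    by near: n; apply: filterS H => n; rewrite sub0r normrN.
  move: sn; rewrite ltr_pdivlMr// => sn.
  have := bnd _ tn; have : `|ek i.+1 t| <= `|ek i.+1 (v n) - ek i.+1 t| + `|ek i.+1 (v n)|.
    by rewrite -[X in `|X| <= _](subKr (ek i.+1 (v n))) [leRHS]addrC; exact: ler_normB.
  move=> /(ler_wpM2r (ltW tN)); rewrite mulrDl; move: sn; lra.
split=> // Q sQ; have [Q0|Q0] := eqVneq Q 0.
  rewrite Q0 (_ : (fun _ => _) = fun=> 0); first exact: cvg_cst.
  by apply/funext => n; rewrite (@eq_Int _ _ _ _ (fun=> 0)) ?Int_cst0// => y _; rewrite deriv0 horner0 mul0r.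
have E n : Int 0 (v n) (fun y => Q^`().[y] * ek i.+1 y) = Q.[v n] * ek i.+1 (v n) -
   Int 0 (v n) (fun y => Q.[y] * ek i y).
  rewrite (@PeanoS i _ (horner Q) (horner Q^`())) ?subKr//; first exact: itg_horner.
  by move=> y /andP[_ yT]; exact: FTC_poly.
under eq_fun do rewrite E.
have sP : (size (prim Q) + i <= 2 * m)%N.
  by apply: leq_trans sQ; rewrite addnS -addSn leq_add2r size_prim.
have := cvgB (decays_poly Q dS) (oF _ sP); rewrite deriv_prim subrr => c; exact: c.
Unshelve. all: by end_near.
Qed.

Lemma ek_pos i t : 0 < t -> t < x 0%N -> 0 < ek i t.
Proof.
elim: i t => [|i IH] t t0 tx /=.
  have -> : gam t = 0.
    apply: big1 => k _; rewrite /stp leNgt (lt_le_trans tx) ?mulr0//.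
    by rewrite xle.
  rewrite subr0; apply: Int_gt0 (itg_wt t) _ => // y /andP[y0 _]; exact: wt_gt0.
by apply: Int_gt0 (itg_ek i t) _ => // y /andP[y0 yt]; apply: IH => //; exact: lt_trans tx.
Qed.

(** The integrals of the nonnegative product over [(0, n]] increase with [n] and tend to 0, so they
    vanish and the product is 0 almost everywhere. Before the first node [ek i] is positive, hence
    [q] vanishes there, so everywhere. *)
Lemma ek_not_one_signed i q (N : seq R) : q != 0 -> (size q + i < 2 * m)%N ->
  (forall t, 0 < t -> t \notin N -> 0 <= - ek i t * q.[t]) -> False.
Proof.
move=> q0 sq nn.
have im : (i < 2 * m)%N by apply: leq_ltn_trans sq; exact: leq_addl.
have [_ /(_ (prim q))] := ek_orth im; rewrite deriv_prim => c.
have {}c : (fun n => Int 0 (v n) (fun y => q.[y] * ek i y)) @ \oo --> (0 : R).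
  by apply: c; apply: leq_trans sq; rewrite -addSn leq_add2r size_prim.
have ih T : itg `]0, T] (fun y => - ek i y * q.[y]).
  have [M MP] : exists M, forall y, 0 < y <= T -> `|q.[y]| <= M.
    exists (\sum_(j < size q) `|q`_j| * T ^+ j) => y /andP[y0 yT].
    apply: le_trans (poly_bound_sum _ _) _; apply: ler_sum => j _.
    by rewrite ler_wpM2l// ger0_norm ?(ltW y0)// lerXn2r// ?nnegrE ?(ltW y0)// (le_trans (ltW y0)).
  apply: (@eq_itg _ _ (fun y => q.[y] * - ek i y)) => //; first by move=> y _; rewrite mulrC.
  apply: (@itgM _ _ _ _ M) => //; last by apply: itgN => //; exact: itg_ek.
    exact: meas_horner.
pose I n := Int 0 (v n) (fun y => - ek i y * q.[y]).
have cI : I @ \oo --> (0 : R).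
  rewrite (_ : I = fun n => - Int 0 (v n) (fun y => q.[y] * ek i y)).
    by have := cvgN c; rewrite oppr0 => c'; exact: c'.
  apply/funext => n; rewrite /I -IntN; first by apply: eq_Int => y _; rewrite mulrC mulrN.
  by apply: eq_itg (itgN _ (ih (v n))) => // y _; rewrite mulNr opprK mulrC.
have I0 n : I n = 0.
  have In0 : 0 <= I n.
    by apply: (@Int_ge0_fin _ _ _ _ N) (ih _) _ => y /andP[y0 _]; exact: nn.
  apply/eqP; rewrite eq_le In0 andbT leNgt; apply/negP => big.
  have [k [nk sk]] : exists k, (n <= k)%N /\ `|I k| < I n.
    have /cvgrPdist_lt/(_ _ big) H := cI.
    near \oo => k; exists k; split; first by near: k; exact: nbhs_infty_ge.
    by near: k; apply: filterS H => k; rewrite sub0r normrN.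
  have vnk : v n <= v k by rewrite ler_nat.
  have vn0 : 0 <= v n by exact: le_trans (v1 n).
  have := sk; rewrite ltNge => /negP; apply; apply: le_trans (ler_norm _).
  rewrite /I (Int_split vn0 vnk (ih _)) lerDl.
  apply: (@Int_ge0_fin _ _ _ _ N) (itg_oc vn0 (lexx _) (ih _)) _ => y /andP[ny _].
  by apply: nn; exact: le_lt_trans ny.
have a0 : 0 < Num.min (x 0%N) 1 by rewrite lt_min xpos// ltr01.
apply/negP/negPn: q0; apply/eqP; apply: (ae0_poly a0).
have hN y : 0 < y <= v 0%N -> y \notin N -> 0 <= - ek i y * q.[y].
  by move=> /andP[y0 _]; exact: nn.
have := I0 0%N; rewrite /I (Int_norm_fin (ih _) hN) => J0.
have [Z [mZ Z0 sZ]] := itg_ae0 (measurable_itv _) (itg_norm (measurable_itv _) (ih _)) (fun _ _ => normr_ge0 _) J0.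
exists Z; split=> // y /= ny; apply: sZ => /= H; apply: ny => /andP[y0].
rewrite lt_min => /andP[yx y1]; move: H; rewrite in_itv/= y0 (ltW y1) => /(_ isT)/eqP.
by rewrite normr_eq0 mulf_eq0 oppr_eq0 (gt_eqF (ek_pos _ y0 yx)) => /eqP.
Unshelve. all: by end_near. Qed.

Definition gamk k : R := \sum_(j < m | (j <= k)%N) lam j.

Lemma gam_step k t : (k < m)%N -> x k <= t -> ((k.+1 < m)%N -> t < x k.+1) -> gam t = gamk k.
Proof.
move=> km xt tx; rewrite /gam /gamk [RHS]big_mkcond; apply: eq_bigr => j _.
rewrite /stp; have [jk|kj] := leqP j k.
  by rewrite (le_trans (xle jk km) xt) mulr1.
have k1m : (k.+1 < m)%N := leq_ltn_trans kj (ltn_ord j).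
by rewrite leNgt (lt_le_trans (tx k1m) (xle kj (ltn_ord j))) mulr0.
Qed.

Lemma gamk_mono k k' : (k <= k')%N -> gamk k <= gamk k'.
Proof.
move=> kk; rewrite /gamk !(big_mkcond (fun j : 'I_m => (j <= _)%N)); apply: ler_sum => j _.
have [jk|_] := leqP j k; first by rewrite (leq_trans jk kk).
by case: ifP => // _; rewrite ltW// lam_gt0.
Qed.

Lemma Wt_le_mass t : 0 <= t -> Wt t <= gamk m.-1.
Proof.
move=> t0; have -> : gamk m.-1 = Lf 1.
  rewrite exact_ ?size_poly1 ?muln_gt0// /gamk big_mkcond; apply: eq_bigr => k _.
  by rewrite hornerC mulr1 -ltnS prednK// ltn_ord.
have -> : Lf 1 = \int[mu]_(y in `]0, +oo[) wt y.
  by apply: eq_RintR => y _; rewrite hornerC mul1r.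
rewrite -subr_ge0 /Wt -(tail_split itg_wt_pos t0).
by apply: Rintegral_ge0 => y _; exact: wt_ge0.
Qed.

(* the values of [- ek 0] just after and just before its jumps at the nodes, with
   alternating sign as in [alt] *)
Fixpoint jumps k n : seq (R * R) :=
  (x k, gamk k - Wt (x k)) ::
  (if n is n'.+1 then (x k.+1, Wt (x k.+1) - gamk k) :: jumps k.+1 n' else [::]).

(** A jump at a node is a piece of length 0, followed by the descent of [- ek 0] up to the next
    node. After the last node [gam] is the total mass, which bounds [Wt] and gives the final
    clause. *)
Lemma alt_jumps n k va : (k + n)%N = m.-1 -> va <= gamk k - Wt (x k) ->
  alt (fun t => - ek 0 t) (x k) va (jumps k n).
Proof.
elim: n k va => [|n IH] k va kn vak.
all: have km : (k < m)%N by rewrite -(prednK m_gt0) ltnS -kn leq_addr.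
all: have xk0 := ltW (xpos km).
  rewrite /=; split=> //.
  - by move=> t /andP[/lt_trans h /h]; rewrite ltxx.
  - by move=> t u /lt_le_trans h /h /lt_trans h' /h'; rewrite ltxx.
  move=> t xt; have gE : gam t = gamk k.
    apply: gam_step => //; first exact: ltW.
    by rewrite -(prednK m_gt0) -kn addn0 ltnn.
  rewrite opprB opprK gE lerD2r Wt_mono ?(ltW xt)//= subr_le0.
  by move: kn; rewrite addn0 => ->; apply: Wt_le_mass; exact: le_trans (ltW xt).
have k1m : (k.+1 < m)%N by rewrite -(prednK m_gt0) ltnS -kn addnS ltnS leq_addr.
have xx : x k < x k.+1 by apply: xlt; rewrite ltnSn.
have gE t : x k <= t -> t < x k.+1 -> ek 0 t = Wt t - gamk k.
  by move=> xt tx /=; rewrite (gam_step km).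
split=> //.
- by move=> t /andP[/lt_trans h /h]; rewrite ltxx.
- by move=> t u /lt_le_trans h /h /lt_trans h' /h'; rewrite ltxx.
split=> //.
- exact: ltW.
- by rewrite opprB lerD2r Wt_mono// ltW.
- move=> t /andP[xt tx]; rewrite opprK gE// ?(ltW xt)// opprB !lerD2r.
  by rewrite !Wt_mono// ?(ltW xt) ?(ltW tx)// (le_trans xk0 (ltW xt)).
- move=> t u xt tu ux; rewrite !opprK !gE ?(ltW xt) ?(le_lt_trans tu ux) ?(le_trans (ltW xt) tu)//.
  by rewrite lerD2r Wt_mono// (le_trans xk0 (ltW xt)).
- rewrite alt_opp2; apply: IH; first by rewrite addSnnS.
  by rewrite opprB lerD2r gamk_mono.
Qed.

Lemma size_jumps k n : size (jumps k n) = (2 * n).+1.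
Proof. by elim: n k => //= n IH k; rewrite IH !mul2n doubleS. Qed.

Lemma nth_jumps k n j : (j < (2 * n).+1)%N ->
  nth 0 (map fst (jumps k n)) j = x (k + (j.+1)./2)%N.
Proof.
elim: n k j => [|n IH] k [|[|j]] //=; rewrite ?addn0 ?addn1//.
by move=> jn; rewrite IH ?addSnnS//; move: jn; rewrite !mul2n doubleS !ltnS.
Qed.

Lemma jumps_all k n : all (fun p => 0 < p.2) (jumps k n) -> forall j, (j <= n)%N ->
  Wt (x (k + j)%N) < gamk (k + j) /\ ((j < n)%N -> gamk (k + j) < Wt (x (k + j).+1)).
Proof.
elim: n k => [|n IH] k /=.
  by rewrite andbT subr_gt0 => h [|//] _; rewrite addn0.
rewrite !subr_gt0 => /and3P[h1 h2 h3] [|j] jn; first by rewrite addn0.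
by rewrite -addSnnS; apply: IH.
Qed.

(** A turning value of the wrong sign would lower the number of sign changes of [ek i] so far that a
    polynomial orthogonal to it could follow all of them. *)
Lemma turning_signs i a va l : alt (fun t => - ek i t) a va l -> va <= 0 ->
  (forall t, 0 < t < a -> 0 <= ek i t) -> (size l + i < 2 * m)%N -> all (fun p => 0 < p.2) l.
Proof.
move=> A va0 ea sl; have [q [N [q0 sq cq ql qr]]] := alt_count A va0.
apply: contraT => /cq sql; exfalso.
apply: (@ek_not_one_signed i q (a :: N)) => //.
  by apply: leq_ltn_trans sl; rewrite leq_add2r.
move=> t t0; rewrite in_cons negb_or => /andP[ta tN].
case: (ltgtP t a) ta => // ta _; last exact: qr.
by rewrite mulNr -mulrN mulr_ge0 ?oppr_ge0 ?ql ?(ltW ta)// ea// t0.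
Qed.

Let Wt_pos t : 0 < t -> 0 < Wt t.
Proof. by move=> t0; apply: Int_gt0 (itg_wt t) _ => // y /andP[y0 _]; exact: wt_gt0. Qed.

Lemma gamk_ge0 k : 0 <= gamk k.
Proof. by apply: sumr_ge0 => j _; rewrite ltW// lam_gt0. Qed.

Let alt0 : alt (fun t => - ek 0 t) (x 0%N) (- Wt (x 0%N)) (jumps 0 m.-1).
Proof. by apply: alt_jumps => //; rewrite lerDr gamk_ge0. Qed.

Let alt0_neg : - Wt (x 0%N) <= 0.
Proof. by rewrite oppr_le0 ltW// Wt_pos// xpos. Qed.

Let size0 : (size (jumps 0 m.-1)).+1 = (2 * m)%N.
Proof. by rewrite size_jumps -{2}(prednK m_gt0) !mul2n doubleS. Qed.

Let ek_sign i t : 0 < t < x 0%N -> 0 <= ek i t.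
Proof. by move=> /andP[t0 tx]; rewrite ltW// ek_pos. Qed.

(** The inequalities say precisely that the [2m - 1] turning values of [- ek 0] have their expected
    signs; there are just few enough of them for the counting argument to apply. *)
Lemma Markov_Stieltjes k : (k < m)%N ->
  Wt (x k) < gamk k /\ ((k.+1 < m)%N -> gamk k < Wt (x k.+1)).
Proof.
move=> km; have := turning_signs alt0 alt0_neg (@ek_sign 0%N).
rewrite addn0 size0 leqnn => /(_ isT)/jumps_all/(_ k).
by rewrite -ltnS prednK// => /(_ km); rewrite add0n -ltnS prednK.
Qed.

(** The induction invariant: after its start [a], [ek i] has [2m - 1 - i] turning points, and number
    [j], counting [a] as number 0, lies between the nodes of index [j/2] and [(j+i)/2], rounded
    down. For [i > 0] the stored values are true values of [ek i]; for [i = 0] they are one-sided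
    limits at jumps. *)
Let turning i := exists a va l,
  [/\ alt (fun t => - ek i t) a va l, va <= 0, 0 <= a & forall t, 0 < t < a -> 0 <= ek i t] /\
  [/\ (size l + i).+1 = (2 * m)%N,
      (forall j, (j < (size l).+1)%N -> x j./2 <= nth 0 (a :: map fst l) j <= x (j + i)./2) &
      ((0 < i)%N -> va = - ek i a /\ l = vals (ek i) (map fst l))].

(** Crossing [j] of [ek i] lies between its turning points [j] and [j + 1] and becomes turning point
    [j] of [ek i.+1]. The lower index bound is inherited from the left one, the upper from the right
    one, which adds 1 to [j + i]. *)
Lemma turningP i : (i < 2 * m)%N -> turning i.
Proof.
elim: i => [_|i IH im].
  exists (x 0%N), (- Wt (x 0%N)), (jumps 0 m.-1); split; first split=> //.
  - by rewrite ltW// xpos.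
  - exact: ek_sign.
  split=> //; first by rewrite addn0.
  move=> j; rewrite addn0 size_jumps ltnS; case: j => [|j] jm /=; first by rewrite lexx.
  by rewrite nth_jumps// add0n lexx.
have [a [va [l [[A va0 a0 ea] [sl bl _]]]]] := IH (ltnW im).
have al : all (fun p => 0 < p.2) l by apply: turning_signs A va0 ea _; rewrite -sl.
have [N [zs [szs S I]]] := alt_signpat A va0 al.
(* The pattern is extended from [a] down to 0, where the primitive starts; [ek i >= 0] on the added
   piece. *)
have S0 : signpat (a :: N) (fun t => - ek i t) 0 zs.
  apply: (@signpat_ext _ _ _ _ a) => //.
  - by move=> t ta _; rewrite oppr_le0 ea.
  - exact: mem_head.
  - by apply: signpat_sub S => t tN; rewrite in_cons tN orbT.
have [dS _] := ek_orth im.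
have A1 : alt (fun t => - - ek i.+1 t) 0 (- - ek i.+1 0) (vals (fun t => - ek i.+1 t) zs).
  apply: (signpat_alt S0).
  - move=> t u t0 tu H; rewrite lerN2 -subr_ge0 ek_diff//.
    apply: (@Int_ge0_fin _ _ _ _ (u :: a :: N)); first exact: itg_ek_oc.
    move=> y /andP[ty yu]; rewrite in_cons negb_or => /andP[yu' yN].
    by rewrite -oppr_le0 H// ty lt_neqAle yu'.
  - move=> t u t0 tu H; rewrite lerN2 -subr_ge0 -opprB ek_diff// oppr_ge0 -oppr_ge0 -IntN; last exact: itg_ek_oc.
    apply: (@Int_ge0_fin _ _ _ _ (u :: a :: N)); first by apply: itgN => //; exact: itg_ek_oc.
    move=> y /andP[ty yu]; rewrite in_cons negb_or => /andP[yu' yN].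
    by rewrite H// ty lt_neqAle yu'.
  - move=> e e0; have [C CP] := dS 1%N; exists (Num.max 1 (C / e + 1)) => t.
    rewrite ge_max => /andP[t1 tC]; have t0 := lt_le_trans ltr01 t1.
    have := CP t t1; rewrite expr1 normrN -ler_pdivlMr// => /le_lt_trans; apply.
    rewrite ltr_pdivrMr// mulrC -ltr_pdivrMr//; apply: lt_le_trans tC; lra.
have EK : (fun t => - - ek i.+1 t) = ek i.+1 by apply/funext => t; rewrite opprK.
have szs0 : (0 < size zs)%N by rewrite szs; move: im; rewrite -sl; case: (size l) => //; rewrite add0n ltnn.
(* The first crossing becomes the new starting point, so the list loses one entry while [i] grows by
   one. *)
case: zs szs S S0 I A1 szs0 => // z zs szs S S0 I /= [z0 vz Fz mz A1] _.
have E3 : (fun t => - - - ek i.+1 t) = (fun t => - ek i.+1 t) by apply/funext => t; rewrite opprK.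
have ekz0 : Int 0 0 (ek i) = 0 by exact: Int_ge.
have ez : 0 <= ek i.+1 z by move: vz; rewrite !opprK /= ekz0.
move: A1; rewrite !opprK EK E3 => A1.
exists z, (- ek i.+1 z), (vals (ek i.+1) zs); split; split=> //.
- by rewrite oppr_le0.
- by move=> t /Fz; rewrite !opprK /= ekz0 => /andP[].
- by rewrite size_vals -sl -szs /= addSnnS.
- move=> j; rewrite size_vals vals_fst => jz.
  have jl : (j < size l)%N by rewrite -szs.
  have /andP[I1 I2] := I j jz.
  have /andP[B1 _] := bl j (ltnW jl : (j < (size l).+1)%N).
  have /andP[_ B2] := bl j.+1 jl.
  by rewrite (le_trans B1 I1) (le_trans I2)//= -addSnnS.
- by rewrite vals_fst.
Qed.

(** Two consecutive turning values of [ek i] have opposite signs, and for [i > 0] the kernel is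
    continuous; the localisation of the turning points then localises the zero. *)
Lemma ek_zero i j : (0 < i)%N -> (j.+1 + i < 2 * m)%N ->
  exists z, x j./2 <= z <= x (j.+1 + i)./2 /\ ek i z = 0.
Proof.
move=> i0 ji; have im : (i < 2 * m)%N by apply: leq_ltn_trans ji; exact: leq_addl.
have [a [va [l [[A va0 a0 ea] [sl bl /(_ i0)[vaE lE]]]]]] := turningP im.
have al : all (fun p => 0 < p.2) l by apply: turning_signs A va0 ea _; rewrite -sl.
have jl : (j < size l)%N by rewrite -(ltn_add2r i) -ltnS sl -addSn.
pose S := nth 0 (a :: map fst l).
have sgS k : (k < (size l).+1)%N -> 0 <= (-1) ^+ k * ek i (S k).
  case: k => [_|k kl]; first by rewrite expr0 mul1r /S /= -oppr_le0 -vaE.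
  have /(all_nthP (0, 0))/(_ k kl) := al.
  by rewrite {1}lE nth_vals ?size_map// => /ltW.
have SS : S j <= S j.+1 := alt_sorted A jl.
have prod : ek i (S j) * ek i (S j.+1) <= 0.
  have := mulr_ge0 (sgS j (ltnW jl : (j < (size l).+1)%N)) (sgS j.+1 jl).
  rewrite mulrACA -exprD addnS -signr_odd /= oddD addbb expr1 mulN1r oppr_ge0//.
have [/andP[B1 _] /andP[_ B2]] := (bl j (ltnW jl : (j < (size l).+1)%N), bl j.+1 jl).
have Sj0 : 0 <= S j.
  apply: le_trans B1; apply/ltW/xpos; rewrite ltn_half_double -mul2n.
  by apply: leq_ltn_trans ji; rewrite addSn -addnS leq_addr.
have ci : {within `[S j, S j.+1], continuous (ek i)}.
  case: i i0 {ji im va0 ea sl bl vaE lE A al sgS prod B1 B2 jl} => // i _.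
  apply: (@continuous_subspaceW _ _ _ `[0, S j.+1]); last exact: continuous_Int (itg_ek i _).
  by move=> y /=; rewrite !in_itv/= => /andP[/(le_trans Sj0) -> ->].
have [|z] := IVT SS ci (v := 0).
  rewrite ge_min le_max; apply/andP; split; apply: contraT; rewrite negb_or -!ltNge => /andP[h1 h2].
    by move: prod; rewrite leNgt mulr_gt0.
  by move: prod; rewrite leNgt nmulr_rgt0 ?h2.
rewrite in_itv/= => /andP[z1 z2] ez; exists z; split=> //.
by rewrite (le_trans B1 z1) (le_trans z2 B2).
Qed.

Lemma node_bracket k M t : x k <= t -> t < x (k + M.+1)%N ->
  exists j, [/\ (k <= j <= k + M)%N, x j <= t & t < x j.+1].
Proof.
elim: M => [|M IH] xt tx; first by exists k; rewrite addn0 leqnn -addn1.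
have [h|h] := ltP t (x (k + M.+1)%N).
  have [j [/andP[kj jM] xj tj]] := IH xt h.
  by exists j; rewrite kj (leq_trans jM)// leq_add2l.
by exists (k + M.+1)%N; rewrite leq_addr leqnn -addnS.
Qed.

Lemma ek_window i k M t : ((k + M).+1 < m)%N -> (i <= 2 * M)%N -> x k <= t <= x (k + M)%N ->
  `|ek i t| <= (Wt (x (k + M).+1) - Wt (x k)) * (x (k + M)%N - x k) ^+ i.
Proof.
move=> kM iM; have kMm := ltnW kM; have km : (k < m)%N := leq_ltn_trans (leq_addr _ _) kMm.
have xk0 := ltW (xpos km).
elim: i iM t => [_|i IH iM] t /andP[xt tx].
  rewrite expr0 mulr1.
  have [j [/andP[kj jM] xj tj]] : exists j, [/\ (k <= j <= k + M)%N, x j <= t & t < x j.+1].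
    by apply: node_bracket xt _; rewrite addnS (le_lt_trans tx)// xlt// ltnSn.
  have j1m : (j.+1 < m)%N by apply: leq_ltn_trans kM; rewrite ltnS.
  have [MS1 /(_ j1m) MS2] := Markov_Stieltjes (ltnW j1m).
  rewrite /= (gam_step (ltnW j1m) xj)//.
  have t0 := le_trans xk0 xt; have xj0 := ltW (xpos (ltnW j1m)).
  have W1 : Wt (x j) <= Wt t by exact: Wt_mono.
  have W2 : Wt t <= Wt (x j.+1) by rewrite Wt_mono// ltW.
  have W3 : Wt (x k) <= Wt (x j) by rewrite Wt_mono// xle// ltnW.
  have W4 : Wt (x j.+1) <= Wt (x (k + M).+1) by rewrite Wt_mono ?(ltW (xpos j1m))// xle.
  by rewrite ler_norml; apply/andP; split; lra.
have [z [/andP[kz zM] ez]] : exists z, x k <= z <= x (k + M)%N /\ ek i.+1 z = 0.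
  (* The zero is sought from turning point [2k], which lies at or after [x k]; its upper node index
     [(2k + 1 + i + 1)/2] is at most [k + M] after rounding down. *)
  have ji : ((2 * k).+1 + i.+1 < 2 * m)%N.
    apply: (@leq_ltn_trans (2 * (k + M)).+1).
      by rewrite mulnDr addSn ltnS leq_add2l.
    by rewrite !mul2n -doubleS (leq_trans _ (_ : ((k + M).+1.*2 <= _)%N)) ?leq_double.
  have [z [/andP[z1 z2] ez]] := ek_zero (ltn0Sn i) ji; exists z; split=> //.
  have h1 : (2 * k)./2 = k by rewrite mul2n doubleK.
  rewrite h1 in z1; rewrite z1 (le_trans z2)// xle//.
  by rewrite leq_half_double -mul2n mulnDr addSn ltnS leq_add2l.
have w0 : 0 <= (Wt (x (k + M).+1) - Wt (x k)) * (x (k + M)%N - x k) ^+ i.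
  by apply: le_trans (IH (ltnW iM) (x k) _); rewrite ?lexx ?xle ?leq_addr.
have [zt|tz] := leP z t.
  have z0 := le_trans xk0 kz.
  rewrite -[ek _ t]subr0 -ez ek_diff//.
  apply: le_trans (Int_bound zt (itg_ek_oc i t z0) _) _.
    move=> y /andP[zy yt]; apply: (IH (ltnW iM)).
    by rewrite (le_trans kz (ltW zy)) (le_trans yt tx).
  rewrite exprSr mulrA ler_wpM2l//; lra.
have t0 := le_trans xk0 xt.
rewrite -normrN -[- _]add0r -ez ek_diff ?(ltW tz)//.
apply: le_trans (Int_bound (ltW tz) (itg_ek_oc i z t0) _) _.
  move=> y /andP[ty yz]; apply: (IH (ltnW iM)).
  by rewrite (le_trans xt (ltW ty)) (le_trans yz zM).
rewrite exprSr mulrA ler_wpM2l//; lra.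
Qed.

Lemma gam_before t : t < x 0%N -> gam t = 0.
Proof.
move=> tx; apply: big1 => k _; rewrite /stp leNgt (lt_le_trans tx) ?mulr0//.
by rewrite xle.
Qed.

Lemma gam_le_Wt k t : (k.+1 < m)%N -> t < x k.+1 -> gam t <= Wt (x k.+1).
Proof.
move=> k1m tx; have [_ /(_ k1m) /ltW] := Markov_Stieltjes (ltnW k1m).
apply: le_trans; rewrite /gam /gamk [leRHS]big_mkcond; apply: ler_sum => j _.
have [jk|kj] := leqP j k.
  by rewrite ler_piMr ?(ltW (lam_gt0 _))//; have /andP[] := stp_bound (x j) t.
have -> : stp (x j) t = 0 by rewrite /stp leNgt (lt_le_trans tx)// xle.
by rewrite mulr0.
Qed.

End GaussKernels.

(** * Sturm comparison and the spacing of Laguerre zeros *)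

Section Sturm.
Variable R : realType.

Lemma derivative_nincr (f df : R -> R) (a b : R) : a <= b ->
  (forall y, a <= y <= b -> is_derive y 1 f (df y)) ->
  (forall y, a <= y <= b -> df y <= 0) -> f b <= f a.
Proof.
rewrite le_eqVlt => /predU1P[->//|ab] dF df0.
have cf : {within `[a, b], continuous f}.
  by apply: continuous_in_subspaceT => y /set_mem /=; rewrite in_itv/= => /dF; exact: derive_cont.
have [|c] := @MVT R f df a b ab _ cf.
  by move=> y; rewrite in_itv/= => /andP[/ltW ay /ltW yb]; apply: dF; rewrite ay.
rewrite in_itv/= => /andP[/ltW ac /ltW cb] E.
by rewrite -subr_le0 E mulr_le0_ge0 ?subr_ge0 ?(ltW ab)// df0// ac.
Qed.

(** The Wronskian [v' psi - v psi'] with [psi = sin (w (y - y0))] has derivative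
    [(w^2 - Q) v psi <= 0] over half a period, but it equals [- w v < 0] at the left end and
    [w v > 0] at the right end. *)
Lemma Sturm_pos (v v1 Q : R -> R) (y0 w : R) : 0 < w ->
  (forall y, y0 <= y <= y0 + pi / w -> is_derive y 1 v (v1 y)) ->
  (forall y, y0 <= y <= y0 + pi / w -> is_derive y 1 v1 (- (Q y * v y))) ->
  (forall y, y0 <= y <= y0 + pi / w -> w ^+ 2 <= Q y) ->
  (forall y, y0 <= y <= y0 + pi / w -> 0 < v y) -> False.
Proof.
move=> w0 dv dv1 Qw vp; have pw : 0 < pi / w by rewrite divr_gt0// pi_gt0.
have b0 : y0 <= y0 + pi / w by rewrite lerDl ltW.
pose psi y := sin (w * (y - y0)); pose psi1 y := w * cos (w * (y - y0)).
have dlin (y : R) : is_derive y 1 (fun y => w * (y - y0)) w.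
  apply: derive_eqv (deriveM_fun (is_derive_cst w y 1) (deriveB_fun (is_derive_id y 1) (is_derive_cst y0 y 1))) _.
  by rewrite /cst; ring.
have dpsi (y : R) : is_derive y 1 psi (psi1 y).
  by apply: derive_eqv (derive_comp_fun (is_derive_sin _) (dlin y)) _; rewrite /psi1 mulrC.
have dpsi1 (y : R) : is_derive y 1 psi1 (- (w ^+ 2 * psi y)).
  have d := derive_comp_fun (is_derive_cos _) (dlin y).
  apply: derive_eqv (deriveM_fun (is_derive_cst w y 1) d) _.
  by rewrite /psi /cst; ring.
have := @derivative_nincr (fun y => v1 y * psi y - v y * psi1 y)
  (fun y => (w ^+ 2 - Q y) * (v y * psi y)) _ _ b0.
have wb : w * (y0 + pi / w - y0) = pi by field; rewrite gt_eqF.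
rewrite /psi /psi1 wb subrr mulr0 sin0 cos0 sinpi cospi.
rewrite !mulr0 !sub0r.
have H1 := vp y0; rewrite lexx b0 in H1; have {}H1 := H1 isT.
have H2 := vp (y0 + pi / w); rewrite lexx b0 in H2; have {}H2 := H2 isT.
have H : - (v (y0 + pi / w) * (w * -1)) <= - (v y0 * (w * 1)) -> False.
  by apply/negP; rewrite -ltNge; have := mulr_gt0 H1 w0; have := mulr_gt0 H2 w0; lra.
move=> K; apply: H; apply: K => y yb.
  apply: derive_eqv (deriveB_fun (deriveM_fun (dv1 y yb) (dpsi y)) (deriveM_fun (dv y yb) (dpsi1 y))) _.
  by rewrite /psi1 /psi; ring.
rewrite mulr_le0_ge0 ?subr_le0 ?Qw// mulr_ge0 ?(ltW (vp _ yb))//.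
move: yb => /andP[ya yb]; apply: sin_ge0_pi; rewrite mulr_ge0 ?subr_ge0 ?(ltW w0)//=.
by rewrite mulrC -ler_pdivlMr// lerBlDl.
Qed.

Lemma Sturm (v v1 Q : R -> R) (y0 w : R) : 0 < w ->
  (forall y, y0 <= y <= y0 + pi / w -> is_derive y 1 v (v1 y)) ->
  (forall y, y0 <= y <= y0 + pi / w -> is_derive y 1 v1 (- (Q y * v y))) ->
  (forall y, y0 <= y <= y0 + pi / w -> w ^+ 2 <= Q y) ->
  exists2 y, y0 <= y <= y0 + pi / w & v y = 0.
Proof.
move=> w0 dv dv1 Qw; apply: contrapT => nz.
have nz' y : y0 <= y <= y0 + pi / w -> v y != 0.
  by move=> yb; apply/eqP => e; apply: nz; exists y.
have pw : 0 < pi / w by rewrite divr_gt0// pi_gt0.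
have b0 : y0 <= y0 + pi / w by rewrite lerDl ltW.
have cst_sign y : y0 <= y <= y0 + pi / w -> 0 < v y0 * v y.
  move=> /andP[ya yb]; rewrite lt_neqAle eq_sym mulf_neq0 ?nz' ?lexx ?ya//=.
  rewrite leNgt; apply/negP => neg.
  have cv : {within `[y0, y], continuous v}.
    apply: continuous_in_subspaceT => z /set_mem /=; rewrite in_itv/= => /andP[z1 z2].
    by apply: (@derive_cont _ _ _ (v1 z)); apply: dv; rewrite z1 (le_trans z2).
  have [|z] := IVT ya cv (v := 0).
    rewrite ge_min le_max; apply/andP; split; apply: contraT; rewrite negb_or -!ltNge => /andP[h1 h2].
      by move: neg; rewrite ltNge mulr_ge0 ?ltW.
    by move: neg; rewrite ltNge mulr_le0 ?ltW.
  rewrite in_itv/= => /andP[z1 z2] vz; apply: nz; exists z => //.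
  by rewrite z1 (le_trans z2).
(* Multiplying by the constant [v y0] makes a zero-free solution positive. *)
apply: (@Sturm_pos (fun y => v y0 * v y) (fun y => v y0 * v1 y) Q y0 w) => // y yb.
  apply: derive_eqv (deriveM_fun (is_derive_cst (v y0) y 1) (dv y yb)) _.
  by rewrite /cst; ring.
apply: derive_eqv (deriveM_fun (is_derive_cst (v y0) y 1) (dv1 y yb)) _.
by rewrite /cst; ring.
Qed.

(* Liouville form of the Laguerre equation in the variable [y = sqrt x] *)
Lemma Laguerre_Liouville (alpha : R) (m : nat) (p : {poly R}) (y : R) : 0 < y ->
  'X * p^`()^`() + ((alpha + 1)%:P - 'X) * p^`() + m%:R *: p = 0 ->
  let e y := expR (- (y * y / 2)) * y `^ (alpha + 2^-1) in
  let v y := e y * p.[y * y] in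
  let v1 y := e y * (((alpha + 2^-1) / y - y) * p.[y * y] + 2 * y * p^`().[y * y]) in
  is_derive y 1 v (v1 y) /\
  is_derive y 1 v1 (- ((4 * m%:R + 2 * alpha + 2 - y * y + (4^-1 - alpha ^+ 2) / (y * y)) * v y)).
Proof.
move=> y0 ode e v v1; have yn0 : y != 0 by rewrite gt_eqF.
have dsq : is_derive y 1 (fun y : R => y * y) (2 * y).
  by apply: derive_eqv (deriveM_fun (is_derive_id y 1) (is_derive_id y 1)) _; ring.
have dpo (q : {poly R}) : is_derive y 1 (fun y => q.[y * y]) (2 * y * q^`().[y * y]).
  by apply: derive_eqv (@derive_comp_fun _ (fun y => y * y) (horner q) y _ _ (is_derive_poly q (y * y)) dsq) _; rewrite mulrC.
have de : is_derive y 1 e (e y * ((alpha + 2^-1) / y - y)).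
  have d1 : is_derive y 1 (fun y : R => - (y * y / 2)) (- y).
    apply: derive_eqv (is_deriveN (deriveM_fun dsq (is_derive_cst (2^-1 : R) y 1))) _.
    by rewrite /cst; field.
  have d2 := derive_comp_fun (is_derive_expR _) d1.
  apply: derive_eqv (deriveM_fun d2 (is_derive1_powR (alpha + 2^-1) y0)) _.
  rewrite /e powRB; last by rewrite (gt_eqF y0) implybT.
  by rewrite powRr1 ?ltW//; field.
have dc : is_derive y 1 (fun y : R => (alpha + 2^-1) / y - y) (- ((alpha + 2^-1) / (y * y)) - 1).
  have dV := is_deriveV yn0 (is_derive_id y 1).
  apply: derive_eqv (deriveB_fun (deriveM_fun (is_derive_cst (alpha + 2^-1) y 1) dV) (is_derive_id y 1)) _.
  by rewrite /cst /GRing.scale/=; field.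
split.
  by apply: derive_eqv (deriveM_fun de (dpo p)) _; rewrite /v1; ring.
have d2y : is_derive y 1 (fun y : R => 2 * y) 2.
  by apply: derive_eqv (deriveM_fun (is_derive_cst (2 : R) y 1) (is_derive_id y 1)) _; rewrite /cst; ring.
have dA := deriveD_fun (deriveM_fun dc (dpo p)) (deriveM_fun d2y (dpo p^`())).
apply: derive_eqv (deriveM_fun de dA) _.
have := congr1 (fun q => q.[y * y]) ode.
rewrite !(hornerD, hornerM, hornerZ, hornerN, hornerC, hornerX).
set p0 := p.[_]; set p1 := p^`().[_]; set p2 := p^`()^`().[_] => E.
rewrite /v -/p0; set E0 := e y.
have E2 : y * y * p2 = - ((alpha + 1 - y * y) * p1 + m%:R * p0).
  by apply/eqP; rewrite -addr_eq0 -E; apply/eqP; ring.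
have p2E : p2 = - ((alpha + 1 - y * y) * p1 + m%:R * p0) / (y * y) by rewrite -E2; field.
by rewrite p2E; field.
Qed.

(** The upper condition gives [4 m - z^2 >= 4 (1 - theta) m] on the interval. Half of this absorbs
    the term in [1/z^2], by the lower condition on [y], and the other half is the comparison
    frequency squared. *)
Lemma Laguerre_zero_gap (alpha theta : R) (m : nat) (p : {poly R}) (y : R) : -1 < alpha ->
  theta < 1 -> (0 < m)%N -> 0 < y ->
  'X * p^`()^`() + ((alpha + 1)%:P - 'X) * p^`() + m%:R *: p = 0 ->
  (`|4^-1 - alpha ^+ 2| + 1) / (2 * (1 - theta)) <= y ^+ 2 * m%:R ->
  (y + pi / Num.sqrt (2 * (1 - theta) * m%:R)) ^+ 2 <= 4 * theta * m%:R ->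
  exists2 z, y <= z <= y + pi / Num.sqrt (2 * (1 - theta) * m%:R) & root p (z ^+ 2).
Proof.
move=> al th m0 y0 ode yK yT; have mp : 0 < m%:R :> R by rewrite ltr0n.
have th0 : 0 < 1 - theta by rewrite subr_gt0.
have w2 : 0 < 2 * (1 - theta) * m%:R by rewrite !mulr_gt0.
have w0 : 0 < Num.sqrt (2 * (1 - theta) * m%:R) by rewrite sqrtr_gt0.
pose Q y := 4 * m%:R + 2 * alpha + 2 - y * y + (4^-1 - alpha ^+ 2) / (y * y).
pose e y := expR (- (y * y / 2)) * y `^ (alpha + 2^-1).
have zp z : y <= z <= y + pi / Num.sqrt (2 * (1 - theta) * m%:R) -> 0 < z.
  by case/andP => + _; exact: lt_le_trans.
have [|||z] := @Sturm (fun y => e y * p.[y * y])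
  (fun y => e y * (((alpha + 2^-1) / y - y) * p.[y * y] + 2 * y * p^`().[y * y])) Q y _ w0.
- by move=> z /zp z0; exact: (Laguerre_Liouville z0 ode).1.
- by move=> z /zp z0; exact: (Laguerre_Liouville z0 ode).2.
- move=> z zI; have z0 := zp _ zI; have /andP[yz zb] := zI.
  rewrite sqr_sqrtr ?ltW// /Q.
  have h1 : z * z <= 4 * theta * m%:R.
    by apply: le_trans yT; rewrite -expr2 lerXn2r// ?nnegrE ltW// (lt_le_trans z0).
  have h2 : - (2 * (1 - theta) * m%:R) <= (4^-1 - alpha ^+ 2) / (z * z).
    have zz0 : 0 < z * z by rewrite mulr_gt0.
    have yz2 : y ^+ 2 <= z * z by rewrite -expr2 lerXn2r// ?nnegrE ltW.
    rewrite ler_pdivlMr// mulNr lerNl.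
    have h3 : `|4^-1 - alpha ^+ 2| <= z * z * m%:R * (2 * (1 - theta)).
      rewrite -ler_pdivrMr ?mulr_gt0//; apply: le_trans (le_trans _ yK) _.
        by rewrite ler_pM2r ?invr_gt0 ?mulr_gt0// lerDl.
      by rewrite ler_pM2r.
    apply: le_trans (le_trans _ h3) _; first by rewrite -normrN; exact: ler_norm.
    by rewrite le_eqVlt; apply/orP; left; apply/eqP; ring.
  move: h1 h2; set A := _ / (z * z); move: al; set M := m%:R; lra.
move=> zI ez; exists z => //; move: ez => /eqP; rewrite mulf_eq0 expr2 => /orP[|//].
by rewrite gt_eqF// /e mulr_gt0 ?expR_gt0// powR_gt0// (zp _ zI).
Qed.

End Sturm.

(** * Bounds for the kernels near the origin and in the bulk *)

Section KernelBounds.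
Variables (R : realType) (alpha : R) (m : nat) (p : {poly R}) (x lam : nat -> R).
Notation mu := (@lebesgue_measure R).
Local Notation wt := (wt alpha).
Local Notation Lf := (Lf alpha).
Local Notation Wt := (Wt alpha).
Local Notation gam := (gam m x lam).
Local Notation ek := (ek alpha m x lam).
Implicit Types (q Q : {poly R}) (t u T z y : R) (i j k n : nat).
Hypothesis alpha_gt : -1 < alpha.
Hypothesis iw : forall q, itg `]0, +oo[ (fun y => q.[y] * wt y).
Hypothesis m_gt0 : (0 < m)%N.
Hypothesis xpos : forall k, (k < m)%N -> 0 < x k.
Hypothesis xlt : forall i j, (i < j < m)%N -> x i < x j.
Hypothesis lam_gt0 : forall k, (k < m)%N -> 0 < lam k.
Hypothesis exact_ : forall q, (size q <= 2 * m)%N -> Lf q = \sum_(k < m) lam k * q.[x k].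
Hypothesis proots : forall z, root p z -> exists2 k, (k < m)%N & x k = z.
Hypothesis ode : 'X * p^`()^`() + ((alpha + 1)%:P - 'X) * p^`() + m%:R *: p = 0.

Let mR : 0 < m%:R :> R. Proof. by rewrite ltr0n. Qed.

(** The power is integrated on [[s, t]] only, since it may be unbounded at 0; the mass of [(0, s]]
    is made smaller than any given [e]. *)
Lemma Wt_le t : 0 <= t -> Wt t <= t `^ (alpha + 1) / (alpha + 1).
Proof.
have a1 : 0 < alpha + 1 by move: alpha_gt; lra.
rewrite le_eqVlt => /predU1P[<-|t0].
  by rewrite /Wt Int_ge// divr_ge0 ?powR_ge0// ltW.
apply/ler_addgt0Pr => e e0.
have ci := continuous_Int (itg_wt iw t).
have c0 : Int 0 s wt @[s --> 0^'+] --> (0 : R).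
  have /(continuous_within_itvP _ t0)[_ + _] := ci; rewrite [X in _ --> X -> _](_ : _ = 0)//.
  by rewrite Int_ge.
move/cvgrPdist_lt: c0 => /(_ _ e0) c0.
have [s [s0 st se]] : exists s, [/\ 0 < s, s < t & Int 0 s wt < e].
  near ((0 : R)^'+) => s; exists s; split.
  - by near: s; exact: nbhs_right_gt.
  - by near: s; exact: nbhs_right_lt.
  - near: s; apply: filterS c0 => s; rewrite sub0r normrN; exact: le_lt_trans (ler_norm _).
rewrite /Wt (Int_split (ltW s0) (ltW st) (itg_wt iw t)) addrC lerD ?(ltW se)//.
pose F y : R := (alpha + 1)^-1 * y `^ (alpha + 1).
have dF y : s <= y <= t -> is_derive y 1 F (y `^ alpha).
  move=> /andP[sy _]; have y0 := lt_le_trans s0 sy.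
  apply: derive_eqv (deriveM_fun (is_derive_cst ((alpha + 1)^-1) y 1) (is_derive1_powR (alpha + 1) y0)) _.
  by rewrite /cst addrK; field; rewrite gt_eqF.
have cF y : s <= y <= t -> {for y, continuous (fun z : R => z `^ alpha)}.
  move=> /andP[sy _]; have y0 := lt_le_trans s0 sy.
  exact: derive_cont (is_derive1_powR alpha y0).
apply: (@le_trans _ _ (Int s t (fun z : R => z `^ alpha))).
  apply: Int_le; [exact: itg_oc (ltW s0) (lexx _) (itg_wt iw t)|exact: continuous_itg|].
  move=> y /andP[sy _]; rewrite ler_piMr ?powR_ge0// expR_le1 oppr_le0.
  by rewrite ltW// (lt_trans s0 sy).
rewrite (Int_FTC (ltW st) dF cF) /F mulrC [X in _ - X]mulrC lerBlDr lerDl.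
by rewrite divr_ge0 ?powR_ge0// ltW.
Unshelve. all: by end_near. Qed.

Lemma ek_crude i t : 0 <= t -> `|ek i t| <= t ^+ i * (Wt t + gam t).
Proof.
move=> t0; have G0 s : 0 <= s -> s <= t -> 0 <= Wt s /\ 0 <= gam s.
  move=> s0 st; split; first by apply: Int_ge0 => y _; exact: wt_ge0.
  apply: sumr_ge0 => k _; rewrite mulr_ge0 ?(ltW (lam_gt0 _))//.
  by have /andP[] := stp_bound (x k) s.
suff H : forall s, 0 <= s -> s <= t -> `|ek i s| <= t ^+ i * (Wt t + gam t) by exact: H.
elim: i => [|i IH] s s0 st.
  have [W0 g0] := G0 s s0 st; rewrite expr0 mul1r /=; apply: le_trans (ler_normB _ _) _.
  rewrite !ger0_norm// lerD//; first exact: (Wt_mono iw).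
  by apply: gam_mono.
have [Wt0 gt0] := G0 t t0 (lexx _).
rewrite /=; apply: le_trans (Int_bound s0 (itg_ek m x lam iw i s) _) _.
  by move=> y /andP[/ltW y0 ys]; apply: IH => //; exact: le_trans st.
rewrite subr0 exprS -mulrA mulrC ler_wpM2r// mulr_ge0 ?exprn_ge0//; exact: addr_ge0.
Qed.

(* meant for [t] of order [1/m], where [sqrt (b m)] is bounded *)
Lemma ek_small i t b C : 0 < t -> t <= b -> Wt t + gam t <= C * t `^ (alpha + 1) ->
  `|ek i t| <= C * expR b * Num.sqrt (b * m%:R) ^+ i.+1 * Num.sqrt (t / m%:R) ^+ i.+1 * wt t.
Proof.
move=> t0 tb GC; have b0 := lt_le_trans t0 tb.
have C0 : 0 <= C.
  rewrite -(pmulr_lge0 _ (powR_gt0 (alpha + 1) t0)); apply: le_trans GC.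
  rewrite addr_ge0//; first by apply: Int_ge0 => y _; exact: wt_ge0.
  apply: sumr_ge0 => k _; rewrite mulr_ge0 ?(ltW (lam_gt0 _))//.
  by have /andP[] := stp_bound (x k) t.
apply: le_trans (ek_crude i (ltW t0)) _.
apply: le_trans (_ : t ^+ i * (C * t `^ (alpha + 1)) <= _).
  by rewrite ler_wpM2l ?exprn_ge0// ltW.
have -> : t ^+ i * (C * t `^ (alpha + 1)) = C * t ^+ i.+1 * t `^ alpha.
  rewrite powRD; last by rewrite (gt_eqF t0) implybT.
  by rewrite powRr1 ?(ltW t0)// exprS; ring.
have ts : t ^+ i.+1 <= Num.sqrt (b * m%:R) ^+ i.+1 * Num.sqrt (t / m%:R) ^+ i.+1.
  rewrite -exprMn lerXn2r ?nnegrE ?mulr_ge0 ?sqrtr_ge0 ?(ltW t0)//.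
  rewrite -sqrtrM; last by rewrite mulr_ge0// ltW.
  have -> : b * m%:R * (t / m%:R) = b * t by field; rewrite gt_eqF.
  by rewrite -[leLHS](ger0_norm (ltW t0)) -sqrtr_sqr ler_wsqrtr// expr2 ler_wpM2r// ltW.
have ta : t `^ alpha <= expR b * wt t.
  by rewrite /wt mulrCA ler_peMr ?powR_ge0// -expRD -expR0 ler_expR subr_ge0.
apply: (@le_trans _ _ (C * (Num.sqrt (b * m%:R) ^+ i.+1 * Num.sqrt (t / m%:R) ^+ i.+1) * (expR b * wt t))); last first.
  by rewrite le_eqVlt; apply/orP; left; apply/eqP; ring.
apply: ler_pM => //; rewrite ?mulr_ge0 ?exprn_ge0 ?powR_ge0 ?(ltW t0)//.
by rewrite ler_wpM2l.
Qed.

Section Bulk.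
Variables (theta D y : R) (M : nat).
Hypothesis th01 : 0 < theta < 1.
Let d := pi / Num.sqrt (2 * (1 - theta) * m%:R).
Let K1 := (`|4^-1 - alpha ^+ 2| + 1) / (2 * (1 - theta)).
Hypothesis ylow : K1 <= (y - d) ^+ 2 * m%:R.
Hypothesis yd : 2 * d <= y.
Hypothesis yup : (y + (2 * M.+1)%:R * d) ^+ 2 <= 4 * theta * m%:R.

Let d_gt0 : 0 < d.
Proof.
move: th01 => /andP[_ t1].
by rewrite /d divr_gt0 ?pi_gt0// sqrtr_gt0 !mulr_gt0// subr_gt0.
Qed.

Lemma node_in u : y - d <= u -> u + d <= y + (2 * M.+1)%:R * d ->
  exists2 k, (k < m)%N & u ^+ 2 <= x k <= (u + d) ^+ 2.
Proof.
move=> yu ud; have y0 : 0 < y - d by move: yd d_gt0; lra.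
have u0 : 0 < u := lt_le_trans y0 yu.
have ud0 : 0 <= u + d by rewrite addr_ge0 ?(ltW u0) ?(ltW d_gt0).
move: th01 => /andP[t0 t1].
have [||z /andP[uz zu] /proots [k km xk]] := @Laguerre_zero_gap R alpha theta m p u alpha_gt t1 m_gt0 u0 ode.
- apply: le_trans ylow _; rewrite ler_wpM2r ?ler0n// lerXn2r// ?nnegrE ltW//.
- by apply: le_trans yup; rewrite lerXn2r ?nnegrE ?(le_trans _ ud).
- have z0 := le_trans (ltW u0) uz.
  by exists k => //; rewrite xk !lerXn2r ?nnegrE ?(ltW u0).
Qed.

(** [k] is the last node index with [x k <= y^2]. The gap estimate just left of [y] bounds [x k]
    from below; used repeatedly to the right it produces [M + 1] further nodes. *)
Lemma node_window : exists k, [/\ (k + M.+1 < m)%N, (y - d) ^+ 2 <= x k,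
  x k <= y ^+ 2, y ^+ 2 < x k.+1 & x (k + M.+1)%N <= (y + (2 * M.+1)%:R * d) ^+ 2].
Proof.
have y0 : 0 < y - d by move: yd d_gt0; lra.
have y1 : 0 < y by move: yd d_gt0; lra.
have [|a am /andP[ya ay]] := node_in (lexx (y - d)).
  by rewrite subrK lerDl mulr_ge0// ltW.
rewrite subrK in ay.
have [k [km xk kmax]] : exists k, [/\ (k < m)%N, x k <= y ^+ 2 & forall j, (j < m)%N -> x j <= y ^+ 2 -> (j <= k)%N].
  have exP : exists k, (k < m)%N && (x k <= y ^+ 2) by exists a; rewrite am.
  have ub k : (k < m)%N && (x k <= y ^+ 2) -> (k <= m)%N by case/andP => /ltnW.
  case: (ex_maxnP exP ub) => k /andP[km xk] kmax; exists k; split=> // j jm xj.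
  by apply: kmax; rewrite jm.
have chain j : (j <= M.+1)%N -> exists b, [/\ (k + j <= b)%N, (b < m)%N & x b <= (y + (2 * j)%:R * d) ^+ 2].
  elim: j => [_|j IH jM]; first by exists k; rewrite addn0 muln0 mul0r addr0.
  have [b [kb bm xb]] := IH (ltnW jM).
  (* The steps have length [2 d] although each gap is at most [d]: the skipped interval separates
     the new node strictly from the previous one, so no node is counted twice. *)
  have [||c cm /andP[c1 c2]] := node_in (u := y + (2 * j).+1%:R * d).
  - apply: (@le_trans _ _ y); first by move: d_gt0; lra.
    by rewrite lerDl mulr_ge0 ?ler0n ?(ltW d_gt0).
  - rewrite -addrA -{2}[d]mul1r -mulrDl natr1 lerD2l ler_wpM2r ?(ltW d_gt0)// ler_nat.
    by rewrite !mul2n -doubleS leq_double.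
  exists c; split=> //; last first.
    apply: le_trans c2 _; rewrite -addrA -{2}[d]mul1r -mulrDl natr1.
    by rewrite mulnS.
  rewrite addnS; apply: leq_ltn_trans kb _.
  rewrite ltnNge; apply/negP => cb; have := xle xlt cb bm.
  rewrite leNgt => /negP; apply; apply: le_lt_trans xb (lt_le_trans _ c1).
  have h : y + (2 * j)%:R * d < y + (2 * j).+1%:R * d by rewrite ltrD2l ltr_pM2r// ltr_nat.
  have h0 : 0 <= y + (2 * j)%:R * d by rewrite addr_ge0 ?(ltW y1)// mulr_ge0 ?ler0n ?(ltW d_gt0).
  by rewrite ltr_pXn2r ?nnegrE// (le_trans h0 (ltW h)).
have [b [kb bm xb]] := chain M.+1 (leqnn _).
have kM : (k + M.+1 < m)%N by exact: leq_ltn_trans kb bm.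
exists k; split=> //.
- by apply: le_trans ya _; apply: (xle xlt) => //; exact: kmax.
- rewrite ltNge; apply/negP => xk1.
  have k1m : (k.+1 < m)%N by apply: leq_ltn_trans kM; rewrite addnS ltnS leq_addr.
  by have := kmax _ k1m xk1; rewrite ltnn.
- by apply: le_trans xb; exact: (xle xlt).
Qed.

Hypothesis M_gt0 : (0 < M)%N.

(** Comparability is required in both directions because [alpha] may have either sign. *)
Lemma powR_ratio t u (K : R) : 0 < t -> 0 < u -> 1 <= K -> t <= K * u -> u <= K * t ->
  u `^ alpha <= K `^ `|alpha| * t `^ alpha.
Proof.
move=> t0 u0 K1' tu ut; have K0 := lt_le_trans ltr01 K1'.
have [a0|a0] := leP 0 alpha.
  rewrite (ger0_norm a0) -powRM ?(ltW t0) ?(ltW K0)//.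
  by apply: ge0_ler_powR => //; rewrite ?nnegrE ?mulr_ge0 ?(ltW u0) ?(ltW t0) ?(ltW K0).
have -> : u `^ alpha = (u `^ (- alpha))^-1 by rewrite powRN invrK.
have -> : t `^ alpha = (t `^ (- alpha))^-1 by rewrite powRN invrK.
have na : 0 <= - alpha by rewrite oppr_ge0 ltW.
rewrite (ltr0_norm a0).
rewrite ler_pdivlMr ?powR_gt0// mulrC ler_pdivrMr ?powR_gt0// -powRM ?(ltW u0) ?(ltW K0)//.
by apply: ge0_ler_powR => //; rewrite ?nnegrE ?mulr_ge0 ?(ltW u0) ?(ltW t0) ?(ltW K0).
Qed.

(** At [t = y^2] the window estimate is used with nodes whose distance is at most [B sqrt (t/m)];
    the weight changes only by a constant factor over such a window. As [d sqrt m] does not depend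
    on [m], neither does [B]. *)
Lemma ek_bulk i (B : R) : (i <= 2 * M)%N ->
  B = (2 * M.+1 + 1)%:R ^+ 2 * (d * Num.sqrt m%:R) ->
  `|ek i (y ^+ 2)| <= ((M.+2)%:R ^+ 2 * 4) `^ `|alpha| * expR (2 * B) * B ^+ i.+1
     * Num.sqrt (y ^+ 2 / m%:R) ^+ i.+1 * wt (y ^+ 2).
Proof.
move=> iM BE; have th1 : theta < 1 by case/andP: th01.
have y0 : 0 < y - d by move: yd d_gt0; lra.
have y1 : 0 < y by move: yd d_gt0; lra.
have t0 : 0 < y ^+ 2 by rewrite exprn_gt0.
have [k [kM ak xk kx bk]] := node_window.
set t := y ^+ 2; pose h := Num.sqrt (t / m%:R).
have kMm : ((k + M).+1 < m)%N by rewrite -addnS.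
have xkM : t <= x (k + M)%N.
  apply: le_trans (ltW kx) _; apply: (xle xlt) (ltnW kMm).
  by rewrite -addn1 leq_add2l.
have km : (k < m)%N by apply: leq_ltn_trans (leq_addr M.+1 k) kM.
have xk0 := xpos km.
have W := ek_window iw m_gt0 xpos xlt lam_gt0 exact_ kMm iM (_ : x k <= t <= x (k + M)%N).
have {}W := W _; rewrite xk xkM in W; have {}W := W isT.
have sm0 : 0 < Num.sqrt m%:R :> R by rewrite sqrtr_gt0.
have hE : h = y / Num.sqrt m%:R.
  by rewrite /h /t sqrtrM ?sqr_ge0// sqrtrV ?ler0n// sqrtr_sqr (ger0_norm (ltW y1)).
have B0 : 0 <= B by rewrite BE mulr_ge0 ?sqr_ge0// mulr_ge0 ?ltW.
have h0 : 0 <= h by exact: sqrtr_ge0.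
(* In the variable [y] the window has length [(2 (M + 1) + 1) d]; squaring brings a factor of order
   [y], and [d <= y] absorbs the quadratic term in [d]. *)
have Ly : x (k + M.+1)%N - x k <= B * h.
  have -> : B * h = (2 * M.+1 + 1)%:R ^+ 2 * (d * y) by rewrite hE BE; field; rewrite gt_eqF.
  apply: le_trans (lerB bk ak) _; set n2 := (2 * M.+1)%N; rewrite natrD.
  set n := n2%:R; have n0 : 2 <= n by rewrite /n /n2 ler_nat mulnS leq_addr.
  have -> : (y + n * d) ^+ 2 - (y - d) ^+ 2 = (n + 1) * d * (2 * y + (n - 1) * d) by ring.
  have -> : (n + 1) ^+ 2 * (d * y) = (n + 1) * d * ((n + 1) * y) by ring.
  have nd0 : 0 <= (n + 1) * d by rewrite mulr_ge0 ?(ltW d_gt0)//; move: n0; lra.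
  apply: (ler_wpM2l nd0).
  have : (n - 1) * d <= (n - 1) * y by rewrite ler_wpM2l//; move: yd d_gt0 n0; lra.
  have -> : (n + 1) * y = 2 * y + (n - 1) * y by ring.
  by rewrite lerD2l.
have LB : B * h <= 2 * B.
  rewrite mulrC ler_wpM2r// hE ler_pdivrMr// -[leLHS](ger0_norm (ltW y1)) -sqrtr_sqr.
  have -> : 2 * Num.sqrt m%:R = Num.sqrt (4 * m%:R) :> R.
    by rewrite sqrtrM// -[4](_ : 2 ^+ 2 = _ :> R) ?sqrtr_sqr ?ger0_norm//; rewrite expr2 -natrM.
  rewrite ler_wsqrtr//; apply: le_trans (le_trans _ yup) _.
    have nd : 0 <= (2 * M.+1)%:R * d by rewrite mulr_ge0 ?ler0n ?(ltW d_gt0).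
    by rewrite lerXn2r ?nnegrE ?lerDl// ?(ltW y1)// addr_ge0 ?(ltW y1).
  by rewrite ler_wpM2r// ler_piMr// ltW.
(* From [2 d <= y], points of the window lie between [t/4] and [(M + 2)^2 t]; one constant covers
   both directions of the ratio. The exponential changes by at most [expR (2 B)], the window length
   being at most [2 B]. *)
pose Ka : R := (M.+2)%:R ^+ 2 * 4.
have wb u : x k < u <= x (k + M).+1 -> wt u <= Ka `^ `|alpha| * expR (2 * B) * wt t.
  move=> /andP[ku uk]; have u0 : 0 < u := lt_trans xk0 ku.
  have -> : Ka `^ `|alpha| * expR (2 * B) * wt t = Ka `^ `|alpha| * t `^ alpha * (expR (2 * B) * expR (- t)).
    by rewrite /wt; ring.
  have Ka1 : 1 <= Ka.
    by rewrite /Ka -natrX -natrM ler1n muln_gt0 expn_gt0.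
  rewrite /wt; apply: ler_pM; rewrite ?powR_ge0 ?expR_ge0//.
    apply: powR_ratio => //.
      apply: le_trans (_ : 4 * u <= _); last first.
        by rewrite ler_wpM2r ?(ltW u0)// /Ka ler_peMl// -natrX ler1n expn_gt0.
      apply: le_trans (_ : 4 * x k <= _); last by rewrite ler_wpM2l// ltW.
      apply: le_trans (_ : 4 * (y - d) ^+ 2 <= _); last by rewrite ler_wpM2l.
      rewrite /t -[4](_ : 2 ^+ 2 = _ :> R); last by rewrite expr2 -natrM.
      rewrite -exprMn lerXn2r ?nnegrE ?(ltW y1) ?mulr_ge0 ?(ltW y0)//.
      by move: yd; lra.
    apply: le_trans uk _; rewrite -addnS; apply: le_trans bk _.
    apply: le_trans (_ : ((M.+2)%:R * y) ^+ 2 <= _); last first.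
      by rewrite exprMn /Ka ler_wpM2r ?(ltW t0)// ler_peMr ?sqr_ge0// ler1n.
    have nd : 0 <= (2 * M.+1)%:R * d by rewrite mulr_ge0 ?ler0n ?(ltW d_gt0).
    have h1 : y + (2 * M.+1)%:R * d <= (M.+2)%:R * y.
      have -> : (2 * M.+1)%:R * d = M.+1%:R * (2 * d) by rewrite natrM; ring.
      have -> : (M.+2)%:R * y = y + M.+1%:R * y by rewrite -[in LHS]natr1; ring.
      by rewrite lerD2l ler_wpM2l.
    have h2 := addr_ge0 (ltW y1) nd.
    by rewrite lerXn2r ?nnegrE// (le_trans h2).
  rewrite -expRD ler_expR; apply: le_trans (_ : - t + (x (k + M.+1)%N - x k) <= _); last first.
    by rewrite addrC lerD2r (le_trans Ly).
  have xM : x (k + M)%N <= x (k + M.+1)%N by apply: (xle xlt) => //; rewrite leq_add2l.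
  by move: (ltW ku) xkM xM; lra.
have xk0' := ltW xk0.
have xx : x k <= x (k + M).+1 by rewrite (xle xlt)// -addnS leq_addr.
have C0 : 0 <= Ka `^ `|alpha| * expR (2 * B) * wt t by rewrite !mulr_ge0 ?powR_ge0 ?expR_ge0.
have WL : Wt (x (k + M).+1) - Wt (x k) <= Ka `^ `|alpha| * expR (2 * B) * wt t * (B * h).
  rewrite (Wt_diff iw)//; apply: le_trans (ler_norm _) _.
  apply: le_trans (@Int_bound _ _ _ wt (Ka `^ `|alpha| * expR (2 * B) * wt t) xx (itg_oc xk0' (lexx _) (itg_wt iw _)) _) _.
    by move=> u /wb H; rewrite ger0_norm// wt_ge0.
  by rewrite ler_wpM2l// -addnS.
apply: le_trans W _.
apply: (@le_trans _ _ (Ka `^ `|alpha| * expR (2 * B) * wt t * (B * h) * (B * h) ^+ i)).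
  apply: ler_pM => //.
  - by rewrite subr_ge0 (Wt_mono iw).
  - by rewrite exprn_ge0// subr_ge0 (le_trans xk).
  - rewrite lerXn2r ?nnegrE ?mulr_ge0 ?subr_ge0 ?(le_trans xk xkM)//.
    apply: le_trans Ly; rewrite lerD2r (xle xlt)// leq_add2l leqnSn//.
rewrite le_eqVlt; apply/orP; left; apply/eqP.
by rewrite -/Ka -/h -mulrA -exprS exprMn; ring.
Qed.

End Bulk.

End KernelBounds.

(** * Kernel bounds uniform in m *)

Section LaguerreKernels.
Variables (R : realType) (alpha theta : R) (P : nat -> {poly R}) (X : nat -> seq R).
Hypothesis alpha_gt : -1 < alpha.
Hypothesis lag : laguerre_orthonormal alpha P.
Hypothesis zX : forall m, zeros_of (P m) (X m).
Hypothesis th01 : 0 < theta < 1.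
Local Notation wt := (wt alpha).
Local Notation Wt := (Wt alpha).
Local Notation node m := (fun k => (X m)`_k).
Local Notation ct m := (cotes alpha (X m)).
Local Notation gam m := (gam m (node m) (ct m)).
Local Notation ek m := (ek alpha m (node m) (ct m)).
Implicit Types (t b y C : R) (m i k r : nat).

Let iw : forall q : {poly R}, itg `]0, +oo[ (fun y => q.[y] * wt y) := itg_polyw lag.

Lemma node_pos m k : (k < m)%N -> 0 < (X m)`_k.
Proof. exact: (zeros_pos lag (zX m)). Qed.

Lemma node_lt m i j : (i < j < m)%N -> (X m)`_i < (X m)`_j.
Proof. exact: (zeros_lt lag (zX m)). Qed.

Lemma cotes_pos m k : (k < m)%N -> 0 < cotes alpha (X m) k.
Proof. exact: (cotes_gt0 lag (zX m)). Qed.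

Lemma cotes_exact m (q : {poly R}) : (size q <= 2 * m)%N ->
  Lf alpha q = \sum_(k < m) cotes alpha (X m) k * q.[(X m)`_k].
Proof. exact: (gauss_exact lag (zX m)). Qed.

Lemma node_root m z : root (P m) z -> exists2 k, (k < m)%N & (X m)`_k = z.
Proof.
have [_ rP] := zX m; have [sm _] := zeros_size_pos lag (zX m).
by move=> /rP /(nthP 0) [k]; rewrite sm => km <-; exists k.
Qed.

Lemma node0_ge m : (0 < m)%N -> (alpha + 1) / m%:R <= (X m)`_0.
Proof.
move=> m0; apply: (zeros_lower alpha_gt lag (zX m)).
by rewrite mem_nth// (zeros_size_pos lag (zX m)).1.
Qed.

Let a1 : 0 < alpha + 1. Proof. by move: alpha_gt; lra. Qed.

Let Wt_bound t : 0 <= t -> Wt t <= t `^ (alpha + 1) / (alpha + 1).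
Proof. exact: (Wt_le alpha_gt iw). Qed.

(** A node is counted only if [t] is at least the first node, and then
    [(t / x_0)^(alpha + 1) >= 1]. *)
Lemma gam_crude m t : (0 < m)%N -> 0 < t ->
  gam m t <= \sum_(k < m) cotes alpha (X m) k * (t / (X m)`_0) `^ (alpha + 1).
Proof.
move=> m0 t0; have x0 := node_pos m0.
apply: ler_sum => k _; rewrite ler_wpM2l ?(ltW (cotes_pos _))//.
rewrite /stp; case: (leP (X m)`_k t) => xt; last by rewrite powR_ge0.
have x0t : (X m)`_0 <= t.
  by apply: le_trans xt; apply: (xle (@node_lt m)).
rewrite [leLHS](_ : 1 = 1 `^ (alpha + 1)); last by rewrite powR1.
by rewrite ge0_ler_powR ?nnegrE ?ler01 ?(ltW a1) ?divr_ge0 ?(ltW t0) ?(ltW x0)// ler_pdivlMr// mul1r.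
Qed.

Let pow_unif (B : R) i r : 0 <= B -> (i < r)%N -> B ^+ i.+1 <= (1 + B) ^+ r.
Proof.
move=> B0 ir; apply: le_trans (_ : (1 + B) ^+ i.+1 <= _).
  by rewrite lerXn2r ?nnegrE ?addr_ge0// lerDr.
by rewrite ler_weXn2l// lerDl.
Qed.

(** The constant may depend on [m]: this serves the finitely many [m] too small for the asymptotic
    argument. *)
Lemma kernel_bound_fixed r m : (0 < m)%N -> exists C, 0 <= C /\
  forall i t, (i < r)%N -> 0 < t <= 4 * theta * m%:R ->
  `|ek m i t| <= C * Num.sqrt (t / m%:R) ^+ i.+1 * wt t.
Proof.
move=> m0; pose b := 4 * theta * m%:R; have x0 := node_pos m0.
pose G := \sum_(k < m) cotes alpha (X m) k.
have G0 : 0 <= G by apply: sumr_ge0 => k _; rewrite ltW// cotes_pos.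
pose C1 := (alpha + 1)^-1 + G * (((X m)`_0)^-1) `^ (alpha + 1).
have C10 : 0 <= C1 by rewrite addr_ge0 ?invr_ge0 ?mulr_ge0 ?powR_ge0// ltW.
exists (C1 * expR b * (1 + Num.sqrt (b * m%:R)) ^+ r).
have S0 : 0 <= (1 + Num.sqrt (b * m%:R)) ^+ r by rewrite exprn_ge0// ler_wpDr// sqrtr_ge0.
split; first by rewrite mulr_ge0// mulr_ge0// expR_ge0.
move=> i t ir /andP[t0 tb].
have GC : Wt t + gam m t <= C1 * t `^ (alpha + 1).
  rewrite mulrDl; apply: lerD; first by rewrite mulrC Wt_bound ?ltW.
  apply: le_trans (gam_crude m0 t0) _; rewrite -mulr_suml -/G -mulrA ler_wpM2l//.
  by rewrite -powRM ?invr_ge0 ?(ltW x0) ?(ltW t0)// mulrC.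
have H := ek_small iw m0 (@cotes_pos m) i t0 tb GC; apply: le_trans H _.
rewrite ler_wpM2r ?wt_ge0// ler_wpM2r ?exprn_ge0 ?sqrtr_ge0// ler_wpM2l ?mulr_ge0 ?expR_ge0//.
by rewrite pow_unif ?sqrtr_ge0.
Qed.

Lemma kernel_bound_large r : exists m0 C, 0 <= C /\
  forall m i t, (m0 <= m)%N -> (i < r)%N -> 0 < t <= 4 * theta * m%:R ->
  `|ek m i t| <= C * Num.sqrt (t / m%:R) ^+ i.+1 * wt t.
Proof.
move: th01 => /andP[th0 th1].
(* The windows extend to the right of [t <= 4 theta m]; the larger parameter leaves room for them
   within the range of Sturm comparison. *)
pose th := (1 + theta) / 2.
have th'01 : 0 < th < 1 by rewrite /th; apply/andP; split; lra.
have tht : theta < th by rewrite /th; lra.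
have nt0 : 0 < 2 * (1 - th) by move: th'01 => /andP[_]; lra.
pose D : R := pi / Num.sqrt (2 * (1 - th)).
have D0 : 0 < D by rewrite divr_gt0 ?pi_gt0// sqrtr_gt0.
pose K1 := (`|4^-1 - alpha ^+ 2| + 1) / (2 * (1 - th)).
have K10 : 0 < K1 by rewrite divr_gt0// ltr_wpDl.
(* For [y^2 >= K0/m] the part [4 D^2] gives [2 d <= y]; then [y - d >= y/2], and the part [4 K1]
   gives the lower condition. *)
pose K0 := 4 * (K1 + D ^+ 2).
have K00 : 0 < K0 by rewrite mulr_gt0// addr_gt0// exprn_gt0.
pose M := r.+1.
pose gap := Num.sqrt th - Num.sqrt theta.
have gap0 : 0 < gap by rewrite subr_gt0 ltr_sqrt// (lt_trans th0).
(* Two demands on [m]: the [2 (M + 1)] steps of length [d] fit between [2 sqrt (theta m)] and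
   [2 sqrt (th m)], and [K0/m] lies below [4 theta m]. *)
pose m0 := (Num.bound ((M.+1)%:R * D / gap) + Num.bound (K0 / (4 * theta)) + 1)%N.
pose B := (2 * M.+1 + 1)%:R ^+ 2 * D.
have B0 : 0 <= B by rewrite mulr_ge0 ?sqr_ge0 ?ltW.
pose Ka := ((M.+2)%:R ^+ 2 * 4) `^ `|alpha| * expR (2 * B).
have Ka0 : 0 <= Ka by rewrite mulr_ge0 ?powR_ge0 ?expR_ge0.
pose C1 := (1 + (4 * K0 / (alpha + 1)) `^ (alpha + 1)) / (alpha + 1).
have C10 : 0 <= C1.
  by rewrite /C1 divr_ge0 ?(ltW a1)// ler_wpDr// powR_ge0.
exists m0, (Ka * (1 + B) ^+ r + C1 * expR K0 * (1 + Num.sqrt K0) ^+ r).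
have CA : 0 <= Ka * (1 + B) ^+ r by rewrite mulr_ge0 ?exprn_ge0 ?addr_ge0.
have CB : 0 <= C1 * expR K0 * (1 + Num.sqrt K0) ^+ r.
  by rewrite mulr_ge0 ?exprn_ge0 ?ler_wpDr ?sqrtr_ge0// mulr_ge0// expR_ge0.
split; first exact: addr_ge0.
move=> m i t mm ir /andP[t0 tT].
have m_gt0 : (0 < m)%N by apply: leq_trans mm; rewrite /m0 addn1.
have mR : 0 < m%:R :> R by rewrite ltr0n.
have sm0 : 0 < Num.sqrt m%:R :> R by rewrite sqrtr_gt0.
have m1R : 1 <= m%:R :> R by rewrite ler1n.
have mA : (M.+1)%:R * D <= gap * m%:R.
  rewrite [leRHS]mulrC -ler_pdivrMr// ltW//.
  apply: lt_le_trans (archi_boundP _) _; first exact: divr_ge0 (mulr_ge0 (ler0n _ _) (ltW D0)) (ltW gap0).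
  by rewrite ler_nat; apply: leq_trans mm; rewrite /m0 -addnA leq_addr.
have mB : K0 <= 4 * theta * m%:R.
  rewrite [leRHS]mulrC -ler_pdivrMr ?mulr_gt0// ltW//.
  apply: lt_le_trans (archi_boundP _) _; first exact: divr_ge0 (ltW K00) (mulr_ge0 (ler0n _ _) (ltW th0)).
  by rewrite ler_nat; apply: leq_trans mm; rewrite /m0 addnAC leq_addl.
set d := pi / Num.sqrt (2 * (1 - th) * m%:R).
have dE : d = D / Num.sqrt m%:R by rewrite /d /D sqrtrM ?(ltW nt0)// invfM mulrA.
have d0 : 0 < d by rewrite dE divr_gt0.
(* side conditions of the bulk estimates for [y = sqrt t] *)
have bulk s : K0 / m%:R <= s -> s <= 4 * theta * m%:R -> let y := Num.sqrt s in
    [/\ K1 <= (y - d) ^+ 2 * m%:R, 2 * d <= y & (y + (2 * M.+1)%:R * d) ^+ 2 <= 4 * th * m%:R].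
  move=> Ks sT y; have s0 : 0 < s by apply: lt_le_trans Ks; rewrite divr_gt0.
  have y0 : 0 <= y := sqrtr_ge0 s.
  have y2 : y ^+ 2 = s by rewrite sqr_sqrtr// ltW.
  have yd : 2 * d <= y.
    have -> : 2 * d = Num.sqrt ((2 * d) ^+ 2) by rewrite sqrtr_sqr ger0_norm// mulr_ge0// ltW.
    rewrite ler_wsqrtr// (le_trans _ Ks)// ler_pdivlMr//.
    have -> : (2 * d) ^+ 2 * m%:R = 4 * D ^+ 2.
      rewrite dE -[X in _ * X = _](sqr_sqrtr (ltW mR)); field; by rewrite gt_eqF.
    by rewrite /K0 ler_wpM2l// lerDr ltW.
  split=> //.
    apply: le_trans (_ : (y / 2) ^+ 2 * m%:R <= _).
      have -> : (y / 2) ^+ 2 * m%:R = s * m%:R / 4 by rewrite -y2; field.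
      rewrite ler_pdivlMr//; move: Ks; rewrite ler_pdivrMr//; apply: le_trans.
      by rewrite /K0 mulrC ler_wpM2l// lerDl sqr_ge0.
    rewrite ler_wpM2r ?(ltW mR)// lerXn2r ?nnegrE ?divr_ge0//; move: yd d0; lra.
  have -> : 4 * th * m%:R = (2 * Num.sqrt th * Num.sqrt m%:R) ^+ 2.
    have th'0 : 0 <= th by move: th'01 => /andP[/ltW].
    by rewrite !exprMn !sqr_sqrtr// ?ltW//; ring.
  have nd : 0 <= (2 * M.+1)%:R * d := mulr_ge0 (ler0n _ _) (ltW d0).
  have rh : 0 <= 2 * Num.sqrt th * Num.sqrt m%:R by rewrite !mulr_ge0 ?sqrtr_ge0 ?ler0n.
  rewrite lerXn2r ?nnegrE ?(addr_ge0 y0 nd)//.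
  have yT : y <= 2 * Num.sqrt theta * Num.sqrt m%:R.
    have -> : 2 * Num.sqrt theta * Num.sqrt m%:R = Num.sqrt (4 * theta * m%:R).
      rewrite !sqrtrM ?mulr_ge0 ?(ltW th0)//.
      by rewrite -[4](_ : 2 ^+ 2 = _ :> R) ?sqrtr_sqr ?ger0_norm// expr2 -natrM.
    by rewrite ler_wsqrtr.
  have dT : (2 * M.+1)%:R * d <= 2 * gap * Num.sqrt m%:R.
    rewrite dE natrM mulrA ler_pdivrMr// -mulrA [X in _ <= X](_ : _ = 2 * (gap * m%:R)).
      by rewrite ler_wpM2l.
    by rewrite -[in RHS](sqr_sqrtr (ltW mR)); ring.
  apply: le_trans (lerD yT dT) _; rewrite le_eqVlt; apply/orP; left; apply/eqP.
  by rewrite /gap; ring.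
have [Kt|tK] := leP (K0 / m%:R) t.
  have [b1 b2 b3] := bulk t Kt tT.
  have iM : (i <= 2 * M)%N.
    apply: leq_trans (ltnW ir) _; rewrite /M mul2n -addnn.
    exact: leq_trans (leqnSn r) (leq_addr _ _).
  have BE : B = (2 * M.+1 + 1)%:R ^+ 2 * (d * Num.sqrt m%:R) by rewrite dE divfK ?gt_eqF.
  have := ek_bulk alpha_gt iw m_gt0 (@node_pos m) (@node_lt m) (@cotes_pos m) (@cotes_exact m) (@node_root m)
    (laguerre_ode alpha_gt lag m) th'01 b1 b2 b3 (ltn0Sn r) iM BE.
  rewrite sqr_sqrtr ?(ltW t0)// => /le_trans; apply.
  rewrite ler_wpM2r ?wt_ge0// ler_wpM2r ?exprn_ge0 ?sqrtr_ge0//.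
  apply: le_trans (_ : Ka * (1 + B) ^+ r <= _); last by rewrite lerDl.
  by rewrite ler_wpM2l// pow_unif.
have GC : Wt t + gam m t <= C1 * t `^ (alpha + 1).
  rewrite /C1 mulrAC mulrDl mul1r mulrDl; apply: lerD; first by rewrite Wt_bound ?ltW.
  have [tx|xt] := ltP t (X m)`_0.
    have -> : gam m t = 0 by apply: gam_before => //; exact: node_lt.
    exact: divr_ge0 (mulr_ge0 (powR_ge0 _ _) (powR_ge0 _ _)) (ltW a1).
  (* Below [K0/m], once a node has been passed, [t >= (alpha + 1)/m]. The bulk conditions hold at
     [K0/m] and supply a node of size at most [4 K0/m], which is a constant times [t];
     Markov-Stieltjes then bounds [gam t] by the mass up to that node. *)
  have KT : K0 / m%:R <= 4 * theta * m%:R.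
    by apply: le_trans mB; rewrite ler_pdivrMr// ler_peMr ?(ltW K00).
  have [b1 b2 b3] := bulk _ (lexx _) KT.
  set y := Num.sqrt (K0 / m%:R) in b1 b2 b3.
  have y2 : y ^+ 2 = K0 / m%:R by rewrite sqr_sqrtr// divr_ge0 ?ltW.
  have [||k km] := node_in alpha_gt m_gt0 (@node_root m) (laguerre_ode alpha_gt lag m) th'01 b1 b2 b3 (u := y).
  - by rewrite lerBlDr lerDl ltW.
  - by rewrite lerD2l ler_peMl ?(ltW d0)// ler1n.
  rewrite -/d y2 => /andP[k1 k2].
  have tk : t < (X m)`_k by apply: lt_le_trans k1.
  (* The node found lies beyond [t], so it is not the first one and has the form [k.+1]. *)
  case: k km k1 k2 tk => [|k] km k1 k2 tk; first by move: xt; rewrite leNgt tk.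
  apply: le_trans (gam_le_Wt iw m_gt0 (@node_pos m) (@node_lt m) (@cotes_pos m) (@cotes_exact m) km tk) _.
  apply: le_trans (Wt_bound (ltW (node_pos km))) _.
  have cK : 0 <= 4 * K0 / (alpha + 1).
    exact: divr_ge0 (mulr_ge0 (ler0n _ _) (ltW K00)) (ltW a1).
  have h : (X m)`_k.+1 <= 4 * K0 / (alpha + 1) * t.
    apply: le_trans k2 _; apply: le_trans (_ : (2 * y) ^+ 2 <= _).
      have yd : y + d <= 2 * y by move: b2 d0; lra.
      have y0 : 0 <= y := sqrtr_ge0 _.
      have h1 := addr_ge0 y0 (ltW d0).
      by rewrite lerXn2r ?nnegrE// (le_trans h1).
    rewrite exprMn y2; have := le_trans (node0_ge m_gt0) xt; rewrite ler_pdivrMr// => at_.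
    have -> : 2 ^+ 2 * (K0 / m%:R) = 4 * K0 / m%:R by rewrite -[4](_ : 2 ^+ 2 = _ :> R) ?mulrA// expr2 -natrM.
    have -> : 4 * K0 / (alpha + 1) * t = 4 * K0 * (t / (alpha + 1)) by ring.
    rewrite ler_wpM2l//; first exact: mulr_ge0 (ler0n _ _) (ltW K00).
    by rewrite ler_pdivlMr// mulrC ler_pdivrMr.
  rewrite ler_wpM2r ?invr_ge0 ?(ltW a1)// -powRM ?(ltW t0)//.
  by apply: ge0_ler_powR; rewrite ?nnegrE ?(ltW a1) ?(ltW (node_pos km)) ?(mulr_ge0 cK (ltW t0)).
apply: le_trans (ek_small iw m_gt0 (@cotes_pos m) i t0 (ltW tK) GC) _.
rewrite ler_wpM2r ?wt_ge0// ler_wpM2r ?exprn_ge0 ?sqrtr_ge0//.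
apply: le_trans (_ : C1 * expR K0 * (1 + Num.sqrt K0) ^+ r <= _); last by rewrite lerDr.
rewrite divfK ?gt_eqF//; apply: ler_pM; [exact: mulr_ge0 C10 (expR_ge0 _)|by rewrite exprn_ge0 ?sqrtr_ge0| |].
  by rewrite ler_wpM2l// ler_expR ler_pdivrMr// ler_peMr ?(ltW K00).
by rewrite pow_unif ?sqrtr_ge0.
Qed.

Lemma kernel_bound r : exists C, 0 <= C /\
  forall m i t, (0 < m)%N -> (i < r)%N -> 0 < t <= 4 * theta * m%:R ->
  `|ek m i t| <= C * Num.sqrt (t / m%:R) ^+ i.+1 * wt t.
Proof.
have [m0 [C [C0 CP]]] := kernel_bound_large r.
suff [C' [C'0 C'P]] : exists C', 0 <= C' /\ forall m i t, (m < m0)%N -> (0 < m)%N -> (i < r)%N ->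
    0 < t <= 4 * theta * m%:R -> `|ek m i t| <= C' * Num.sqrt (t / m%:R) ^+ i.+1 * wt t.
  exists (C + C'); split=> [|m i t mp ir tT]; first exact: addr_ge0.
  have [mm|mm] := leqP m0 m.
    apply: le_trans (CP m i t mm ir tT) _.
    by rewrite ler_wpM2r ?wt_ge0// ler_wpM2r ?exprn_ge0 ?sqrtr_ge0// lerDl.
  apply: le_trans (C'P m i t mm mp ir tT) _.
  by rewrite ler_wpM2r ?wt_ge0// ler_wpM2r ?exprn_ge0 ?sqrtr_ge0// lerDr.
elim: m0 {CP} => [|n [C' [C'0 C'P]]]; first by exists 0; split.
have [n0|n0] := posnP n.
  by exists 0; split=> // m i t; rewrite n0 ltnS leqn0 => /eqP ->.
have [D [D0 DP]] := kernel_bound_fixed r n0.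
exists (C' + D); split=> [|m i t]; first exact: addr_ge0.
rewrite ltnS leq_eqVlt => /predU1P[->|mn] mp ir tT.
  apply: le_trans (DP i t ir tT) _.
  by rewrite ler_wpM2r ?wt_ge0// ler_wpM2r ?exprn_ge0 ?sqrtr_ge0// lerDr.
apply: le_trans (C'P m i t mn mp ir tT) _.
by rewrite ler_wpM2r ?wt_ge0// ler_wpM2r ?exprn_ge0 ?sqrtr_ge0// lerDl.
Qed.

End LaguerreKernels.

(** * Smooth transition functions and cutoffs *)

Section SmoothFunctions.
Variable R : realType.
Implicit Types (f g : R -> R) (n : nat) (x : R).

Fixpoint Sm n f : Prop :=
  if n is n'.+1 then exists f', (forall x, is_derive x 1 f (f' x)) /\ Sm n' f' else True.

Lemma SmS n f : Sm n.+1 f -> Sm n f.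
Proof.
elim: n f => // n IH f [f' [df sf]]; exists f'; split=> //; exact: IH.
Qed.

Lemma SmD n f g : Sm n f -> Sm n g -> Sm n (fun x => f x + g x).
Proof.
elim: n f g => // n IH f g [f' [df sf]] [g' [dg sg]].
exists (fun x => f' x + g' x); split; last exact: IH.
by move=> x; exact: deriveD_fun.
Qed.

Lemma SmM n f g : Sm n f -> Sm n g -> Sm n (fun x => f x * g x).
Proof.
elim: n f g => // n IH f g sf sg.
have sf' := SmS sf; have sg' := SmS sg.
case: sf sg => f' [df sf] [g' [dg sg]].
exists (fun x => f x * g' x + g x * f' x); split; first by move=> x; exact: deriveM_fun.
by apply: SmD; exact: IH.
Qed.

Lemma Sm_cst n (c : R) : Sm n (fun=> c).
Proof.
elim: n c => // n IH c; exists (fun=> 0); split=> // x; exact: is_derive_cst.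
Qed.

Lemma derive_affine (a b x : R) : is_derive x 1 (fun x => a * x + b) a.
Proof.
apply: derive_eqv (deriveD_fun (deriveM_fun (is_derive_cst a x 1) (is_derive_id x 1)) (is_derive_cst b x 1)) _.
by rewrite /cst; ring.
Qed.

Lemma Sm_affine n f (a b : R) : Sm n f -> Sm n (fun x => f (a * x + b)).
Proof.
elim: n f => // n IH f [f' [df sf]].
exists (fun x => f' (a * x + b) * a); split.
  by move=> x; exact: (@derive_comp_fun _ (fun x => a * x + b) f x _ _ (df _) (derive_affine a b x)).
by apply: SmM; [exact: IH|exact: Sm_cst].
Qed.

Lemma derive_fun f f' : (forall x, is_derive x 1 f (f' x)) -> derive1 f = f'.
Proof. by move=> df; apply/funext => x; rewrite derive1E; have [_ ->] := df x. Qed.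

Lemma Sm_derivable f : (forall n, Sm n f) -> forall n x, derivable (derive1n n f) x 1.
Proof.
move=> sf n; move: f sf; elim: n => [|n IH] f sf x.
  by have [f' [df _]] := sf 1%N; exact: ex_derive.
rewrite derive1Sn; apply: IH => k.
by have [f' [df sf']] := sf k.+1; rewrite (derive_fun df).
Qed.

(* [P(1/x) e^(-1/x)] extended by [0] to the left; flat at the origin *)
Definition flat (p : {poly R}) x : R := if x <= 0 then 0 else p.[x^-1] * expR (- x^-1).

Lemma flat_quadratic p : exists C, 0 <= C /\ forall x, `|x| <= 1 -> `|flat p x| <= C * x ^+ 2.
Proof.
have [C [N CN]] := poly_growth p.
have C0 : 0 <= C.
  by have := le_trans (normr_ge0 _) (CN 1 (lexx _)); rewrite expr1n mulr1.
exists (C * N.+2`!%:R); split=> [|x x1]; first by rewrite mulr_ge0.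
rewrite /flat; case: (leP x 0) => [x0|x0]; first by rewrite normr0; apply: mulr_ge0; [exact: mulr_ge0|exact: sqr_ge0].
have xi1 : 1 <= x^-1 by rewrite invf_ge1//; apply: le_trans x1; exact: ler_norm.
have xi0 : 0 < x^-1 by rewrite invr_gt0.
rewrite normrM (ger0_norm (expR_ge0 _)) expRN ler_pdivrMr ?expR_gt0//.
apply: le_trans (CN _ xi1) _; rewrite -!mulrA ler_wpM2l//.
have := expR_ge_pow N.+2 (ltW xi0); rewrite ler_pdivrMr ?ltr0n ?fact_gt0// => h.
have -> : x^-1 ^+ N = x ^+ 2 * x^-1 ^+ N.+2.
  by rewrite -(addn2 N) exprD mulrCA -exprMn divff ?gt_eqF// expr1n mulr1.
by have := ler_wpM2l (sqr_ge0 x) h; congr (_ <= _); ring.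
Qed.

Lemma derive_quadratic f (C x : R) : (forall h, `|h| <= 1 -> `|f (h + x) - f x| <= C * h ^+ 2) ->
  is_derive x 1 f 0.
Proof.
move=> fC; have C0 : 0 <= C.
  by have := fC 1; rewrite normr1 lexx expr1n mulr1 => /(_ isT); exact: le_trans (normr_ge0 _).
have c : h^-1 *: (f (h *: 1 + x) - f x) @[h --> 0^'] --> (0 : R).
  apply/cvgrPdist_le => e e0; near=> h.
  have h0 : h != 0 by near: h; exact: nbhs_dnbhs_neq.
  rewrite sub0r normrN /GRing.scale/= mulr1 normrM.
  have h1 : `|h| <= 1 by near: h; apply: dnbhs0_le.
  apply: le_trans (ler_wpM2l (normr_ge0 _) (fC h h1)) _.
  rewrite normfV -(real_normK (num_real h)) mulrCA expr2 mulKf ?normr_eq0//.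
  apply: le_trans (_ : (C + 1) * `|h| <= _); first by rewrite ler_wpM2r// lerDl.
  rewrite mulrC -ler_pdivlMr ?ltr_wpDl//.
  by near: h; apply: dnbhs0_le; rewrite divr_gt0// ltr_wpDl.
by split; [apply/cvg_ex; exists 0|exact/cvg_lim].
Unshelve. all: by end_near. Qed.

(** With [u = 1/x], the derivative of [p(u) e^(-u)] is [u^2 (p - p')(u) e^(-u)]: the family is
    closed under differentiation, so all orders of smoothness follow at once, including at 0. *)
Lemma derive_flat p x : is_derive x 1 (flat p) (flat ('X^2 * (p - p^`())) x).
Proof.
have [x0|x0|->] := ltgtP x 0; last first.
- have [C [C0 CP]] := flat_quadratic p.
  have -> : flat ('X^2 * (p - p^`())) 0 = 0 by rewrite /flat lexx.
  by apply: (@derive_quadratic _ C) => h h1; rewrite addr0 {2}/flat lexx subr0 CP.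
- have d : is_derive x 1 (fun x => p.[x^-1] * expR (- x^-1)) (flat ('X^2 * (p - p^`())) x).
    have xn : x != 0 by rewrite gt_eqF.
    have dV : is_derive x 1 (fun x : R => x^-1) (- x^-1 ^+ 2).
      apply: derive_eqv (is_deriveV xn (is_derive_id x 1)) _.
      by rewrite /GRing.scale/= mulr1 exprVn.
    have d1 := @derive_comp_fun _ (fun x => x^-1) (horner p) x _ _ (is_derive_poly p x^-1) dV.
    have dN := is_deriveN dV.
    have d2 := @derive_comp_fun _ (fun x => - x^-1) expR x _ _ (is_derive_expR _) dN.
    apply: derive_eqv (deriveM_fun d1 d2) _.
    rewrite /flat leNgt x0/= !(hornerM, hornerD, hornerN, hornerX) /GRing.scale/=; ring.
  apply: near_eq_is_derive d; near=> z; rewrite /flat leNgt ifF//.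
  by apply: negbTE; rewrite negbK; near: z; exact: lt_nbhsr.
- have -> : flat ('X^2 * (p - p^`())) x = 0 by rewrite /flat ltW.
  have d : is_derive x 1 (fun _ : R => 0 : R) 0 by exact: is_derive_cst.
  apply: near_eq_is_derive d; near=> z; rewrite /flat ifT//.
  by apply/ltW; near: z; exact: lt_nbhsl.
Unshelve. all: by end_near. Qed.

Lemma Sm_flat n p : Sm n (flat p).
Proof.
by elim: n p => // n IH p; exists (flat ('X^2 * (p - p^`()))); split=> // x; exact: derive_flat.
Qed.

Lemma Sm_inv n f : (forall x, f x != 0) -> Sm n f -> Sm n (fun x => (f x)^-1).
Proof.
move=> f0; elim: n f f0 => // n IH f f0 sf; have sf' := SmS sf.
case: sf => f' [df sf]; exists (fun x => f' x * (- 1 * ((f x)^-1 * (f x)^-1))); split.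
  move=> x; apply: derive_eqv (is_deriveV (f0 x) (df x)) _.
  by rewrite /GRing.scale/= expr2 invfM; ring.
by apply: SmM => //; apply: SmM; [exact: Sm_cst|apply: SmM; exact: IH].
Qed.

Lemma flat_ge0 p x : (forall y, 0 <= y -> 0 <= p.[y]) -> 0 <= flat p x.
Proof.
move=> p0; rewrite /flat; case: (leP x 0) => // x0.
by rewrite mulr_ge0 ?expR_ge0// p0// invr_ge0 ltW.
Qed.

Lemma flat_gt0 x : 0 < x -> 0 < flat 1 x.
Proof. by move=> x0; rewrite /flat leNgt x0/= hornerC mul1r expR_gt0. Qed.

Lemma flat_le0 p x : x <= 0 -> flat p x = 0.
Proof. by rewrite /flat => ->. Qed.

Definition step_den x : R := flat 1 x + flat 1 (- 1 * x + 1).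

Lemma step_den_gt0 x : 0 < step_den x.
Proof.
have h y : 0 <= flat 1 y by apply: flat_ge0 => z _; rewrite hornerC.
have [x0|x0] := ltP 0 x; first by rewrite ltr_pwDl// flat_gt0.
by rewrite ltr_pwDr// flat_gt0//; move: x0; lra.
Qed.

Definition step x : R := flat 1 x * (step_den x)^-1.

Definition dstep x : R := (flat 'X^2 x * flat 1 (- 1 * x + 1) + flat 1 x * flat 'X^2 (- 1 * x + 1)) *
  ((step_den x)^-1 * (step_den x)^-1).

Lemma derive_step (x : R) : is_derive x 1 step (dstep x).
Proof.
have d1 (y : R) : is_derive y 1 (flat 1) (flat 'X^2 y).
  apply: derive_eqv (derive_flat 1 y) _.
  by rewrite -polyC1 derivC subr0 mulr1.
have d2 := @derive_comp_fun _ (fun x => - 1 * x + 1) (flat 1) x _ _ (d1 _) (derive_affine (-1) 1 x).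
have d3 := deriveD_fun (d1 x) d2.
have n0 : step_den x != 0 by rewrite gt_eqF// step_den_gt0.
apply: derive_eqv (deriveM_fun (d1 x) (is_deriveV n0 d3)) _.
rewrite /dstep /GRing.scale/= expr2 invfM -/(step_den x).
set i := (step_den x)^-1; have iE : i = step_den x * (i * i) by rewrite mulrA mulfV// mul1r.
rewrite [X in _ + X * _]iE /step_den; ring.
Qed.

Lemma Sm_step_den n : Sm n step_den.
Proof. by apply: SmD; [exact: Sm_flat|apply: Sm_affine; exact: Sm_flat]. Qed.

Lemma Sm_step_deni n : Sm n (fun x => (step_den x)^-1).
Proof. by apply: Sm_inv; [move=> x; rewrite gt_eqF// step_den_gt0|exact: Sm_step_den]. Qed.

Lemma Sm_step n : Sm n step.
Proof. by apply: SmM; [exact: Sm_flat|exact: Sm_step_deni]. Qed.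

Lemma Sm_dstep n : Sm n dstep.
Proof.
apply: SmM; last by apply: SmM; exact: Sm_step_deni.
by apply: SmD; apply: SmM; try exact: Sm_flat; apply: Sm_affine; exact: Sm_flat.
Qed.

Lemma cont_dstep x : {for x, continuous dstep}.
Proof. by have [b' [db _]] := Sm_dstep 1; exact: derive_cont (db x). Qed.

Lemma step_le0 x : x <= 0 -> step x = 0.
Proof. by move=> x0; rewrite /step flat_le0// mul0r. Qed.

Lemma step_ge1 x : 1 <= x -> step x = 1.
Proof.
move=> x1; have h : -1 * x + 1 <= 0 by move: x1; lra.
have := step_den_gt0 x; rewrite /step /step_den (flat_le0 _ h) addr0 => /gt_eqF/negbT x0.
by rewrite mulfV.
Qed.

Lemma step_bound x : 0 <= step x <= 1.
Proof.
have h y : 0 <= flat 1 y by apply: flat_ge0 => z _; rewrite hornerC.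
rewrite /step ler_pdivrMr ?step_den_gt0// mul1r lerDl h andbT.
by rewrite mulr_ge0// invr_ge0 ltW ?step_den_gt0.
Qed.

Lemma dstep_le0 x : x <= 0 -> dstep x = 0.
Proof. by move=> x0; rewrite /dstep !(flat_le0 _ x0) !mul0r addr0 mul0r. Qed.

Lemma dstep_ge1 x : 1 <= x -> dstep x = 0.
Proof.
move=> x1; have h : -1 * x + 1 <= 0 by move: x1; lra.
by rewrite /dstep !(flat_le0 _ h) !mulr0 addr0 mul0r.
Qed.

Lemma dstep_bounded : exists2 K, 0 <= K & forall x, `|dstep x| <= K.
Proof.
have [K KP] : exists K, forall x, 0 <= x <= 1 -> `|dstep x| <= K.
  have [|c _ cP] := @EVT_max R (fun x => `|dstep x|) 0 1 ler01.
    apply: continuous_in_subspaceT => x _.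
    exact: (continuous_comp (@cont_dstep x) (@norm_continuous _ _ _)).
  by exists `|dstep c| => x x01; apply: cP; rewrite in_itv.
have K0 : 0 <= K by apply: le_trans (KP 0 _); rewrite ?lexx ?ler01.
exists K => // x; have [x0|x0] := leP x 0; first by rewrite dstep_le0// normr0.
have [x1|x1] := leP 1 x; first by rewrite dstep_ge1// normr0.
by apply: KP; rewrite !ltW.
Qed.

Section Cutoff.
Variables (d : R) (d0 : 0 < d).

Definition scaled x t : R := d^-1 * t + - (d^-1 * x).

Lemma scaledE x t : scaled x t = d^-1 * (t - x).
Proof. by rewrite mulrBr. Qed.

Lemma scaled_le0 x t : t <= x -> scaled x t <= 0.
Proof. by move=> tx; rewrite scaledE mulr_ge0_le0 ?invr_ge0 ?subr_le0// ltW. Qed.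

Lemma scaled_ge1 x t : x + d <= t -> 1 <= scaled x t.
Proof. by move=> tx; rewrite scaledE mulrC ler_pdivlMr// mul1r lerBrDl. Qed.

(** Rises from 0 to 1 on [[x, x + d]] and falls back on [[y, y + d]]. It is written with [+ - 1 *]
    so that the closure rules for [Sm] apply. *)
Definition cutoff x y t : R := step (scaled x t) + - 1 * step (scaled y t).

Definition dcutoff x y t : R := d^-1 * dstep (scaled x t) + - 1 * (d^-1 * dstep (scaled y t)).

Lemma derive_scaled_step (x t : R) : is_derive t 1 (fun t => step (scaled x t)) (d^-1 * dstep (scaled x t)).
Proof.
rewrite mulrC.
exact: (@derive_comp_fun _ (scaled x) step t _ _ (derive_step _) (derive_affine _ _ _)).
Qed.

Lemma derive_cutoff (x y t : R) : is_derive t 1 (cutoff x y) (dcutoff x y t).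
Proof.
apply: derive_eqv (deriveD_fun (derive_scaled_step x t)
  (deriveM_fun (is_derive_cst (-1 : R) t 1) (derive_scaled_step y t))) _.
by rewrite /dcutoff /cst /=; ring.
Qed.

Lemma Sm_cutoff x y n : Sm n (cutoff x y).
Proof.
have h z : Sm n (fun t => step (scaled z t)) by exact/Sm_affine/Sm_step.
by apply: SmD => //; apply: SmM => //; exact: Sm_cst.
Qed.

Lemma cutoff_test x y : x <= y -> test_fun (cutoff x y).
Proof.
move=> xy; split; first by apply: Sm_derivable => n; exact: Sm_cutoff.
exists (`|x| + `|y| + d) => t tM; rewrite /cutoff.
have [x1 y1 t1] : [/\ - `|x| <= x, y <= `|y| & `|x| + `|y| + d < t \/ t < - (`|x| + `|y| + d)].
  split; [by have := ler_norm (- x); rewrite normrN; lra|exact: ler_norm|].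
  by move: tM; have [_|_] := ger0P t => ?; [left|right; rewrite ltrNr].
case: t1 => h.
  rewrite !step_ge1 ?scaled_ge1//; first lra.
  - by have := normr_ge0 x; move: h y1; lra.
  - by have := normr_ge0 x; move: h y1 xy; lra.
rewrite !step_le0 ?scaled_le0//; first lra.
- by have := normr_ge0 y; move: h x1 xy d0; lra.
- by have := normr_ge0 y; move: h x1 d0; lra.
Qed.

(** The derivative must be a test function too: two weak derivatives of consecutive orders are
    related only through [f], by testing one with a cutoff and the other with its derivative. *)
Lemma dcutoff_test x y : x <= y -> test_fun (dcutoff x y).
Proof.
move=> /cutoff_test[h [M MP]]; have E := derive_fun (derive_cutoff x y); split.
  by move=> n t; rewrite -E -derive1Sn; exact: h.
exists M => t tM; have [_ <-] := derive_cutoff x y t; apply/derive_val.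
have dc : is_derive t 1 (fun=> 0 : R) 0 by exact: is_derive_cst.
apply: near_eq_is_derive dc; near=> z; apply/esym/MP; near: z.
exact: (cvgr_gt `|t| (@norm_continuous _ R t) _ tM).
Unshelve. all: by end_near. Qed.

End Cutoff.

End SmoothFunctions.

(** * Increments of weakly differentiable functions at Lebesgue points *)

Section WeakIncrements.
Variable R : realType.
Notation mu := (@lebesgue_measure R).
Implicit Types (g h : R -> R) (x y : R).

Definition loc_itg g := forall a b : R, itg `]a, b] g.

(** A Lebesgue point from the right only, since both transitions of a cutoff lie to the right of its
    parameters. *)
Definition Lpt g x : Prop := forall e, 0 < e ->
  \forall d \near 0^'+, Int x (x + d) (fun t => `|g t - g x|) <= e * d.

Lemma Rint_supp F (a b : R) : (forall t, ~~ (a < t <= b) -> F t = 0) -> \int[mu]_t F t = Int a b F.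
Proof.
move=> F0; rewrite IntE; apply: eq_RintR => t _; rewrite patchE; case: ifPn => //.
by rewrite notin_setE/= in_itv/= => /negP; exact: F0.
Qed.

Lemma loc_itg_norm g : loc_itg g -> loc_itg (fun t => `|g t|).
Proof. by move=> ig a b; exact: itg_norm. Qed.

Lemma loc_itgBc g c : loc_itg g -> loc_itg (fun t => g t - c).
Proof. by move=> ig a b; apply: itgB => //; exact: itg_cst. Qed.

Lemma Int_small h x : loc_itg h -> forall e, 0 < e ->
  \forall d \near 0^'+, Int x (x + d) (fun t => `|h t|) <= e.
Proof.
move=> ih e e0; have := @continuous_Int _ x (x + 1) _ (loc_itg_norm ih x (x + 1)).
have x1 : x < x + 1 by rewrite ltrDl.
move=> /(continuous_within_itvP _ x1)[_ + _]; rewrite Int_ge// => /cvgrPdist_le/(_ _ e0) c.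
move: c; rewrite nbhs_right0P; apply: filterS => d; rewrite sub0r normrN.
by apply: le_trans; exact: ler_norm.
Qed.

Lemma loc_itg_meas g : loc_itg g -> measurable_fun setT g.
Proof.
move=> ig.
have -> : setT = \bigcup_n (`]- n%:R, (n%:R:R)]%classic : set (measurableTypeR R)).
  apply/esym/seteqP; split=> // t _.
  exists (Num.truncn `|t|).+1 => //=; rewrite in_itv/=.
  by have := truncnS_gt `|t|; rewrite ltr_norml => /andP[-> /ltW ->].
apply/measurable_fun_bigcup => // n; exact: itg_meas.
Qed.

Lemma Lpt_lebesgue g x : loc_itg g -> lebesgue_pt g x -> Lpt g x.
Proof.
move=> ig lg e e0.
have [fin] := (fine_cvgP _ _).1 lg; move=> /cvgrPdist_le /(_ (e / 2)) c.
have {}c := c (divr_gt0 e0 (ltr0n _ 2)).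
near=> d.
have d0 : 0 < d by near: d; exact: nbhs_right_gt.
have fd : davg g x d \is a fin_num by near: d.
have cd : `|0 - (fine \o davg g x) d| <= e / 2 by near: d.
have mg D : measurable D -> measurable_fun D (fun t => `|(g t - g x)%:E|%E).
  move=> mD; apply/measurableT_comp => //; apply/measurable_EFinP/measurable_funB => //.
  exact: (measurable_funS measurableT _ (loc_itg_meas ig)).
have ib : itg `]x, x + d] (fun t => `|g t - g x|) by apply: itg_norm => //; exact: loc_itgBc.
have : ((Int x (x + d) (fun t => `|g t - g x|))%:E <= (e * d)%:E)%E.
  rewrite /Int fineK; last exact: integrable_fin_num.
  rewrite -integral_itv_bndo_bndc; last by apply: mg.
  apply: (@le_trans _ _ (\int[mu]_(y in ball x d) `|(g y - g x)%:E|)%E).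
    apply: ge0_subset_integral => //.
    + exact: measurable_ball.
    + by apply: mg; exact: measurable_ball.
    + move=> t/=; rewrite in_itv/= => /andP[xt td].
      by rewrite /ball/= ltr_distlC td andbT ltrBlDr; move: xt d0; lra.
  have : (davg g x d <= (e / 2)%:E)%E.
    rewrite -(fineK fd) lee_fin; apply: le_trans cd; rewrite sub0r normrN; exact: ler_norm.
  rewrite /davg /iavg lebesgue_measure_ball ?(ltW d0)// inver gt_eqF ?mulrn_wgt0// lee_pdivrMl ?mulrn_wgt0//.
  by rewrite -EFinM (_ : d *+ 2 * (e / 2) = e * d)//; field.
by rewrite lee_fin.
Unshelve. all: by end_near. Qed.

Section Cut.
Variables (d : R) (d0 : 0 < d).

Lemma meas_derive (f : R -> R) : (forall n, Sm n f) -> measurable_fun setT f.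
Proof.
move=> /(_ 1%N)[f' [df _]]; apply: continuous_measurable_fun => x; exact: derive_cont (df x).
Qed.

Lemma Sm_scaled f x n : Sm n f -> Sm n (fun t => f (scaled d x t)).
Proof. exact: Sm_affine. Qed.

Lemma meas_scaled_dstep x D : measurable_fun D (fun t => d^-1 * dstep (scaled d x t)).
Proof.
apply: (measurable_funS measurableT) => //; apply: meas_derive => n.
by apply: SmM; [exact: Sm_cst|apply: Sm_scaled; exact: Sm_dstep].
Qed.

(** The scaled derivative of [step] has integral 1 over [(x, x + d]] and is bounded by [K / d]. *)
Lemma Int_dcut g x K : loc_itg g -> (forall t, `|dstep t| <= K) ->
  `|Int x (x + d) (fun t => g t * (d^-1 * dstep (scaled d x t))) - g x| <=
  d^-1 * K * Int x (x + d) (fun t => `|g t - g x|).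
Proof.
move=> ig KP; pose u t := d^-1 * dstep (scaled d x t).
have mu_ D : measurable_fun D u by exact: meas_scaled_dstep.
have K0 : 0 <= K by apply: le_trans (KP 0).
have uK t : `|u t| <= d^-1 * K.
  by rewrite normrM ger0_norm ?invr_ge0 ?(ltW d0)// ler_wpM2l ?invr_ge0 ?(ltW d0).
have xd : x <= x + d by rewrite lerDl ltW.
have Iu : Int x (x + d) u = 1.
  rewrite (Int_FTC xd (fun t _ => derive_scaled_step d x t)).
    by rewrite step_ge1 ?scaled_ge1// step_le0 ?subr0// scaled_le0.
  move=> t _; have [u' [du _]] : Sm 1 u.
    by apply: SmM; [exact: Sm_cst|apply: Sm_scaled; exact: Sm_dstep].
  exact: derive_cont (du t).
have iu : itg `]x, x + d] u by apply: itg_bounded (mu_ _) (fun t _ => uK t).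
have igx := loc_itgBc (g x) ig.
have iug : itg `]x, x + d] (fun t => u t * (g t - g x)).
  by apply: (itgM _ (mu_ _) (fun t _ => uK t)).
have -> : Int x (x + d) (fun t => g t * u t) - g x = Int x (x + d) (fun t => u t * (g t - g x)).
  rewrite -[X in _ - X]mulr1 -Iu -IntZ// -IntB//; last exact: itgZ.
    by apply: eq_Int => t _; ring.
  apply: (@eq_itg _ _ (fun t => u t * g t) _ _ _ (itgM _ (mu_ _) (fun t _ => uK t) (ig x (x + d)))) => //.
  by move=> t _; rewrite mulrC.
rewrite -IntZ; last exact: loc_itg_norm.
apply: Int_norm_le => //; first by apply: itgZ => //; exact: loc_itg_norm.
by move=> t _; rewrite normrM ler_wpM2r.
Qed.

(** The cutoff differs from the indicator of [(x, y]] only on the two transition intervals. *)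
Lemma Int_cut h x y : loc_itg h -> x <= y ->
  `|Int x (y + d) (fun t => h t * cutoff d x y t) - Int x y h| <=
  Int x (x + d) (fun t => `|h t|) + 2 * Int y (y + d) (fun t => `|h t|).
Proof.
move=> ih xy.
have ms z D : measurable_fun D (fun t => step (scaled d z t)).
  apply: (measurable_funS measurableT) => //; apply: meas_derive => n.
  by apply: Sm_scaled; exact: Sm_step.
have s1 z t : `|step (scaled d z t)| <= 1.
  by have /andP[a b] := step_bound (scaled d z t); rewrite ger0_norm.
have s2 z t : `|1 - step (scaled d z t)| <= 1.
  by have /andP[a b] := step_bound (scaled d z t); rewrite ger0_norm; lra.
have yd : y <= y + d by rewrite lerDl ltW.
have xd : x <= x + d by rewrite lerDl ltW.
have is1 z a b : itg `]a, b] (fun t => step (scaled d z t) * h t).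
  exact: (itgM _ (ms z _) (fun t _ => s1 z t)).
have is2 z a b : itg `]a, b] (fun t => (1 - step (scaled d z t)) * h t).
  by apply: (@eq_itg _ _ (fun t => h t - step (scaled d z t) * h t)); [|move=> t _; ring|exact: itgB].
have -> : Int x (y + d) (fun t => h t * cutoff d x y t) =
   Int x (y + d) h - Int x (y + d) (fun t => (1 - step (scaled d x t)) * h t)
    - Int x (y + d) (fun t => step (scaled d y t) * h t).
  rewrite -!IntB//; last exact: itgB.
  by apply: eq_Int => t _; rewrite /cutoff; ring.
rewrite (Int_split xy yd (ih _ _)).
have -> : Int x (y + d) (fun t => (1 - step (scaled d x t)) * h t) =
          Int x (x + d) (fun t => (1 - step (scaled d x t)) * h t).
  rewrite (@Int_split _ x (y + d) (x + d))//; last by rewrite lerD2r.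
  rewrite [X in _ + X](_ : _ = 0) ?addr0// -(@Int_cst0 _ (x + d) (y + d)).
  by apply: eq_Int => t /andP[/ltW xt _]; rewrite step_ge1 ?subrr ?mul0r// scaled_ge1.
have -> : Int x (y + d) (fun t => step (scaled d y t) * h t) =
          Int y (y + d) (fun t => step (scaled d y t) * h t).
  rewrite (@Int_split _ x (y + d) y)//.
  rewrite [X in X + _](_ : _ = 0) ?add0r// -(@Int_cst0 _ x y).
  by apply: eq_Int => t /andP[_ ty]; rewrite step_le0 ?mul0r// scaled_le0.
have h1 : `|Int x (x + d) (fun t => (1 - step (scaled d x t)) * h t)| <= Int x (x + d) (fun t => `|h t|).
  apply: Int_norm_le => //; first exact: loc_itg_norm.
  by move=> t _; rewrite normrM ler_piMl.
have h2 : `|Int y (y + d) (fun t => step (scaled d y t) * h t)| <= Int y (y + d) (fun t => `|h t|).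
  apply: Int_norm_le => //; first exact: loc_itg_norm.
  by move=> t _; rewrite normrM ler_piMl.
have h3 : `|Int y (y + d) h| <= Int y (y + d) (fun t => `|h t|) by exact: Int_norm.
move: h1 h2 h3; rewrite !ler_norml => /andP[? ?] /andP[? ?] /andP[? ?]; apply/andP; split; lra.
Qed.

End Cut.

Lemma approx_increment (a b c p q i s u : R) : `|a - p| <= s -> `|b - q| <= s -> `|c - i| <= u ->
  a - b = - c -> `|q - p - i| <= 2 * s + u.
Proof.
rewrite !ler_norml => /andP[? ?] /andP[? ?] /andP[? ?] ?; apply/andP; split; lra.
Qed.

Lemma sum_le4 (a b c : R) : 0 < c -> a <= c -> b <= c -> a + 2 * b <= 4 * c.
Proof. lra. Qed.

(** As the transition width [d] shrinks, testing against the derivative of the cutoff tends to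
    [g x - g y] at Lebesgue points, and testing against the cutoff tends to the integral of [h]. *)
Lemma weak_increment g h x y : loc_itg g -> loc_itg h -> x <= y -> Lpt g x -> Lpt g y ->
  (forall d, 0 < d -> \int[mu]_t (g t * dcutoff d x y t) = - \int[mu]_t (h t * cutoff d x y t)) ->
  g y - g x = Int x y h.
Proof.
move=> ig ih xy lx ly parts; apply/eqP; rewrite -subr_eq0 -normr_le0; apply/ler_addgt0Pr => e e0.
have [K K0 KP] := @dstep_bounded R; rewrite add0r.
(* Each of the two transitions of [g] costs [K e1] and the cutoff error of [h] costs [4 e1], which
   add up to [e]. *)
pose e1 := e / (2 * K + 4).
have e10 : 0 < e1 by rewrite divr_gt0//; move: K0; lra.
have eE : e = 2 * (K * e1) + 4 * e1.
  rewrite mulrA -mulrDl mulrC /e1 divfK// gt_eqF//; move: K0; lra.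
near ((0:R)^'+) => d.
have d0 : 0 < d by near: d; exact: nbhs_right_gt.
have h1 : Int x (x + d) (fun t => `|g t - g x|) <= e1 * d by near: d; exact: lx.
have h2 : Int y (y + d) (fun t => `|g t - g y|) <= e1 * d by near: d; exact: ly.
have h3 : Int x (x + d) (fun t => `|h t|) <= e1 by near: d; exact: Int_small.
have h4 : Int y (y + d) (fun t => `|h t|) <= e1 by near: d; exact: Int_small.
have xd : x <= x + d by rewrite lerDl ltW.
have yd : y <= y + d by rewrite lerDl ltW.
have P1 := Int_dcut d0 x ig KP.
have P2 := Int_dcut d0 y ig KP.
have P3 := Int_cut d0 ih xy.
have := parts d d0.
have out z t : ~~ (z < t <= z + d) -> dstep (scaled d z t) = 0.
  rewrite negb_and -!leNgt -ltNge => /orP[?|/ltW ?]; first by rewrite dstep_le0 ?scaled_le0.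
  by rewrite dstep_ge1 ?scaled_ge1.
have iu z a b : itg `]a, b] (fun t => g t * (d^-1 * dstep (scaled d z t))).
  have ud t : `|d^-1 * dstep (scaled d z t)| <= d^-1 * K.
    by rewrite normrM ger0_norm ?invr_ge0 ?(ltW d0)// ler_wpM2l ?invr_ge0 ?(ltW d0).
  apply: (@eq_itg _ _ (fun t => d^-1 * dstep (scaled d z t) * g t)) => // [t _|]; first by rewrite mulrC.
  by apply: (itgM _ _ (fun t _ => ud t)) => //; exact: meas_scaled_dstep.
have Iz z a b : a <= z -> z + d <= b -> Int a b (fun t => g t * (d^-1 * dstep (scaled d z t))) =
     Int z (z + d) (fun t => g t * (d^-1 * dstep (scaled d z t))).
  move=> az zb; rewrite -!Rint_supp// => t; first by move=> /out ->; rewrite !mulr0.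
  move=> ht; rewrite out ?mulr0 ?mulr0//; apply: contra ht => /andP[zt td].
  by rewrite (le_lt_trans az zt) (le_trans td zb).
rewrite (@Rint_supp _ x (y + d)); last first.
  move=> t ht; rewrite /dcutoff !out ?mulr0 ?addr0 ?mulr0//; apply: contra ht => /andP[a b].
    by rewrite (le_lt_trans xy a).
  by rewrite a (le_trans b)// lerD2r.
rewrite (@Rint_supp (fun t => h t * cutoff d x y t) x (y + d)); last first.
  move=> t; rewrite negb_and -!leNgt -ltNge /cutoff => /orP[a|/ltW a].
    by rewrite !step_le0 ?scaled_le0// ?(le_trans a)// mulr0 addr0 mulr0.
  by rewrite !step_ge1 ?scaled_ge1 ?(le_trans _ a) ?lerD2r// mulr1 subrr mulr0.
have -> : Int x (y + d) (fun t => g t * dcutoff d x y t) =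
   Int x (x + d) (fun t => g t * (d^-1 * dstep (scaled d x t))) -
   Int y (y + d) (fun t => g t * (d^-1 * dstep (scaled d y t))).
  rewrite -(Iz x x (y + d)) ?lexx ?lerD2r// -(Iz y x (y + d)) ?lexx// -IntB//.
  by apply: eq_Int => t _; rewrite /dcutoff; ring.
move=> E.
have q1 : d^-1 * K * Int x (x + d) (fun t => `|g t - g x|) <= K * e1.
  by rewrite -mulrA ler_pdivrMl// mulrCA ler_wpM2l// mulrC.
have q2 : d^-1 * K * Int y (y + d) (fun t => `|g t - g y|) <= K * e1.
  by rewrite -mulrA ler_pdivrMl// mulrCA ler_wpM2l// mulrC.
have {}P1 := le_trans P1 q1; have {}P2 := le_trans P2 q2.
rewrite eE; apply: le_trans (approx_increment P1 P2 P3 E) _.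
by rewrite lerD2l; exact: sum_le4.
Unshelve. all: by end_near. Qed.

End WeakIncrements.

(** * Representatives with absolutely continuous lower derivatives *)

Section SobolevRepresentatives.
Variable R : realType.
Notation mu := (@lebesgue_measure R).
Implicit Types (f g h : R -> R) (x y : R).

Lemma cutoff_eq1 x y t : x + 1 <= t <= y -> cutoff 1 x y t = 1.
Proof.
by move=> /andP[xt ty]; rewrite /cutoff step_ge1 ?scaled_ge1// step_le0 ?scaled_le0// mulr0 addr0.
Qed.

Lemma continuous_loc_itg f : continuous f -> loc_itg f.
Proof. by move=> cf a b; apply: continuous_itg => x _; exact: cf. Qed.

Lemma continuous_Lpt f x : continuous f -> Lpt f x.
Proof.
move=> cf; apply: Lpt_lebesgue; first exact: continuous_loc_itg.
by apply: (@continuous_lebesgue_pt _ _ _ setT) => //;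
  [exact: open_nbhsT|exact: continuous_measurable_fun|exact: cf].
Qed.

(** The weighted norm does not give this, as the weight may vanish at 0. It comes from the
    integrability of [g] times a test function, for a cutoff equal to 1 on []a, b]]. *)
Lemma weak_deriv_loc_itg k f g : weak_deriv k f g -> loc_itg g.
Proof.
move=> wg a b; have [ba|ab] := leP b a.
  by rewrite /itg set_itv_ge ?bnd_simp -?leNgt//; exact: integrable_set0.
have [|_ [ig _]] := wg (cutoff 1 (a - 1) b); first by apply: cutoff_test; move: ab; lra.
have {}ig : itg `]a, b] (fun x => g x * cutoff 1 (a - 1) b x) by apply: integrableS ig.
apply: eq_itg ig => // t/=; rewrite in_itv/= => /andP[at_ tb].
by rewrite cutoff_eq1 ?mulr1// subrK ltW.
Qed.

Lemma Lpt_ae g : loc_itg g -> {ae mu, forall x, Lpt g x}.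
Proof.
move=> ig; have := @lebesgue_differentiation R g.
case.
  split; [exact: loc_itg_meas|exact: openT|].
  move=> K _ cK; have [M [_ MK]] := compact_bounded cK.
  have iK : itg K g.
    apply: itgS (ig (- (M + 2)) (M + 2)) => //; first exact: compact_measurable.
    move=> t Kt /=; have := MK (M + 1); rewrite ltrDl ltr01 => /(_ isT t Kt) /=.
    by rewrite in_itv/= ler_norml => /andP[? ?]; apply/andP; split; lra.
  apply: integrable_lty; [exact: compact_measurable|exact: integrable_abse iK].
move=> N [mN N0 sN]; exists N; split=> // x /= nx; apply: sN => /= lx; apply: nx.
exact: Lpt_lebesgue.
Qed.

Lemma Lpt_ex g : loc_itg g -> exists x, Lpt g x.
Proof.
move=> /Lpt_ae[N [mN N0 sN]]; apply: contrapT => nL.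
have : (mu `]0%R, 1%R] <= mu N)%E.
  by apply: le_measure; rewrite ?inE// => x _; apply: sN => /= lx; apply: nL; exists x.
by rewrite mu_oc// N0 lee_fin subr0 ler10.
Qed.

Lemma Rint_weak k f g phi : test_fun phi -> weak_deriv k f g ->
  \int[mu]_x (f x * derive1n k phi x) = (-1) ^+ k * \int[mu]_x (g x * phi x).
Proof.
move=> tphi /(_ _ tphi)[i1 [i2 /(congr1 fine)]].
by rewrite fineM// integrable_fin_num.
Qed.

(** The integral of [f] against the derivative of order [k + 1] of the cutoff is computed twice: by
    [h] with the cutoff, and by [g] with the derivative of the cutoff. For [k = 0] the second is
    immediate. *)
Lemma weak_parts k f g h d x y : 0 < d -> x <= y -> (k = 0%N -> g = f) ->
  ((0 < k)%N -> weak_deriv k f g) -> weak_deriv k.+1 f h ->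
  \int[mu]_t (g t * dcutoff d x y t) = - \int[mu]_t (h t * cutoff d x y t).
Proof.
move=> d0 xy g0 wg wh.
have := Rint_weak (cutoff_test d0 xy) wh.
rewrite derive1Sn (derive_fun (derive_cutoff d x y)).
case: k => [|k] in g0 wg wh *; first by rewrite g0// expr1 mulN1r.
rewrite (Rint_weak (dcutoff_test d0 xy) (wg isT)) [in RHS]exprS mulN1r mulNr -mulrN.
by move/mulfI; apply; rewrite signr_eq0.
Qed.

Lemma Rint_ae (D : set (measurableTypeR R)) f g : measurable D -> itg D f -> itg D g ->
  {ae mu, forall x, f x = g x} -> \int[mu]_(x in D) f x = \int[mu]_(x in D) g x.
Proof.
move=> mD fi gi [N [mN N0 sN]]; rewrite /Rintegral; congr fine.
apply: ae_eq_integral => //; [exact: measurable_int fi|exact: measurable_int gi|].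
by exists N; split=> // x /= nx; apply: sN => /= E; apply: nx => _; rewrite E.
Qed.

Lemma meas_wr alpha r (D : set (measurableTypeR R)) : measurable_fun D (wr alpha r).
Proof.
apply: (measurable_funS measurableT) => //; apply: measurable_funM.
  by apply: (measurableT_comp (measurable_powR _)).
by apply: measurableT_comp => //; apply: measurableT_comp.
Qed.

Lemma wnorm_ae alpha r f g : measurable_fun setT f -> measurable_fun setT g ->
  {ae mu, forall x, f x = g x} -> wnorm alpha r f = wnorm alpha r g.
Proof.
move=> mf mg [N [mN N0 sN]]; apply: ae_eq_integral => //.
- by apply/measurable_EFinP; apply: measurableT_comp => //; apply: measurable_funM => //; exact: meas_wr.
- by apply/measurable_EFinP; apply: measurableT_comp => //; apply: measurable_funM => //; exact: meas_wr.
by exists N; split=> // x /= nx; apply: sN => /= E; apply: nx => _; rewrite E.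
Qed.

(** The signed integral, since [Int] vanishes for reversed bounds. *)
Definition SInt a b h := Int a b h - Int b a h.

Lemma SInt_add h a x y : loc_itg h -> x <= y -> SInt a y h - SInt a x h = Int x y h.
Proof.
move=> ih xy; rewrite /SInt.
have [ax|xa] := leP a x.
  rewrite (@Int_ge _ y a) ?(@Int_ge _ x a) ?(le_trans ax)// (Int_split ax xy (ih _ _)); ring.
have [ay|ya] := leP a y.
  rewrite (@Int_ge _ y a)// (@Int_ge _ a x) ?ltW// (Int_split (ltW xa) ay (ih _ _)); ring.
rewrite (@Int_ge _ a y) ?ltW// (@Int_ge _ a x) ?ltW// (Int_split xy (ltW ya) (ih _ _)); ring.
Qed.

End SobolevRepresentatives.

Section Representatives.
Variables (R : realType) (alpha : R) (r : nat) (f : R -> R).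
Hypothesis fW : W_ball alpha r f.
Notation mu := (@lebesgue_measure R).

(** The weak derivatives are changed on null sets only, so the norms survive; [f] itself is
    unchanged because every point is a Lebesgue point of a continuous function. *)
Lemma W_ball_repr : exists G : nat -> R -> R, [/\ G 0%N = f,
  forall k, (k <= r)%N -> loc_itg (G k),
  forall k x y, (k < r)%N -> x <= y -> G k y - G k x = Int x y (G k.+1) &
  forall k, (k <= r)%N -> (wnorm alpha r (G k) <= 1)%E].
Proof.
case: fW => cf [g [g0 [gL [gD gN]]]].
have ig k : (k <= r)%N -> loc_itg (g k).
  case: k => [|k] kr; first by rewrite g0; exact: continuous_loc_itg.
  by apply: weak_deriv_loc_itg (gD k.+1 _); rewrite kr.
have parts k : (k < r)%N -> forall x y d, x <= y -> 0 < d ->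
   \int[mu]_t (g k t * dcutoff d x y t) = - \int[mu]_t (g k.+1 t * cutoff d x y t).
  move=> kr x y d xy d0; apply: (weak_parts d0 xy _ _ (gD k.+1 _)); rewrite ?kr//.
    by move=> ->.
  by move=> k0; apply: gD; rewrite k0 ltnW.
have inc k : (k < r)%N -> forall x y, x <= y -> Lpt (g k) x -> Lpt (g k) y ->
    g k y - g k x = Int x y (g k.+1).
  move=> kr x y xy lx ly; apply: weak_increment => //; try by apply: ig => //; exact: ltnW.
  by move=> d d0; exact: parts.
have base k : exists a, (k <= r)%N -> Lpt (g k) a.
  have [kr|kr] := leqP k r; last by exists 0.
  by have [x lx] := Lpt_ex (ig k kr); exists x.
pose a k := projT1 (cid (base k)).
have aP k : (k <= r)%N -> Lpt (g k) (a k) by rewrite /a; case: cid.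
(* Integrating from a Lebesgue point [a k] makes [G k] agree with [g k] at every Lebesgue point,
   hence almost everywhere. The top derivative is kept as it is. *)
pose G k := if (k < r)%N then fun y => g k (a k) + SInt (a k) y (g k.+1) else g k.
have GE k x : (k <= r)%N -> Lpt (g k) x -> G k x = g k x.
  move=> kr lx; rewrite /G; case: ltnP => // {}kr; rewrite /SInt.
  have [ax|/ltW xa] := leP (a k) x.
    by rewrite -(inc _ kr _ _ ax)// ?Int_ge//; [ring|exact/aP/ltnW].
  by rewrite -(inc _ kr _ _ xa)// ?Int_ge//; [ring|exact/aP/ltnW].
have Gae k : (k <= r)%N -> {ae mu, forall x, G k x = g k x}.
  move=> kr; have [N [mN N0 sN]] := Lpt_ae (ig k kr); exists N; split=> // x /= nx.
  by apply: sN => /= lx; apply: nx; exact: GE.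
have iG k : (k <= r)%N -> loc_itg (G k).
  rewrite leq_eqVlt => /predU1P[->|kr]; rewrite /G ?ltnn ?kr; first exact: ig.
  move=> c b; have ih := ig _ kr.
  apply: (@eq_itg _ _ (fun x => (g k (a k) + SInt (a k) c (g k.+1)) + Int c x (g k.+1))) => //.
    move=> x/=; rewrite in_itv/= => /andP[/ltW cx _].
    by rewrite -(SInt_add (a k) ih cx); ring.
  by apply: itgD => //; [exact: itg_cst|exact: itg_Int].
have Iae k x y : (k <= r)%N -> Int x y (G k) = Int x y (g k).
  by move=> kr; apply: Rint_ae => //; [exact: iG|exact: ig|exact: Gae].
exists G; split=> //.
- apply/funext => x; rewrite GE// g0//; exact: continuous_Lpt.
- move=> k x y kr xy; rewrite Iae// {1 2}/G kr -(SInt_add (a k) (ig _ kr) xy); ring.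
move=> k kr; apply: (@le_trans _ _ (wnorm alpha r (g k))); last first.
  apply: le_trans gN; rewrite (bigD1 (Ordinal (kr : (k < r.+1)%N)))//=.
  rewrite leeDl// sume_ge0// => i _; exact: integral_ge0.
rewrite (wnorm_ae alpha r (loc_itg_meas (iG k kr)) (loc_itg_meas (ig k kr)))//; exact: Gae.
Qed.

End Representatives.

(** * Functions on the half line and pointwise bounds *)

Section HalfLine.
Variable R : realType.
Notation mu := (@lebesgue_measure R).
Implicit Types (F : nat -> R -> R) (b t T : R) (r k m : nat).

Lemma itg_setU (D E : set (measurableTypeR R)) (h : R -> R) : measurable D -> measurable E ->
  itg D h -> itg E h -> itg (D `|` E) h.
Proof.
move=> mD mE /integrableP[hD fD] /integrableP[hE fE]; apply/integrableP.
have mh : measurable_fun (D `|` E) (EFin \o h) by apply/measurable_funU.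
split=> //; have mn : measurable_fun (D `|` E) (fun x => `|(EFin \o h) x|)%E.
  exact: measurableT_comp.
have -> : D `|` E = D `|` (E `\` D) by rewrite setUDr setDv setD0.
have mED : measurable (E `\` D) by exact: measurableD.
rewrite ge0_integral_setU//=; last 2 first.
- by apply: measurable_funS mn => //; [exact: measurableU|move=> x [Dx|[Ex _]]; [left|right]].
- by rewrite disj_set2E setDE setICA setICr setI0.
rewrite lte_add_pinfty//; apply: le_lt_trans fE; apply: ge0_subset_integral => //.
by apply: measurable_funS mn; [exact: measurableU|move=> x; right].
Qed.

(** Only the norm is restricted to the half line. The increments are integrals up to and across 0,
    which controls the functions near 0, where the weighted norm may not. *)
Definition half_ball b r F : Prop := [/\ forall k, (k <= r)%N -> loc_itg (F k),
  forall k x y, (k < r)%N -> x <= y -> F k y - F k x = Int x y (F k.+1) &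
  forall k, (k <= r)%N -> itg `]0, +oo[ (fun x => F k x * wt b x) /\
    \int[mu]_(x in `]0, +oo[) `|F k x * wt b x| <= 1].

Lemma half_ball_Int b r F k t T : half_ball b r F -> (k <= r)%N -> 0 <= t -> t <= T ->
  Int t T (fun x => `|F k x * wt b x|) <= 1.
Proof.
move=> [_ _ nF] kr t0 tT; have [iF] := nF k kr; apply: le_trans.
have iN := itg_norm _ iF.
rewrite (@le_trans _ _ (Int 0 T (fun x => `|F k x * wt b x|)))//.
  apply: Int_mono => //; apply: itgS (iN _) => // x /=.
  by rewrite !in_itv/= => /andP[-> _].
rewrite -subr_ge0 -tail_split//; last exact: le_trans tT; last exact: iN.
exact: Rintegral_ge0.
Qed.

Lemma wt_half b r t : 0 < t -> wt (b + r%:R / 2) t = Num.sqrt t ^+ r * wt b t.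
Proof.
move=> t0; rewrite /wt powRD ?(gt_eqF t0) ?implybT// mulrAC mulrC; congr (_ * _).
by rewrite mulrC powRrM powR12_sqrt ?ltW// powR_mulrn// sqrtr_ge0.
Qed.

Lemma wt_unit_ratio b c : 0 < c -> exists2 K, 0 <= K &
  forall T t, c <= T -> T <= t <= T + 1 -> wt b T <= K * wt b t.
Proof.
move=> c0; pose K := 1 + c^-1.
have K1 : 1 <= K by rewrite lerDl invr_ge0 ltW.
exists (K `^ `|b| * expR 1) => [|T t cT /andP[Tt tT]].
  by rewrite mulr_ge0 ?powR_ge0 ?expR_ge0.
have T0 := lt_le_trans c0 cT; have t0 := lt_le_trans T0 Tt.
rewrite /wt mulrACA ler_pM ?powR_ge0 ?expR_ge0//; last by rewrite -expRD ler_expR; lra.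
apply: powR_ratio => //; last by rewrite (le_trans Tt)// ler_peMl// ltW.
apply: le_trans tT _; rewrite /K mulrDl mul1r lerD2l ler_pdivlMl//.
by rewrite mulr1.
Qed.

(** The identity [F k T = F k t - Int T t (F k.+1)] is averaged over [t] in [[T, T + 1]]; away from
    0 the weight varies there by a bounded factor, independent of [T]. *)
Lemma point_bound b c : 0 < c -> exists2 K, 0 <= K & forall r F, half_ball b r F ->
  forall k T, (k < r)%N -> c <= T -> `|F k T| * wt b T <= K.
Proof.
move=> c0; have [K K0 KP] := wt_unit_ratio b c0.
exists (2 * K) => [|r F hF k T kr cT]; first by rewrite mulr_ge0.
have T0 := lt_le_trans c0 cT; have TT : T <= T + 1 by rewrite lerDl.
have [iF inc nF] := hF.
have B j : (j <= r)%N -> itg `]T, T + 1] (fun t => `|F j t * wt b t|) /\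
    Int T (T + 1) (fun t => wt b T * `|F j t|) <= K.
  move=> jr; have [iw _] := nF j jr.
  have iN : itg `]T, T + 1] (fun t => `|F j t * wt b t|).
    apply: itg_norm => //; apply: itgS iw => // x /=; rewrite !in_itv/= andbT => /andP[Tx _].
    exact: lt_trans Tx.
  split=> //; apply: (@le_trans _ _ (Int T (T + 1) (fun t => K * `|F j t * wt b t|))).
    apply: Int_le; [by apply: itgZ => //; apply: itg_norm => //; exact: iF|exact: itgZ|].
    move=> t /andP[Tt tT]; rewrite normrM (ger0_norm (wt_ge0 _ _)) mulrCA mulrC ler_wpM2l//.
    by rewrite KP// (ltW Tt).
  by rewrite IntZ// ler_piMr// (half_ball_Int hF jr) ?(ltW T0).
have cI : wt b T * Int T (T + 1) (fun t => `|F k.+1 t|) <= K.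
  by have [_] := B k.+1 kr; rewrite IntZ//; apply: itg_norm => //; exact: iF.
have [_ B1] := B k (ltnW kr).
have : Int T (T + 1) (fun=> `|F k T| * wt b T) <= Int T (T + 1) (fun t => wt b T * `|F k t| + K).
  apply: Int_le; [exact: itg_cst| |].
    apply: itgD => //; last exact: itg_cst.
    by apply: itgZ => //; apply: itg_norm => //; apply: iF; exact: ltnW.
  move=> t /andP[Tt tT]; have E := inc k T t kr (ltW Tt).
  have -> : F k T = F k t - Int T t (F k.+1) by rewrite -E; ring.
  rewrite mulrC; apply: le_trans (ler_wpM2l (wt_ge0 _ _) (ler_normB _ _)) _.
  rewrite mulrDr lerD2l; apply: le_trans cI; rewrite ler_wpM2l ?wt_ge0//.
  apply: le_trans (Int_norm (iF _ kr _ _)) _; apply: Int_mono => //.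
  by apply: itg_norm => //; exact: iF.
rewrite Int_cst// IntD; [|by apply: itgZ => //; apply: itg_norm => //; apply: iF; exact: ltnW|exact: itg_cst].
rewrite Int_cst//; lra.
Qed.

End HalfLine.

(** * Error of the truncated Gauss rule on the half line *)

Section HalfLineError.
Variables (R : realType) (alpha theta : R) (P : nat -> {poly R}) (X : nat -> seq R).
Hypothesis alpha_gt : -1 < alpha.
Hypothesis lag : laguerre_orthonormal alpha P.
Hypothesis zX : forall m, zeros_of (P m) (X m).
Hypothesis th01 : 0 < theta < 1.
Notation mu := (@lebesgue_measure R).
Local Notation w0 := (wt alpha).
Local Notation node m := (fun k => (X m)`_k).
Local Notation ct m := (cotes alpha (X m)).
Local Notation ek m := (ek alpha m (node m) (ct m)).
Implicit Types (F : nat -> R -> R) (t T C : R) (m i k r : nat).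

Let iw : forall q : {poly R}, itg `]0, +oo[ (fun y => q.[y] * w0 y) := itg_polyw lag.
Let sX m : size (X m) = m := (zeros_size_pos lag (zX m)).1.

Lemma jidx_le m : (jidx theta m (X m) <= m)%N.
Proof. by apply/bigmax_leqP => j _; rewrite -ltnS -{2}(sX m). Qed.

Lemma jidx_lt m k : (k < m)%N -> (k < jidx theta m (X m))%N = ((X m)`_k <= 4 * theta * m%:R).
Proof.
move=> km; apply/idP/idP => [|kT]; last first.
  have k1 : (k.+1 < (size (X m)).+1)%N by rewrite sX.
  by apply: (leq_trans _ (leq_bigmax_cond (Ordinal k1) _)); rewrite //= kT orbT.
rewrite /jidx; have [|j /orP[/eqP->//|jT] ->] := @eq_bigmax_cond _
  (fun j : 'I_(size (X m)).+1 => (j == 0%N :> nat) || ((X m)`_(j.-1) <= 4 * theta * m%:R)) (fun j => j : nat).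
- by apply/card_gt0P; exists ord0.
- by [].
move=> kj; apply: le_trans jT; have jm : (j < m.+1)%N by rewrite -{2}(sX m).
rewrite ltnS in jm; case: (j : nat) kj jm => // j' /=; rewrite ltnS leq_eqVlt => /predU1P[->//|kj jm].
by apply/ltW/(node_lt lag zX); rewrite kj.
Qed.

Lemma jidx_sum m (f : R -> R) : \sum_(k < jidx theta m (X m)) ct m k * f (X m)`_k =
  \sum_(k < m) ct m k * stp (X m)`_k (4 * theta * m%:R) * f (X m)`_k.
Proof.
rewrite (big_ord_widen_cond _ xpredT (fun k => ct m k * f (X m)`_k) (jidx_le m)) big_mkcond.
apply: eq_bigr => k _ /=; rewrite jidx_lt// /stp.
by case: ifP => _; rewrite ?mulr1// mulr0 mul0r.
Qed.

Lemma Peano_iter b r F m T k : half_ball b r F -> (k < r)%N ->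
  `|Int 0 T (fun y => F 0%N y * w0 y) - \sum_(k < m) ct m k * stp (X m)`_k T * F 0%N (X m)`_k| <=
  \sum_(i < k.+1) `|F i T| * `|ek m i T| + `|Int 0 T (fun y => F k.+1 y * ek m k y)|.
Proof.
move=> [iF inc _]; have E i : (i < r)%N -> forall y, 0 < y <= T -> F i y = F i T - Int y T (F i.+1).
  by move=> ir y /andP[_ yT]; rewrite -(inc i y T ir yT); ring.
elim: k => [|k IH] kr.
  rewrite (Peano0 iw (fun k => node_pos lag zX (k := k)) (fun k => cotes_pos lag zX (k := k)) (iF 1%N kr 0 T) (E 0%N kr)).
  by rewrite big_ord1 -normrM; exact: ler_normB.
apply: le_trans (IH (ltnW kr)) _; rewrite [in leRHS]big_ord_recr/= -addrA lerD2l.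
rewrite (PeanoS m (fun k => (X m)`_k) (ct m) iw k (iF k.+2 kr 0 T) (E k.+1 kr)).
by rewrite -normrM; exact: ler_normB.
Qed.

(** The norm involves [w_r], which is smaller than [w] near 0. On [(0, 1]] the function is bounded,
    its derivative being integrable there, and [w] is integrable; beyond 1, [w <= w_r]. *)
Lemma half_ball_itg r F : half_ball (alpha + r%:R / 2) r F -> (0 < r)%N ->
  itg `]0, +oo[ (fun y => F 0%N y * w0 y).
Proof.
move=> [iF inc nF] r0; pose h := fun y : R => F 0%N y * w0 y; rewrite -/h.
have i1 : itg `]0, 1] h.
  have ih := iF 1%N r0 0 1.
  have bF y : (`]0, 1]%classic : set R) y -> `|F 0%N y| <= `|F 0%N 0| + Int 0 1 (fun x => `|F 1%N x|).
    rewrite /= in_itv/= => y01; have -> : F 0%N y = F 0%N 0 + Int 0 y (F 1%N).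
      by case/andP: y01 => /ltW y0 _; rewrite -inc//; ring.
    by apply: le_trans (ler_normD _ _) _; rewrite lerD2l Int_bounded.
  apply: (itgM _ _ bF) => //; last exact: (itg_wt iw 1).
  exact: itg_meas (iF 0%N (leq0n r) _ _).
have i2 : itg `]1, +oo[ h.
  have [i0 _] := nF 0%N (leq0n r).
  have {}i0 : itg `]1, +oo[ (fun x => F 0%N x * wt (alpha + r%:R / 2) x).
    apply: itgS i0 => // x /=; rewrite !in_itv/= !andbT; exact: lt_trans.
  apply: (@itg_le _ _ _ (fun x => `|F 0%N x * wt (alpha + r%:R / 2) x|)) => //; last exact: itg_norm.
    apply: measurable_funM; last exact: meas_wt.
    by apply: measurable_funTS; apply: loc_itg_meas; exact: iF.
  move=> x /=; rewrite in_itv/= andbT => x1; have x0 := lt_trans ltr01 x1.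
  rewrite wt_half// !normrM ler_wpM2l// ler_peMl// ger0_norm ?exprn_ge0 ?sqrtr_ge0//.
  by rewrite exprn_ege1// -sqrtr1 ler_wsqrtr// ltW.
have -> : `]0, +oo[%classic = `]0, 1]%classic `|` `]1, +oo[%classic :> set R.
  by rewrite -itv_bndbnd_setU// bnd_simp.
exact: itg_setU.
Qed.

Let sm m : 0 <= Num.sqrt (m%:R : R) := sqrtr_ge0 _.

Lemma half_error_pos r : (0 < r)%N -> exists2 C, 0 <= C & forall m F, (0 < m)%N ->
  half_ball (alpha + r%:R / 2) r F ->
  `|\int[mu]_(y in `]0, +oo[) (F 0%N y * w0 y) -
    \sum_(k < jidx theta m (X m)) ct m k * F 0%N (X m)`_k| <= C * Num.sqrt m%:R ^- r.
Proof.
move=> r0; pose b : R := alpha + r%:R / 2.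
have t4 : 0 < 4 * theta by move: th01; lra.
have [Kp Kp0 KpP] := point_bound b t4.
have [C [C0 CP]] := kernel_bound alpha_gt lag zX th01 r.
pose S := Num.sqrt (4 * theta).
have S0 : 0 < S by rewrite sqrtr_gt0.
(* In this order: the boundary terms at [T], the remainder integral with the last kernel, and the
   tail beyond [T]. *)
pose D : R := S ^- r * (\sum_(i < r) Kp * (C * S ^+ i.+1)) + C + S ^- r.
have Dt i : 0 <= Kp * (C * S ^+ i.+1) by rewrite !mulr_ge0// exprn_ge0// ltW.
exists D => [|m F m0 hF].
  by rewrite !addr_ge0 ?mulr_ge0 ?sumr_ge0// invr_ge0 exprn_ge0// ltW.
have mR : 0 < m%:R :> R by rewrite ltr0n.
pose T := 4 * theta * m%:R; have T0 : 0 < T by rewrite mulr_gt0.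
have sT : Num.sqrt T = S * Num.sqrt m%:R by rewrite sqrtrM ?ltW.
have sm0 : 0 < Num.sqrt (m%:R : R) by rewrite sqrtr_gt0.
have cT : 4 * theta <= T by rewrite ler_peMr ?ler1n ?ltW.
(* Beyond [T], and at [T] itself, [w] is at most [T^(-r/2) w_r], and [T] is a fixed multiple of
   [m]. *)
have wT y : 0 < y -> w0 y = Num.sqrt y ^- r * wt b y.
  by move=> y0; rewrite /b wt_half// mulKf// expf_neq0// gt_eqF// sqrtr_gt0.
have [iF inc nF] := hF; have iw0 := half_ball_itg hF r0.
have E := tail_split iw0 (ltW T0).
have tail : `|\int[mu]_(y in `]T, +oo[) (F 0%N y * w0 y)| <= S ^- r * Num.sqrt m%:R ^- r.
  have [ib nb] := nF 0%N (leq0n r).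
  have sub : `]T, +oo[%classic `<=` (`]0, +oo[%classic : set R).
    by move=> x /=; rewrite !in_itv/= !andbT; exact: lt_trans.
  have iT : itg `]T, +oo[ (fun y => F 0%N y * w0 y) by apply: itgS iw0.
  have ibT : itg `]T, +oo[ (fun y => `|F 0%N y * wt b y|) by apply: itg_norm => //; apply: itgS ib.
  rewrite -exprVn -[X in _ * X]exprVn -exprMn -invfM -sT exprVn.
  apply: le_trans (le_normr_Rintegral _ iT) _ => //.
  apply: (@le_trans _ _ (\int[mu]_(y in `]T, +oo[) (Num.sqrt T ^- r * `|F 0%N y * wt b y|))).
    apply: le_Rintegral => //; [exact: itg_norm|exact: itgZ|].
    move=> y /=; rewrite in_itv/= andbT => Ty; have y0 := lt_trans T0 Ty.
    rewrite wT// mulrCA normrM ler_wpM2r// ger0_norm ?invr_ge0 ?exprn_ge0 ?sqrtr_ge0//.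
    rewrite lef_pV2 ?posrE ?exprn_gt0 ?sqrtr_gt0// lerXn2r ?nnegrE ?sqrtr_ge0//.
    by rewrite ler_wsqrtr// ltW.
  rewrite RintegralZl// ler_piMr ?invr_ge0 ?exprn_ge0 ?sqrtr_ge0//.
  apply: le_trans nb; rewrite -subr_ge0; have := tail_split (itg_norm _ ib) (ltW T0).
  move=> ->//; rewrite opprB addrC subrK; apply: Int_ge0 => *; exact: normr_ge0.
rewrite jidx_sum -/T; set Q := \sum_(k < m) _.
have -> : \int[mu]_(y in `]0, +oo[) (F 0%N y * w0 y) - Q =
   Int 0 T (fun y => F 0%N y * w0 y) - Q + \int[mu]_(y in `]T, +oo[) (F 0%N y * w0 y).
  by rewrite E; ring.
rewrite /D 2!mulrDl; apply: le_trans (ler_normD _ _) _; apply: lerD; last exact: tail.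
have r1 : (r.-1 < r)%N by rewrite prednK.
apply: le_trans (Peano_iter m T hF r1) _; rewrite prednK//; apply: lerD.
  rewrite mulr_sumr mulr_suml.
  apply: ler_sum => i _; have := KpP _ _ hF i T (ltn_ord i) cT.
  have := CP m i T m0 (ltn_ord i); rewrite T0 lexx => /(_ isT).
  have -> : Num.sqrt (T / m%:R) = S by rewrite /T mulfK ?gt_eqF.
  move=> e1 e2; apply: le_trans (ler_wpM2l (normr_ge0 _) e1) _.
  rewrite wT// sT mulrCA exprMn invfM.
  have -> : C * S ^+ i.+1 * (`|F i T| * (S ^- r * Num.sqrt m%:R ^- r * wt b T)) =
    S ^- r * (`|F i T| * wt b T * (C * S ^+ i.+1) * Num.sqrt m%:R ^- r) by ring.
  rewrite -[leRHS]mulrA ler_wpM2l ?invr_ge0 ?exprn_ge0 ?(ltW S0)// ler_wpM2r ?invr_ge0 ?exprn_ge0//.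
  by rewrite ler_wpM2r// mulr_ge0// exprn_ge0// ltW.
have ib : itg `]0, T] (fun y => `|F r y * wt b y|).
  apply: itg_norm => //; have [ib _] := nF r (leqnn r); apply: itgS ib => // x /=.
  by rewrite !in_itv/= => /andP[-> _].
(* The factor [(y/m)^(r/2)] turns [w] into [m^(-r/2) w_r], so the remainder is [m^(-r/2)] times the
   norm of [F r]. *)
have pb y : 0 < y <= T -> `|F r y * ek m r.-1 y| <= C * Num.sqrt m%:R ^- r * `|F r y * wt b y|.
  move=> y0T; have /andP[y0 yT] := y0T; have := CP m r.-1 y m0 r1 y0T.
  rewrite prednK// sqrtrM ?(ltW y0)// sqrtrV ?(ltW mR)// exprMn exprVn => ey.
  rewrite [leLHS]normrM [X in _ <= _ * X]normrM mulrCA ler_wpM2l//.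
  apply: le_trans ey _; rewrite ger0_norm ?wt_ge0// /b wt_half//.
  by rewrite le_eqVlt; apply/orP; left; apply/eqP; ring.
have ie : itg `]0, T] (fun y => F r y * ek m r.-1 y).
  apply: (itg_le _ _ _ (itgZ _ _ ib)) => //; last by move=> y /=; rewrite in_itv/=; exact: pb.
  apply: measurable_funM; last exact: itg_meas (itg_ek m _ _ iw _ _).
  by apply: measurable_funTS; apply: loc_itg_meas; exact: iF.
apply: le_trans (Int_norm_le ie (itgZ _ _ ib) pb) _ => //.
rewrite IntZ// ler_piMr ?mulr_ge0 ?invr_ge0 ?exprn_ge0//.
exact: (half_ball_Int hF (leqnn r) (lexx 0) (ltW T0)).
Qed.

(** The rate is stated in [m + 1] so as to cover [m = 0], which [m_n] may be for small [n]. There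
    the rule is empty, and the integral is bounded through the rule for [m = 1], which has at most
    one node. For [m > 0] the shift costs [2^r]. *)
Lemma half_error r : (0 < r)%N -> exists2 C, 0 <= C & forall m F,
  half_ball (alpha + r%:R / 2) r F ->
  `|\int[mu]_(y in `]0, +oo[) (F 0%N y * w0 y) -
    \sum_(k < jidx theta m (X m)) ct m k * F 0%N (X m)`_k| <= C * Num.sqrt m.+1%:R ^- r.
Proof.
move=> r0; pose b : R := alpha + r%:R / 2.
have [C C0 CP] := half_error_pos r0.
have x0 := node_pos lag zX (ltn0Sn 0).
have [K K0 KP] := point_bound b x0.
pose L := ct 1 0%N * (K / wt b (X 1%N)`_0).
have L0 : 0 <= L by rewrite mulr_ge0 ?divr_ge0 ?wt_ge0// ltW// (cotes_pos lag zX).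
have sp m : (0 < m)%N -> 0 < Num.sqrt (m%:R : R) by move=> m0; rewrite sqrtr_gt0 ltr0n.
exists (C * 2 ^+ r + C + L) => [|[|m] F hF].
  by rewrite (addr_ge0 _ L0)// addr_ge0// mulr_ge0// exprn_ge0.
  rewrite (_ : jidx _ _ _ = 0%N); last by apply/eqP; rewrite -leqn0 jidx_le.
  rewrite big_ord0 subr0 sqrtr1 expr1n invr1 mulr1.
  have := CP 1%N F isT hF; rewrite sqrtr1 expr1n invr1 mulr1 => B.
  rewrite -[X in `|X|](subrK (\sum_(k < jidx theta 1 (X 1%N)) ct 1 k * F 0%N (X 1%N)`_k)).
  apply: le_trans (ler_normD _ _) _; apply: lerD.
    by apply: le_trans B _; rewrite lerDr mulr_ge0// exprn_ge0.
  have := jidx_le 1; case: jidx => [|[|//]] _; first by rewrite big_ord0 normr0.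
  rewrite big_ord1 normrM ger0_norm ?(ltW (cotes_pos lag zX (ltn0Sn 0)))//.
  rewrite ler_wpM2l ?(ltW (cotes_pos lag zX (ltn0Sn 0)))// ler_pdivlMr ?wt_gt0//.
  exact: KP hF _ _ r0 (lexx _).
apply: le_trans (CP m.+1 F isT hF) _; rewrite -addrA mulrDl ler_wpDr//.
  by rewrite mulr_ge0 ?addr_ge0// invr_ge0 exprn_ge0.
rewrite -mulrA ler_wpM2l// -!exprVn -exprMn lerXn2r ?nnegrE ?mulr_ge0 ?invr_ge0//.
rewrite -ler_pdivrMl// mulrC -invfM lef_pV2 ?posrE ?mulr_gt0 ?sp//.
have -> : (2 : R) = Num.sqrt (2 ^+ 2) by rewrite sqrtr_sqr ger0_norm.
rewrite -sqrtrM// ler_wsqrtr// -natrX -natrM ler_nat.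
by rewrite (@leq_trans (m.+1 * 2))// ?leq_mul2l// muln2 -addnn addSnnS leq_addl.
Qed.

End HalfLineError.

(** * Reflection and folding of the line *)

Section Reflection.
Variable R : realType.
Notation mu := (@lebesgue_measure R).
Implicit Types (h f : R -> R) (x y : R).

Let opp := (-%R : measurableTypeR R -> measurableTypeR R).

Let mopp : measurable_fun setT opp.
Proof. exact: oppr_measurable. Qed.

Lemma ge0_integral_opp (D : set (measurableTypeR R)) (u : R -> \bar R) : measurable D ->
  measurable_fun setT u -> (forall x, 0 <= u x)%E ->
  (\int[mu]_(x in D) u x = \int[mu]_(x in opp @^-1` D) u (- x)%R)%E.
Proof.
move=> mD mu_ u0; rewrite -(@ge0_integral_pushforward _ _ _ _ _ opp mopp mu D u)//; last exact: measurable_funTS.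
by apply: eq_measure_integral => //= A mA _; exact/esym/lebesgue_measureN.
Qed.

Lemma meas_opp (D : set (measurableTypeR R)) h : measurable_fun setT h ->
  measurable_fun D (fun x => h (- x)).
Proof. by move=> mh; apply: measurable_funTS; apply: measurableT_comp mh _. Qed.

Lemma itg_opp (D : set (measurableTypeR R)) h : measurable D -> measurable_fun setT h ->
  itg D h -> itg (opp @^-1` D) (fun x => h (- x)).
Proof.
move=> mD mh /integrableP[_ fh]; apply/integrableP; split.
  by apply/measurable_EFinP; exact: meas_opp.
move: fh; rewrite ge0_integral_opp//.
by apply: measurableT_comp => //; exact/measurable_EFinP.
Qed.

Lemma Rint_opp (D : set (measurableTypeR R)) h : measurable D -> measurable_fun setT h ->
  itg D h -> \int[mu]_(x in D) h x = \int[mu]_(x in opp @^-1` D) h (- x).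
Proof.
move=> mD mh ih; congr fine.
rewrite -(@integral_pushforward _ _ _ _ _ opp mopp mu D (EFin \o h))//.
- by apply: eq_measure_integral => //= A mA _; exact/esym/lebesgue_measureN.
- exact/measurable_EFinP.
- exact: itg_opp.
Qed.

Lemma loc_itg_opp h : loc_itg h -> loc_itg (fun x => h (- x)).
Proof.
move=> ih a b; have := itg_opp _ (loc_itg_meas ih) (itg_cc (ih (- b) (- a))).
rewrite opp_preimage_itvbndbnd/= !opprK => /(_ _)/itgS; apply=> //.
by move=> x /=; rewrite !in_itv/= => /andP[/ltW -> ->].
Qed.

Lemma Int_opp h x y : loc_itg h -> Int x y (fun t => h (- t)) = Int (- y) (- x) h.
Proof.
move=> ih; rewrite /Int (Rint_opp _ (loc_itg_meas ih) (ih _ _))// opp_preimage_itvbndbnd/= !opprK.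
have ic := itg_cc (loc_itg_opp ih x y).
rewrite Rintegral_itv_obnd_cbnd; last exact: loc_itg_opp.
rewrite Rintegral_itv_bndo_bndc//.
by apply: itgS ic => // t /=; rewrite !in_itv/= => /andP[-> /ltW ->].
Qed.

Lemma Rint_fold h : itg setT h ->
  itg `]0, +oo[ (fun x => h x + h (- x)) /\
  \int[mu]_x h x = \int[mu]_(x in `]0, +oo[) (h x + h (- x)).
Proof.
move=> ih; have mh : measurable_fun setT h by apply/measurable_EFinP; exact: measurable_int ih.
have ip : itg `]0, +oo[ h by apply: itgS ih.
have iN : itg `]-oo, 0] h by apply: itgS ih.
have pre : opp @^-1` `]-oo, 0]%classic = `[0, +oo[%classic.
  by apply/seteqP; split=> x /=; rewrite !in_itv/= andbT oppr_le0.
have ic : itg `[0, +oo[ (fun x => h (- x)) by rewrite -pre; exact: itg_opp.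
have io : itg `]0, +oo[ (fun x => h (- x)).
  by apply: itgS ic => // x /=; rewrite !in_itv/= !andbT; exact: ltW.
split; first exact: itgD.
rewrite RintegralD// [X in _ + X]Rintegral_itv_obnd_cbnd// -pre -Rint_opp//.
have iT : itg `]-oo, +oo[ h by apply: itgS ih.
have := @Rintegral_itvB R h -oo%O +oo%O 0 iT; rewrite !bnd_simp => /(_ isT isT) <-.
by rewrite set_itvNyy subrK.
Qed.

End Reflection.

(** * From the half line back to the full line *)

Section FullLine.
Variables (R : realType) (alpha : R) (r : nat).
Notation mu := (@lebesgue_measure R).
Implicit Types (f : R -> R) (x : R) (k : nat).

Lemma wrN n x : wr alpha n (- x) = wr alpha n x.
Proof. by rewrite /wr normrN. Qed.

Lemma wr_wt n x : 0 < x -> wr alpha n x = wt (alpha + n%:R / 2) x.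
Proof. by move=> x0; rewrite /wr gtr0_norm. Qed.

Lemma wr_ge0 n x : 0 <= wr alpha n x.
Proof. by rewrite mulr_ge0 ?powR_ge0 ?expR_ge0. Qed.

(* The coefficients (1,0), (0,1) and (1,1) select f(x), f(-x) and f(x) + f(-x). *)
Lemma W_ball_half f : W_ball alpha r f -> forall a c : R, 0 <= a <= 1 -> 0 <= c <= 1 ->
  exists F, half_ball (alpha + r%:R / 2) r F /\ forall x, F 0%N x = a * f x + c * f (- x).
Proof.
move=> fW a c /andP[a0 a1] /andP[c0 c1]; have [G [G0 iG inc nG]] := W_ball_repr fW.
pose F k x := a * G k x + c * ((-1) ^+ k * G k (- x)).
exists F; split; last by move=> x; rewrite /F expr0 mul1r G0.
split=> [k kr u v|k x y kr xy|k kr].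
- apply: itgD => //; first by apply: itgZ => //; exact: iG.
  by do 2 (apply: itgZ => //); apply: loc_itg_opp; exact: iG.
- have iO := loc_itg_opp (iG k.+1 kr).
  have i2 : itg `]x, y] (fun x => (-1) ^+ k.+1 * G k.+1 (- x)) by apply: itgZ => //; exact: iO.
  rewrite /F IntD; [|by apply: itgZ => //; exact: iG|exact: itgZ].
  rewrite (IntZ _ (iG k.+1 kr x y)) (IntZ _ i2) (IntZ _ (iO x y)) Int_opp; last exact: iG.
  rewrite -(inc k x y kr xy) -inc ?lerN2// exprS; ring.
pose h x := G k x * wr alpha r x.
have mh : measurable_fun setT h.
  by apply: measurable_funM; [exact: loc_itg_meas (iG k kr)|exact: meas_wr].
have ih : itg setT h.
  apply/integrableP; split; first exact/measurable_EFinP.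
  by apply: le_lt_trans (nG k kr) _; rewrite ltry.
have nh : \int[mu]_x `|h x| <= 1.
  rewrite -lee_fin /Rintegral fineK; first exact: nG.
  by apply: integrable_fin_num => //; exact: (itg_norm _ ih).
have [iN EN] := Rint_fold (itg_norm measurableT ih).
have ip : itg `]0, +oo[ h by apply: itgS ih.
have im : itg `]0, +oo[ (fun x => h (- x)).
  have -> : (fun x => h (- x)) = fun x => (h x + h (- x)) - h x by apply/funext => x; ring.
  by apply: itgB => //; have [] := Rint_fold ih.
have FE x : 0 < x -> F k x * wt (alpha + r%:R / 2) x = a * h x + c * ((-1) ^+ k * h (- x)).
  by move=> x0; rewrite /h wrN wr_wt// /F; ring.
have iF : itg `]0, +oo[ (fun x => F k x * wt (alpha + r%:R / 2) x).
  apply: (@eq_itg _ _ (fun x => a * h x + c * ((-1) ^+ k * h (- x)))) => //.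
    by move=> x /=; rewrite in_itv/= andbT => x0; rewrite FE.
  by apply: itgD => //; do ?apply: itgZ.
(* The norms of the two halves add up to the full norm, so the folded function stays in the unit
   ball as [a] and [c] are at most 1. *)
split=> //; apply: le_trans nh; rewrite EN; apply: le_Rintegral => //; first exact: itg_norm.
move=> x /=; rewrite in_itv/= andbT => x0; rewrite FE//.
apply: le_trans (ler_normD _ _) _; rewrite !normrM normrX normrN1 expr1n mul1r.
by rewrite (ger0_norm a0) (ger0_norm c0) lerD// ler_piMl.
Qed.

End FullLine.

Section FullError.
Variables (R : realType) (alpha theta : R) (P : nat -> {poly R}) (X : nat -> seq R) (r : nat).
Hypothesis alpha_gt : -1 < alpha.
Hypothesis lag : laguerre_orthonormal alpha P.
Hypothesis zX : forall m, zeros_of (P m) (X m).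
Hypothesis th01 : 0 < theta < 1.
Hypothesis r_gt0 : (0 < r)%N.
Notation mu := (@lebesgue_measure R).

Let i0 : 0 <= (0 : R) <= 1. Proof. by rewrite lexx ler01. Qed.
Let i1 : 0 <= (1 : R) <= 1. Proof. by rewrite lexx ler01. Qed.

(** Membership in the ball speaks of [w_r] only; integrability against [w] is obtained on each half
    line separately. *)
Lemma W_ball_itg f : W_ball alpha r f -> itg setT (fun x : R => f x * wr alpha 0 x).
Proof.
move=> fW; set h := fun x : R => _.
have mh : measurable_fun setT h.
  have [cf _] := fW; apply: measurable_funM; last exact: meas_wr.
  exact: continuous_measurable_fun.
have wE x : 0 < x -> wr alpha 0 x = wt alpha x by move=> x0; rewrite wr_wt// mul0r addr0.
have [F [hF FE]] := W_ball_half fW (a := 1) (c := 0) i1 i0.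
have [E [hE EE]] := W_ball_half fW (a := 0) (c := 1) i0 i1.
have ip : itg `]0, +oo[ h.
  apply: eq_itg (half_ball_itg lag hF r_gt0) => // x /=; rewrite in_itv/= andbT => x0.
  by rewrite /h wE// FE mul1r mul0r addr0.
have im : itg `]0, +oo[ (fun x => h (- x)).
  apply: eq_itg (half_ball_itg lag hE r_gt0) => // x /=; rewrite in_itv/= andbT => x0.
  by rewrite /h wrN wE// EE mul1r mul0r add0r.
have {}im : itg `]-oo, 0] h.
  have := @itg_opp _ `[0, +oo[ (fun x => h (- x)) _ _ (itg_cc im).
  rewrite opp_preimage_itvbndy/= oppr0 => /(_ _ _)/eq_itg; apply=> //.
  - by move=> x _; rewrite opprK.
  - exact: (meas_opp (D := setT) mh).
have -> : [set: R] = `]-oo, 0] `|` `]0, +oo[.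
  by apply/seteqP; split=> // x _ /=; rewrite !in_itv/= andbT; have [?|?] := leP x 0; [left|right].
exact: itg_setU.
Qed.

Lemma upper_bound : exists2 C : R, 0 <= C & forall m,
  (sup_err alpha (W_ball alpha r) (Q2TL alpha (X m) (jidx theta m (X m))) <=
   (C * Num.sqrt m.+1%:R ^- r)%:E)%E.
Proof.
have [C C0 CP] := half_error alpha_gt lag zX th01 r_gt0.
exists C => // m; apply: ge_ereal_sup => _ [f fW <-].
have [F [hF FE]] := W_ball_half fW (a := 1) (c := 1) i1 i1.
have ih := W_ball_itg fW; have [_ E] := Rint_fold ih.
rewrite /quad_err.
have -> : (\int[mu]_x (f x * wr alpha 0 x)%:E)%E = (\int[mu]_x (f x * wr alpha 0 x))%:E.
  by rewrite /Rintegral fineK//; exact: integrable_fin_num.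
rewrite -EFinB abse_EFin lee_fin; apply: le_trans (CP m F hF).
rewrite le_eqVlt; apply/orP; left; apply/eqP; congr (`|_ - _|).
  rewrite E; apply: eq_RintR => x /=; rewrite in_itv/= andbT => x0.
  by rewrite wrN wr_wt// mul0r addr0 FE; ring.
rewrite /quad_apply /Q2TL big_flatten/= big_map -{1}[jidx _ _ _]subn0 -/(index_iota 0 _) big_mkord.
by apply: eq_bigr => k _; rewrite !big_cons big_nil/= FE; ring.
Qed.

End FullError.

(** * Bumps, their weak derivatives, and intervals free of nodes *)

Section Bumps.
Variable R : realType.
Notation mu := (@lebesgue_measure R).
Implicit Types (h psi : R -> R) (D G : nat -> R -> R) (a b s t x : R) (k j r : nat).

Lemma itg_supp h a b : (forall t, ~~ (a < t <= b) -> h t = 0) -> itg `]a, b] h -> itg setT h.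
Proof.
move=> h0 /integrable_mkcond => /(_ (measurable_itv _)); apply: eq_integrable => // t _ /=.
rewrite patchE; case: ifPn => //; rewrite notin_setE/= in_itv/= => /negP n.
by rewrite h0.
Qed.

(** All derivatives are carried along as a sequence, the shape in which [W_ball] asks for its
    witness. *)
Definition is_bump a b D := (forall k t, is_derive t 1 (D k) (D k.+1 t)) /\
  forall k t, ~~ (a < t < b) -> D k t = 0.

Lemma bump_cont a b D k : is_bump a b D -> continuous (D k).
Proof. by move=> [dD _] t; exact: derive_cont (dD k t). Qed.

Lemma bump_supp a b D k psi : is_bump a b D -> forall t, ~~ (a < t <= b) -> D k t * psi t = 0.
Proof.
move=> [_ sD] t h; rewrite sD ?mul0r//; apply: contra h => /andP[-> /ltW ->] //.
Qed.

Lemma continuous_mul h psi : continuous h -> continuous psi -> continuous (fun t => h t * psi t).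
Proof. by move=> ch cp t; apply: cvgM; [exact: ch|exact: cp]. Qed.

Lemma bump_itg a b D k psi : is_bump a b D -> continuous psi -> itg setT (fun t => D k t * psi t).
Proof.
move=> bD cpsi; apply: (@itg_supp _ a b); first exact: bump_supp bD.
by apply: continuous_itg => t _; apply: continuous_mul => //; exact: bump_cont bD.
Qed.

Lemma bump_parts a b D j k phi : a <= b -> is_bump a b D -> test_fun phi ->
  \int[mu]_t (D j t * derive1n k phi t) = (-1) ^+ k * \int[mu]_t (D (j + k)%N t * phi t).
Proof.
move=> ab bD [dphi _].
have dp n t : is_derive t 1 (derive1n n phi) (derive1n n.+1 phi t).
  by rewrite derive1nS derive1E; apply: DeriveDef (dphi n t) _.
have cp n : continuous (derive1n n phi) by move=> t; exact: derive_cont (dp n t).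
elim: k j => [|k IH] j; first by rewrite addn0 expr0 mul1r.
rewrite addnS -addSn exprS mulN1r mulNr -IH !(@Rint_supp _ _ a b); try exact: bump_supp bD.
have ic i n : itg `]a, b] (fun t => D i t * derive1n n phi t).
  by apply: itgS (bump_itg i bD (cp n)).
apply/eqP; rewrite -subr_eq0 opprK -IntD//; apply/eqP.
have dF t : a <= t <= b -> is_derive t 1 (fun t => D j t * derive1n k phi t)
    (D j t * derive1n k.+1 phi t + D j.+1 t * derive1n k phi t).
  move=> _; have [dD _] := bD; apply: derive_eqv (deriveM_fun (dD j t) (dp k t)) _.
  by rewrite [X in _ + X]mulrC.
rewrite (Int_FTC ab dF).
  by rewrite !bD.2 ?mul0r ?subrr// ltxx ?andbF.
have cc i n : continuous (fun t => D i t * derive1n n phi t).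
  exact: continuous_mul (@bump_cont _ _ _ i bD) (cp n).
by move=> t _; apply: cvgD; exact: cc.
Qed.

Lemma bump_weak a b D k : a <= b -> is_bump a b D -> weak_deriv k (D 0%N) (D k).
Proof.
move=> ab bD phi tp; have [dphi _] := tp.
have cp n : continuous (derive1n n phi).
  move=> t; apply: (derive_cont (a := derive1n n.+1 phi t)).
  by rewrite derive1nS derive1E; apply: DeriveDef (dphi n t) _.
have i1 := bump_itg 0 bD (cp k); have i2 := bump_itg k bD (cp 0%N).
split; first exact: i1; split; first exact: i2.
have E := bump_parts 0 k ab bD tp; rewrite add0n in E.
have := congr1 (EFin : R -> \bar R) E.
by rewrite EFinM /Rintegral !fineK//; exact: integrable_fin_num.
Qed.

Lemma bump_shift a b D s c : is_bump a b D -> is_bump (s + a) (s + b) (fun k t => c * D k (t - s)).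
Proof.
move=> [dD sD]; split=> [k t|k t h].
  have ds : is_derive t 1 (fun t => 1 * t + - s) 1 by exact: derive_affine.
  have E : (fun t => c * D k (t - s)) = fun t => c * D k (1 * t + - s).
    by apply/funext => u; rewrite mul1r.
  rewrite E; have dd := @derive_comp_fun _ (fun t => 1 * t + - s) (D k) t _ _ (dD k _) ds.
  apply: derive_eqv (deriveM_fun (is_derive_cst c t 1) dd) _.
  by rewrite /cst mul1r; ring.
by rewrite sD ?mulr0// ltrBrDl ltrBlDl.
Qed.

Lemma unit_bump r : exists D (M : R), [/\ is_bump 0 1 D, 1 <= M,
  forall k t, (k <= r)%N -> `|D k t| <= M, forall t, 0 <= D 0%N t &
  forall t, 4^-1 <= t <= 3 / 4 -> D 0%N t = 1].
Proof.
(* With width [1/8] the cutoff rises on [[1/8, 1/4]] and falls on [[3/4, 7/8]], strictly inside the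
   unit interval. *)
pose d : R := 8^-1; have d0 : 0 < d by rewrite invr_gt0.
pose f := cutoff d d (3 / 4); pose D k := derive1n k f.
have dD k t : is_derive t 1 (D k) (D k.+1 t).
  rewrite /D derive1nS derive1E; apply: DeriveDef => //.
  by apply: Sm_derivable => n; exact: Sm_cutoff.
have out k t : t < d \/ 3 / 4 + d < t -> D k t = 0.
  elim: k t => [|k IH] t ht.
    rewrite /D /f derive1n0 /cutoff; case: ht => h.
      by rewrite !step_le0 ?scaled_le0//; move: h; rewrite /d; lra.
    by rewrite !step_ge1 ?scaled_ge1//; move: h; rewrite /d; lra.
  have [_ <-] := dD k t; apply/derive_val.
  have dc : is_derive t 1 (fun=> 0 : R) 0 by exact: is_derive_cst.
  apply: near_eq_is_derive dc; case: ht => h.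
    by near=> z; apply/esym/IH; left; near: z; exact: lt_nbhsl.
  by near=> z; apply/esym/IH; right; near: z; exact: lt_nbhsr.
have bD : is_bump 0 1 D.
  by split=> // k t h; apply: out; move: h; rewrite negb_and -!leNgt /d => /orP[] ?; [left|right]; lra.
have Mk k : exists M, forall t, `|D k t| <= M.
  have cD : {within `[0, 1], continuous (fun t => `|D k t|)}.
    have ck : continuous (D k) by exact: bump_cont bD.
    by apply: continuous_subspaceT => t; apply: cvg_norm; exact: ck.
  have [c _ cM] := EVT_max ler01 cD; exists `|D k c| => t.
  have [h|h] := boolP (0 < t < 1); last by rewrite bD.2// normr0.
  by apply: cM; rewrite in_itv/=; case/andP: h => /ltW -> /ltW ->.
have [M [M1 MP]] : exists M, 1 <= M /\ forall k t, (k <= r)%N -> `|D k t| <= M.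
  elim: (r) => [|n [M [M1 MP]]].
    have [M MP] := Mk 0%N; exists (Num.max 1 M); split; first by rewrite le_max lexx.
    by move=> k t; rewrite leqn0 => /eqP ->; rewrite le_max MP orbT.
  have [M' M'P] := Mk n.+1; exists (Num.max M M'); split; first by rewrite le_max M1.
  move=> k t; rewrite leq_eqVlt => /predU1P[->|kn]; rewrite le_max ?M'P ?orbT//.
  by rewrite MP.
exists D, M; split=> // t; rewrite /D derive1n0 /f /cutoff.
  have [t1|t1] := leP t (3 / 4).
    by rewrite [X in _ + _ * X]step_le0 ?scaled_le0// mulr0 addr0; have /andP[] := step_bound (scaled d d t).
  rewrite step_ge1; last by apply: scaled_ge1 => //; move: t1; rewrite /d; lra.
  by have /andP[] := step_bound (scaled d (3 / 4) t); lra.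
move=> /andP[t1 t2]; rewrite step_ge1 ?scaled_ge1//; last by move: t1; rewrite /d; lra.
by rewrite step_le0 ?scaled_le0// mulr0 addr0.
Unshelve. all: by end_near. Qed.

(** Pigeonhole on integer parts. Starting at 1 keeps the interval away from the singularity of the
    weight. *)
Lemma free_interval (s : seq R) n : (size s <= n)%N ->
  exists i, (0 < i <= n.+1)%N /\ forall p, p \in s -> ~~ (i%:R < p < i%:R + 1).
Proof.
move=> sn; have /allPn[i] : ~~ all (fun i => i \in map Num.truncn s) (iota 1 n.+1).
  apply/negP => /allP h; have := uniq_leq_size (iota_uniq 1 n.+1) h.
  by rewrite size_iota size_map leqNgt ltnS sn.
rewrite mem_iota add1n ltnS => i1 ni; exists i; split=> // p ps; apply: contra ni => /andP[ip pi].
apply/mapP; exists p => //; apply/esym/truncn_def.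
by rewrite (ltW ip) -natr1 pi.
Qed.

End Bumps.

(** * The lower bound for arbitrary quadratures *)

Section LowerBound.
Variables (R : realType) (alpha : R) (r : nat).
Notation mu := (@lebesgue_measure R).

(** The bump on [[i, i + 1]] is normalised in [w_r] while the error is measured in [w]; their ratio
    there is of order [i^(-r/2)], and [i <= n + 1 <= 2 n], hence the power of [sqrt 2] in the
    constant. *)
Lemma lower_bound : exists2 C : R, 0 < C & forall (n : nat) (Q : seq (R * R)), (0 < n)%N ->
  (size Q <= n)%N -> ((C * Num.sqrt n%:R ^- r)%:E <= sup_err alpha (W_ball alpha r) Q)%E.
Proof.
pose b : R := alpha + r%:R / 2.
have [D [M [bD M1 DM D0 D1]]] := unit_bump R r.
have [K K0 KP] := wt_unit_ratio alpha (ltr01 : 0 < (1 : R)).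
have M0 : 0 < M := lt_le_trans ltr01 M1.
have K_gt0 : 0 < K.
  rewrite lt_neqAle K0 andbT; apply/eqP => K00; have := KP 1 1 (lexx _).
  by rewrite lexx lerDl ler01 -K00 mul0r leNgt wt_gt0// => /(_ isT).
(* On [(i, i + 1)] with [i >= 1] the quotient [t/i] is at most 2. *)
pose B : R := 2 `^ `|b|; have B0 : 0 < B by rewrite powR_gt0.
have wrB (i : nat) t : (0 < i)%N -> 0 < t - i%:R < 1 -> wr alpha r t <= B * wt b i%:R.
  move=> i0 /andP[t0 t1]; have i1 : 1 <= i%:R :> R by rewrite ler1n.
  have tp : 0 < t by lra.
  rewrite wr_wt// -/b /wt mulrA ler_pM ?powR_ge0 ?expR_ge0//.
    by apply: powR_ratio; rewrite ?ltr0n//; lra.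
  by rewrite ler_expR; lra.
(* Chosen so that each of the [r + 1] norms of the scaled bump is at most [1/(r + 1)]. *)
pose A : R := r.+1%:R * M * B.
have A0 : 0 < A by rewrite !mulr_gt0.
pose C := (2 * K * A)^-1 * Num.sqrt 2 ^- r.
have s2 : 0 < Num.sqrt (2 : R) by rewrite sqrtr_gt0.
exists C => [|n Q n0 sQ]; first by rewrite mulr_gt0// ?invr_gt0 ?exprn_gt0// !mulr_gt0.
have [|i [/andP[i0 iN] free]] := @free_interval R [seq p.1 | p <- Q] n; first by rewrite size_map.
have i1 : 1 <= i%:R :> R by rewrite ler1n.
have ip : 0 < i%:R :> R by rewrite ltr0n.
have wi : 0 < wt b i%:R by exact: wt_gt0.
pose c : R := (A * wt b i%:R)^-1; have c0 : 0 < c by rewrite invr_gt0 mulr_gt0.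
pose G := fun k t => c * D k (t - i%:R).
have bG : is_bump i%:R (i%:R + 1) G by have := bump_shift i%:R c bD; rewrite addr0.
have ii : i%:R <= i%:R + 1 :> R by rewrite lerDl.
have cG k : continuous (G k) by exact: bump_cont bG.
have mG k : measurable_fun setT (G k) by exact: continuous_measurable_fun.
have zG k (h : R -> R) t : ~~ (i%:R < t <= i%:R + 1) -> G k t * h t = 0 by exact: bump_supp bG t.
have Gw k : (k <= r)%N -> forall t, i%:R < t <= i%:R + 1 -> `|G k t * wr alpha r t| <= r.+1%:R^-1.
  move=> kr t /andP[t0 t1]; rewrite normrM (ger0_norm (wr_ge0 _ _ _)).
  have [/wrB wt1|h] := boolP (0 < t - i%:R < 1); last first.
    by rewrite /G bD.2// mulr0 normr0 mul0r invr_ge0.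
  rewrite /G normrM (gtr0_norm c0) -mulrA.
  apply: (@le_trans _ _ (c * (M * (B * wt b i%:R)))).
    rewrite ler_wpM2l ?(ltW c0)// ler_pM ?wr_ge0 ?DM//; exact: wt1.
  rewrite /c /A le_eqVlt; apply/orP; left; apply/eqP; field.
  by rewrite !gt_eqF//= addrC natr1 gt_eqF.
have iGw k : (k <= r)%N -> itg `]i%:R, i%:R + 1] (fun t => G k t * wr alpha r t).
  move=> kr; apply: itg_bounded (Gw k kr); apply: measurable_funTS.
  by apply: measurable_funM => //; exact: meas_wr.
have nG k : (k <= r)%N -> (wnorm alpha r (G k) <= (r.+1%:R^-1)%:E)%E.
  move=> kr; have iT := itg_supp (zG k _) (iGw k kr).
  have -> : wnorm alpha r (G k) = (\int[mu]_t `|G k t * wr alpha r t|)%:E.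
    by rewrite /Rintegral fineK//; apply: integrable_fin_num => //; exact: (itg_norm _ iT).
  rewrite lee_fin (@Rint_supp _ _ i%:R (i%:R + 1)); last by move=> t h; rewrite zG// normr0.
  apply: le_trans (_ : Int i%:R (i%:R + 1) (fun=> r.+1%:R^-1) <= _).
    apply: Int_le; [by apply: itg_norm => //; exact: iGw|exact: itg_cst|exact: Gw].
  by rewrite Int_cst// addrAC subrr add0r mulr1.
have GW : W_ball alpha r (G 0%N).
  split; first exact: cG.
  exists G; split=> //; split; [|split].
  - move=> k kr; split; first exact: mG.
    by apply: le_lt_trans (nG k kr) _; rewrite ltry.
  - by move=> k _; exact: bump_weak ii bG.
  apply: (@le_trans _ _ (\sum_(k < r.+1) (r.+1%:R^-1)%:E)%E).
    by apply: lee_sum => k _; apply: nG; rewrite -ltnS.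
  by rewrite sumEFin lee_fin sumr_const card_ord -[leLHS]mulr_natl divff.
apply: (@le_trans _ _ (quad_err alpha Q (G 0%N))); last by apply: ereal_sup_ubound; exists (G 0%N).
have iW : itg `]i%:R, i%:R + 1] (fun t => G 0%N t * wr alpha 0 t).
  have iw : itg `]i%:R, i%:R + 1] (wt alpha).
    by apply: continuous_itg => t /andP[t0 _]; apply: cont_wt; lra.
  apply: (@eq_itg _ _ (fun t => G 0%N t * wt alpha t)) => //.
    by move=> t /=; rewrite in_itv/= => /andP[t0 _]; rewrite wr_wt ?mul0r ?addr0//; lra.
  apply: (@itgM _ _ _ _ (c * M)) => //; first by apply: measurable_funTS; exact: mG.
  by move=> t _; rewrite /G normrM (gtr0_norm c0) ler_wpM2l ?(ltW c0)// DM.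
have iT := itg_supp (zG 0%N _) iW.
have E : quad_err alpha Q (G 0%N) = (`|Int i%:R (i%:R + 1) (fun t => G 0%N t * wr alpha 0 t)|)%:E.
  have -> : Int i%:R (i%:R + 1) (fun t => G 0%N t * wr alpha 0 t) = \int[mu]_t (G 0%N t * wr alpha 0 t).
    by rewrite (@Rint_supp _ _ i%:R (i%:R + 1))//; exact: zG.
  have Q0 : quad_apply Q (G 0%N) = 0.
    apply: big1_seq => p /andP[_ pQ]; rewrite bG.2 ?mulr0//.
    by apply: free; apply/mapP; exists p.
  by rewrite /quad_err Q0 sube0 /Rintegral -abse_EFin fineK//; exact: integrable_fin_num.
rewrite E lee_fin; apply: le_trans (ler_norm _).
have i4 : i%:R + 4^-1 <= i%:R + 3 / 4 :> R by lra.
have sub : itg `]i%:R + 4^-1, i%:R + 3 / 4] (fun t => G 0%N t * wr alpha 0 t).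
  by apply: itg_oc iW; lra.
apply: le_trans (Int_mono (c := i%:R + 4^-1) (d := i%:R + 3 / 4) iW _ _ _); try lra; last first.
  by move=> t _; rewrite mulr_ge0 ?wr_ge0// mulr_ge0 ?D0// ltW.
apply: le_trans (_ : Int (i%:R + 4^-1) (i%:R + 3 / 4) (fun=> c * (K^-1 * wt alpha i%:R)) <= _); last first.
  apply: Int_le => //; first exact: itg_cst.
  move=> t /andP[t0 t1]; rewrite /G D1; last by apply/andP; split; lra.
  rewrite mulr1 ler_wpM2l ?(ltW c0)// ler_pdivrMl// wr_wt ?mul0r ?addr0; last lra.
  by apply: KP => //; apply/andP; split; lra.
rewrite Int_cst// (_ : i%:R + 3 / 4 - (i%:R + 4^-1) = 2^-1); last by lra.
have si : 0 < Num.sqrt (i%:R : R) by rewrite sqrtr_gt0.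
have wa : 0 < wt alpha i%:R by exact: wt_gt0.
have -> : c * (K^-1 * wt alpha i%:R) * 2^-1 = (2 * K * A)^-1 * Num.sqrt i%:R ^- r.
  rewrite /c /b wt_half//; field.
  by rewrite !gt_eqF ?exprn_gt0.
have KA : 0 <= (2 * K * A)^-1 by rewrite invr_ge0 (mulr_ge0 _ (ltW A0))// mulr_ge0.
rewrite /C -[leLHS]mulrA ler_wpM2l// -invfM -exprMn -sqrtrM//.
rewrite lef_pV2 ?posrE ?exprn_gt0 ?sqrtr_gt0 ?mulr_gt0 ?ltr0n//.
rewrite lerXn2r ?nnegrE ?sqrtr_ge0// ler_wsqrtr// -natrM ler_nat (leq_trans iN)//.
by rewrite mul2n -addnn -addn1 leq_add2l.
Qed.

End LowerBound.

Lemma size_Q2TL (R : realType) (alpha : R) (s : seq R) j : size (Q2TL alpha s j) = (2 * j)%N.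
Proof.
rewrite /Q2TL -[in RHS](size_iota 0 j); elim: (iota 0 j) => //= k t ->.
by rewrite mulnS.
Qed.

Lemma sqrt_rate (R : realType) (n r : nat) : (0 < n)%N ->
  Num.sqrt n%:R ^- r = n%:R `^ (- (r%:R / 2)) :> R.
Proof.
move=> n0; have n1 : 0 <= n%:R :> R by [].
by rewrite powRN mulrC powRrM powR12_sqrt// powR_mulrn// sqrtr_ge0.
Qed.

Theorem theorem2p2 (R : realType) (alpha theta : R) (r : nat)
    (P : nat -> {poly R}) (X : nat -> seq R) (mn : nat -> nat) :
  -1 < alpha -> (0 < r)%N -> 0 < theta < 1 ->
  laguerre_orthonormal alpha P ->
  (forall m, zeros_of (P m) (X m)) ->
  (forall n, (0 < n)%N ->
     (2 * jidx theta (mn n) (X (mn n)) <= n)%N /\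
     (forall m, (2 * jidx theta m (X m) <= n)%N -> (m <= mn n)%N)) ->
  (forall n, (0 < n)%N ->
     (size (Q2TL alpha (X (mn n)) (jidx theta (mn n) (X (mn n)))) <= n)%N) /\
  exists C1 C2 : R, 0 < C1 /\ 0 < C2 /\
    forall n, (0 < n)%N ->
      ((C1 * n%:R `^ (- (3 * r%:R / 4)))%:E <= Int_n alpha n (W_ball alpha r))%E /\
      (Int_n alpha n (W_ball alpha r)
         <= sup_err alpha (W_ball alpha r)
              (Q2TL alpha (X (mn n)) (jidx theta (mn n) (X (mn n)))))%E /\
      (sup_err alpha (W_ball alpha r)
              (Q2TL alpha (X (mn n)) (jidx theta (mn n) (X (mn n))))
         <= (C2 * n%:R `^ (- (r%:R / 2)))%:E)%E.
Proof.
move=> a1 r0 th lag zX mnP; split=> [n n0|]; first by rewrite size_Q2TL; exact: (mnP n n0).1.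
have [C1 C10 low] := lower_bound alpha r.
have [C C0 up] := upper_bound a1 lag zX th r0.
exists C1, (C * Num.sqrt 2 ^+ r + 1); split=> //; split.
  by rewrite ltr_wpDl// mulr_ge0// exprn_ge0// sqrtr_ge0.
move=> n n0; have nR : 1 <= n%:R :> R by rewrite ler1n.
have [jn mmax] := mnP n n0; split; [|split].
(* The exponent is weakened from [r/2] to [3r/4], which is harmless for [n >= 1]. *)
- apply: (@le_trans _ _ (C1 * Num.sqrt n%:R ^- r)%:E).
    rewrite lee_fin sqrt_rate// ler_wpM2l ?(ltW C10)// ler_powR// lerN2.
    by have : 0 <= r%:R :> R by []; lra.
  by apply: le_ereal_inf_tmp => _ [Q sQ <-]; exact: low.
- by apply: ereal_inf_lbound; exists (Q2TL alpha (X (mn n)) (jidx theta (mn n) (X (mn n)))) => //=; rewrite size_Q2TL.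
apply: le_trans (up (mn n)) _; rewrite lee_fin -sqrt_rate//.
apply: (@le_trans _ _ (C * Num.sqrt 2 ^+ r * Num.sqrt n%:R ^- r)); last first.
  by rewrite ler_wpM2r ?lerDl// invr_ge0 exprn_ge0 ?sqrtr_ge0.
rewrite -mulrA ler_wpM2l// -exprVn -[X in _ <= _ * X]exprVn -exprMn lerXn2r ?nnegrE ?mulr_ge0 ?invr_ge0 ?sqrtr_ge0//.
rewrite ler_pdivlMr ?sqrtr_gt0 ?(lt_le_trans ltr01)// ler_pdivrMl ?sqrtr_gt0 ?ltr0n//.
rewrite -sqrtrM ?ler0n// ler_wsqrtr// -natrM ler_nat mulnC.
(* Maximality of [mn n] gives [n < 2 j(m_n + 1)], and [j(m) <= m] turns this into
   [n <= 2 (m_n + 1)]. *)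
have : ~~ (2 * jidx theta (mn n).+1 (X (mn n).+1) <= n)%N by apply/negP => /mmax; rewrite ltnn.
rewrite -ltnNge => /ltnW/leq_trans; apply; rewrite leq_mul2l/=.
exact: jidx_le lag zX _.
Qed.
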